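(* Let $q\ge0$ be an integer and let $J_q$ be the Bessel function of the first kind of order $q$. Let $0<z_1<z_2<\cdots$ be the positive zeros of $J_q$ and $z_{-k}=-z_k$ for $k\ge1$. Then for every $z\in\mathbb{C}$ with $J_q(z)\neq0$, $$J_q(z)=\frac{1}{A^{(0,den)}(z)+\sum_{k=-\infty,\,k\ne0}^{\infty}\frac{a_{-1}^{(k,den)}}{z-z_k}},$$ where for $k\neq0$ $$a_{-1}^{(k,den)}=\left.\frac{1}{\frac{d}{dz}J_q(z)}\right|_{z=z_k}=\frac{2}{J_{q-1}(z_k)-J_{q+1}(z_k)},$$ and $$A^{(0,den)}(z)=\begin{cases}0, & q=0,\\ \sum_{n=1}^{q}\frac{a_{-n}^{(0,den)}}{z^n}, & q\ge1,\end{cases}$$ with $a_{-n}^{(0,den)}$ the coefficient of $z^{-n}$ in the Laurent expansion about $z=0$ of $1/J_q(z)$.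
   Context: Bi-infinite sums are understood as limits of symmetric partial sums, $\sum_{k=-\infty,k\neq0}^\infty=\lim_{N\to\infty}\sum_{1\le|k|\le N}$. Bessel functions of negative integer order are given by $J_{-n}=(-1)^nJ_n$. *)

(* Defs.v *)
(* Stdlib reals with Coquelicot; C is Coquelicot's type of complex numbers. *)
From Stdlib Require Export Reals ZArith.
From Coquelicot Require Export Coquelicot.

Open Scope C_scope.

(* As with RInt, the value is meaningful when the series converges. *)
Definition CSeries (a : nat -> C) : C :=
  iota (T := C_CompleteNormedModule) (fun l => is_series (V := C_NormedModule) a l).

Definition besselJ_nat (n : nat) (z : C) : C :=
  CSeries (fun m =>
    RtoC ((-1) ^ m / (INR (fact m) * INR (fact (m + n)))) * (z / 2) ^ (2 * m + n)).

(* Integer orders, with J_{-n} = (-1)^n J_n. *)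
Definition besselJ (n : Z) (z : C) : C :=
  if (0 <=? n)%Z then besselJ_nat (Z.to_nat n) z
  else RtoC ((-1) ^ Z.abs_nat n) * besselJ_nat (Z.abs_nat n) z.

(* The value at index 0 is unconstrained and never used. *)
Definition bessel_zeros (q : nat) (zk : Z -> R) : Prop :=
  (forall k : Z, (1 <= k)%Z ->
     (0 < zk k)%R /\ (zk k < zk (k + 1)%Z)%R /\
     besselJ (Z.of_nat q) (RtoC (zk k)) = 0 /\
     zk (- k)%Z = (- zk k)%R) /\
  (forall x : R, (0 < x)%R -> besselJ (Z.of_nat q) (RtoC x) = 0 ->
     exists k : Z, (1 <= k)%Z /\ zk k = x).

(* Bi-infinite sum over k <> 0, as the limit of its partial sums over
   1 <= |k| <= N. *)
Definition is_sym_sum (f : Z -> C) (S : C) : Prop :=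
  filterlim
    (fun N : nat =>
       sum_n_m (G := C_AbelianMonoid)
         (fun k => f (Z.of_nat k) + f (- Z.of_nat k)%Z) 1 N)
    eventually (locally (T := C_UniformSpace) S).

(* f(z) = sum_{n in Z} a_n (z - c)^n on some punctured disc about c; the
   regular and the principal part converge separately. *)
Definition is_laurent (f : C -> C) (c : C) (a : Z -> C) : Prop :=
  exists r : R, (0 < r)%R /\
  forall z : C, (0 < Cmod (z - c) < r)%R ->
  exists s t : C,
    is_series (V := C_NormedModule)
      (fun n => a (Z.of_nat n) * (z - c) ^ n) s /\
    is_series (V := C_NormedModule)
      (fun n => a (- Z.of_nat (S n))%Z / (z - c) ^ S n) t /\
    f z = s + t.

Definition laurent_coeff (f : C -> C) (c : C) (n : Z) : C :=
  iota (T := C_CompleteNormedModule)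
    (fun v => exists a : Z -> C, is_laurent f c a /\ a n = v).

Definition inv_besselJ (q : nat) (z : C) : C := 1 / besselJ (Z.of_nat q) z.

Definition pole_coeff (q : nat) (zk : Z -> R) (k : Z) : C :=
  1 / C_derive (besselJ (Z.of_nat q)) (RtoC (zk k)).

Definition A0den (q : nat) (z : C) : C :=
  match q with
  | O => 0
  | S _ =>
      sum_n_m (G := C_AbelianMonoid)
        (fun n => laurent_coeff (inv_besselJ q) 0 (- Z.of_nat n)%Z / z ^ n) 1 q
  end.

(* Main.v *)
(** Cauchy's residue argument for 1/J_q on circles |w| = r_N, where r_N lies between z_N and z_(N+1).
    Removing the polar parts of 1/J_q inside such a circle leaves a function K_N given there by a power
    series, and Cauchy's formula expresses K_N(z) as the mean of w / (J_q(w) (w - z)) over the circle.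
    The radius r_N is a critical point of u(x) = sqrt(x) J_q(x), which solves u'' + (1 - kappa/x^2) u = 0.
    Integrating this equation along the circle from the real point r_N, where u' = 0, gives
    |J_q(w)| >= c e^|Im w| / sqrt(r_N); here |u(r_N)| is bounded below because the energy u^2 + u'^2 stays
    bounded away from 0. Hence K_N(z) = O(r_N^(-1/2)), without any asymptotics of the zeros.

    Cauchy's formula for a disc comes from differentiating
    t |-> int V(a + t (w - a)) w / (w - a) dtheta, whose derivative is the integral of a total derivative. *)
From Stdlib Require Import Lra Lia Psatz Classical.
Require Import Defs.
Open Scope C_scope.

(** * Complex derivatives *)

(** The delicate point is size. On |w| = r the bound on 1/|J_q| is of order sqrt(r) near the real
    axis, so no pointwise estimate tends to 0. The gain comes from the factor e^(-|Im w|), whose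
    mean over the circle is O(1/r), and sqrt(r)/r = r^(-1/2). A critical point of u is a good radius
    because there the whole energy sits in u^2; along the arc in the first quadrant u then stays
    close to u(r) cos(w - r), which grows like e^|Im w|, and the symmetries of J_q give the other
    three arcs. The poles must be known exactly. All zeros of J_q are real by Lommel's argument; the
    positive ones are simple and unbounded, and both facts come from the positivity of the energy,
    that is, from u and u' never vanishing together. [laurent_coeff] is a definite description, so
    matching it with the polar part at 0 requires uniqueness of Laurent expansions, which is reduced
    to Liouville's theorem. Every contour is a circle about 0. Holomorphy is therefore taken to mean
    being the sum of a power series about 0, and division by z - p and inversion have to be shown to
    stay in that class. *)

Notation cdv f z l := (@is_derive C_AbsRing C_NormedModule f%C z%C (l%C : C)) (only parsing).
Notation ccont f z := (@continuous C_UniformSpace C_UniformSpace f%C z%C) (only parsing).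
Notation cser a l := (@is_series C_AbsRing C_NormedModule a%C (l%C : C)) (only parsing).

Lemma Cmod_sub_comm (a b : C) : Cmod (a - b) = Cmod (b - a).
Proof. rewrite <- Cmod_opp. f_equal. ring. Qed.

Lemma Cmod_sub_ge (a b : C) : (Cmod a - Cmod b <= Cmod (a - b))%R.
Proof.
  pose proof (Cmod_triangle (a - b) b) as H.
  replace (a - b + b) with a in H by ring. lra.
Qed.

Lemma Cmod_sub_le (a b : C) : (Cmod (a - b) <= Cmod a + Cmod b)%R.
Proof.
  pose proof (Cmod_triangle a (- b)) as H. rewrite Cmod_opp in H. exact H.
Qed.

Lemma Cmod_le_Re_Im (c : C) : (Cmod c <= Rabs (Re c) + Rabs (Im c))%R.
Proof.
  replace c with (RtoC (Re c) + RtoC (Im c) * Ci) at 1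
    by (destruct c; unfold Cplus, Cmult, Ci, RtoC, Re, Im; simpl; f_equal; ring).
  eapply Rle_trans. apply Cmod_triangle.
  rewrite Cmod_mult, Cmod_Ci, !Cmod_R. lra.
Qed.

Lemma Im_le_Cmod (c : C) : (Rabs (Im c) <= Cmod c)%R.
Proof.
  eapply Rle_trans; [|apply Rmax_Cmod]. apply Rmax_r.
Qed.

Lemma Cmod_pos_neq (c : C) : (0 < Cmod c)%R -> c <> 0.
Proof. intros H ->. rewrite Cmod_0 in H. lra. Qed.

Lemma ball_of_Cmod (x y : C) (e : R) : (Cmod (y - x) < e)%R -> ball (M := C_UniformSpace) x e y.
Proof. exact (C_NormedModule_mixin_compat1 x y e). Qed.

(** Balls of the uniform space [C] are squares, since its structure is that of a product of two
    lines. Passing to the modulus costs a factor sqrt 2, which halving the radius absorbs. *)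
Lemma Cmod_of_ball (x y : C) (e : R) : (0 < e)%R ->
  ball (M := C_UniformSpace) x (e / 2) y -> (Cmod (y - x) < e)%R.
Proof.
  intros He H.
  assert (He2 : (0 < e / 2)%R) by lra.
  pose proof (C_NormedModule_mixin_compat2 x y (mkposreal _ He2) H) as H1.
  simpl in H1. change (minus y x) with (y - x) in H1.
  assert (sqrt 2 < 2)%R.
  { rewrite <- (sqrt_Rsqr 2) at 2 by lra. apply sqrt_lt_1_alt. unfold Rsqr; lra. }
  nra.
Qed.

Lemma ccont_iff (f : C -> C) (z : C) :
  ccont f z <-> forall e, (0 < e)%R -> exists d, (0 < d)%R /\
    forall w, (Cmod (w - z) < d)%R -> (Cmod (f w - f z) < e)%R.
Proof.
  split.
  - intros H e He.
    assert (He2 : (0 < e / 2)%R) by lra.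
    destruct (proj1 (filterlim_locally f (f z)) H (mkposreal _ He2)) as [d Hd].
    exists d. split. apply cond_pos.
    intros w Hw. apply Cmod_of_ball; [lra|]. apply Hd. apply ball_of_Cmod. exact Hw.
  - intros H. apply filterlim_locally. intros e.
    destruct (H e (cond_pos e)) as [d [Hd H1]].
    assert (Hd2 : (0 < d / 2)%R) by lra.
    exists (mkposreal _ Hd2). intros w Hw. apply ball_of_Cmod. apply H1.
    apply Cmod_of_ball; [lra|]. exact Hw.
Qed.

Lemma cdv_iff (f : C -> C) (z l : C) :
  cdv f z l <-> forall e, (0 < e)%R -> exists d, (0 < d)%R /\
    forall w, (Cmod (w - z) < d)%R ->
    (Cmod (f w - f z - (w - z) * l) <= e * Cmod (w - z))%R.
Proof.
  split.
  - intros [_ H] e He.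
    destruct (H z (fun P HP => HP) (mkposreal e He)) as [d Hd].
    exists d. split. apply cond_pos. intros w Hw. exact (Hd w Hw).
  - intros H. split. apply is_linear_scal_l.
    intros x Hx.
    apply (is_filter_lim_locally_unique (V := AbsRing_NormedModule C_AbsRing)) in Hx. subst x.
    intros e. destruct (H e (cond_pos e)) as [d [Hd H1]].
    exists (mkposreal d Hd). intros w Hw. exact (H1 w Hw).
Qed.

Lemma cdv_unique (f : C -> C) (z l l' : C) : cdv f z l -> cdv f z l' -> l = l'.
Proof.
  intros H H'. rewrite <- (is_C_derive_unique f z l H). apply is_C_derive_unique. exact H'.
Qed.

Lemma cdv_cont (f : C -> C) (z l : C) : cdv f z l -> ccont f z.
Proof.
  intros H. apply ccont_iff. intros e He.
  destruct (proj1 (cdv_iff f z l) H 1%R Rlt_0_1) as [d [Hd H1]].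
  pose proof (Cmod_ge_0 l) as Hl.
  exists (Rmin d (e / (Cmod l + 2))). split.
  { apply Rmin_pos; [lra|]. apply Rdiv_lt_0_compat; lra. }
  intros w Hw.
  destruct (Rmin_Rgt_l _ _ _ Hw) as [Hw1 Hw2].
  specialize (H1 w Hw1).
  replace (f w - f z) with ((f w - f z - (w - z) * l) + (w - z) * l) by ring.
  eapply Rle_lt_trans. apply Cmod_triangle. rewrite Cmod_mult.
  apply Rmult_lt_compat_r with (r := (Cmod l + 2)%R) in Hw2; [|lra].
  replace (e / (Cmod l + 2) * (Cmod l + 2))%R with e in Hw2 by (field; lra).
  pose proof (Cmod_ge_0 (w - z)). nra.
Qed.

Lemma cdv_ext_loc (f g : C -> C) (z l : C) (r : R) : (0 < r)%R ->
  (forall w, (Cmod (w - z) < r)%R -> f w = g w) -> cdv f z l -> cdv g z l.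
Proof.
  intros Hr E H. apply cdv_iff. intros e He.
  destruct (proj1 (cdv_iff f z l) H e He) as [d [Hd H1]].
  exists (Rmin d r). split. apply Rmin_pos; lra.
  intros w Hw. rewrite <- (E w), <- (E z).
  - apply H1. eapply Rlt_le_trans; [exact Hw | apply Rmin_l].
  - replace (z - z) with (RtoC 0) by ring. rewrite Cmod_0. exact Hr.
  - eapply Rlt_le_trans; [exact Hw | apply Rmin_r].
Qed.

Lemma cdv_ext (f g : C -> C) (z l : C) : (forall w, f w = g w) -> cdv f z l -> cdv g z l.
Proof. intros E. apply cdv_ext_loc with (r := 1%R). lra. auto. Qed.

Lemma cdv_const (a z : C) : cdv (fun _ => a) z 0.
Proof. exact (is_derive_const (K := C_AbsRing) (V := C_NormedModule) a z). Qed.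

Lemma cdv_id (z : C) : cdv (fun w => w) z 1.
Proof.
  apply cdv_iff. intros e He. exists 1%R. split; [lra|]. intros w _.
  replace (w - z - (w - z) * 1) with (RtoC 0) by ring. rewrite Cmod_0.
  apply Rmult_le_pos; [lra | apply Cmod_ge_0].
Qed.

Lemma cdv_plus (f g : C -> C) (z l m : C) :
  cdv f z l -> cdv g z m -> cdv (fun w => f w + g w) z (l + m).
Proof. exact (is_derive_plus (K := C_AbsRing) (V := C_NormedModule) f g z l m). Qed.

Lemma cdv_minus (f g : C -> C) (z l m : C) :
  cdv f z l -> cdv g z m -> cdv (fun w => f w - g w) z (l - m).
Proof. exact (is_derive_minus (K := C_AbsRing) (V := C_NormedModule) f g z l m). Qed.

Lemma cdv_mult (f g : C -> C) (z l m : C) :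
  cdv f z l -> cdv g z m -> cdv (fun w => f w * g w) z (l * g z + f z * m).
Proof.
  intros Hf Hg. apply cdv_iff. intros e He.
  pose proof (proj1 (ccont_iff _ _) (cdv_cont _ _ _ Hg)) as Cg.
  (* [a] collects the coefficients of the three error terms of the splitting below, so that e' <= 1
     and e' a <= e suffice. *)
  set (a := (Cmod (g z) + Cmod l + Cmod (f z) + 3)%R).
  pose proof (Cmod_ge_0 (g z)) as K1; pose proof (Cmod_ge_0 l) as K2; pose proof (Cmod_ge_0 (f z)) as K3.
  assert (Ha : (0 < a)%R) by (unfold a; lra).
  set (e' := Rmin 1 (e / a)).
  assert (He' : (0 < e')%R) by (apply Rmin_pos; [lra | apply Rdiv_lt_0_compat; lra]).
  assert (He1 : (e' <= 1)%R) by apply Rmin_l.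
  assert (He2 : (e' * a <= e)%R).
  { apply Rle_trans with (e / a * a)%R; [|right; field; lra].
    apply Rmult_le_compat_r; [lra | apply Rmin_r]. }
  destruct (proj1 (cdv_iff _ _ _) Hf _ He') as [d1 [Hd1 H1]].
  destruct (proj1 (cdv_iff _ _ _) Hg _ He') as [d2 [Hd2 H2]].
  destruct (Cg _ He') as [d3 [Hd3 H3]].
  exists (Rmin d1 (Rmin d2 d3)). split. repeat apply Rmin_pos; lra.
  intros w Hw.
  destruct (Rmin_Rgt_l _ _ _ Hw) as [Hw1 Hw23].
  destruct (Rmin_Rgt_l _ _ _ Hw23) as [Hw2 Hw3].
  specialize (H1 w Hw1). specialize (H2 w Hw2). specialize (H3 w Hw3).
  replace (f w * g w - f z * g z - (w - z) * (l * g z + f z * m))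
    with ((f w - f z - (w - z) * l) * (g z + (g w - g z))
          + (w - z) * l * (g w - g z) + f z * (g w - g z - (w - z) * m)) by ring.
  eapply Rle_trans. apply Cmod_triangle.
  eapply Rle_trans. apply Rplus_le_compat_r. apply Cmod_triangle.
  rewrite !Cmod_mult.
  pose proof (Cmod_triangle (g z) (g w - g z)) as H4.
  set (x := Cmod (w - z)) in *. assert (0 <= x)%R by apply Cmod_ge_0.
  pose proof (Cmod_ge_0 (g z + (g w - g z))).
  pose proof (Cmod_ge_0 (f w - f z - (w - z) * l)).
  apply Rle_trans with (e' * a * x)%R; [|apply Rmult_le_compat_r; lra].
  assert (Cmod (f w - f z - (w - z) * l) * Cmod (g z + (g w - g z)) <= e' * x * (Cmod (g z) + 1))%R
    by (apply Rmult_le_compat; lra).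
  assert (x * Cmod l * Cmod (g w - g z) <= x * Cmod l * e')%R
    by (apply Rmult_le_compat_l; nra).
  assert (Cmod (f z) * Cmod (g w - g z - (w - z) * m) <= Cmod (f z) * (e' * x))%R
    by (apply Rmult_le_compat_l; lra).
  assert (0 <= e' * x)%R by nra.
  unfold a. nra.
Qed.

Lemma cdv_comp (f g : C -> C) (z l m : C) :
  cdv f (g z) l -> cdv g z m -> cdv (fun w => f (g w)) z (m * l).
Proof.
  intros Hf Hg. apply cdv_iff. intros e He.
  pose proof (Cmod_ge_0 m) as Km. pose proof (Cmod_ge_0 l) as Kl.
  set (e1 := (e / (2 * (Cmod m + 1)))%R). set (e2 := Rmin 1 (e / (2 * (Cmod l + 1)))%R).
  assert (He1 : (0 < e1)%R) by (apply Rdiv_lt_0_compat; lra).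
  assert (He2 : (0 < e2)%R) by (apply Rmin_pos; [lra | apply Rdiv_lt_0_compat; lra]).
  assert (Q1 : (e1 * (Cmod m + 1) = e / 2)%R) by (unfold e1; field; lra).
  assert (Q2 : (e2 * (Cmod l + 1) <= e / 2)%R).
  { apply Rle_trans with (e / (2 * (Cmod l + 1)) * (Cmod l + 1))%R; [|right; field; lra].
    apply Rmult_le_compat_r; [lra | apply Rmin_r]. }
  assert (Q3 : (e2 <= 1)%R) by apply Rmin_l.
  destruct (proj1 (cdv_iff _ _ _) Hf _ He1) as [d1 [Hd1 H1]].
  destruct (proj1 (cdv_iff _ _ _) Hg _ He2) as [d2 [Hd2 H2]].
  destruct (proj1 (ccont_iff _ _) (cdv_cont _ _ _ Hg) _ Hd1) as [d3 [Hd3 H3]].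
  exists (Rmin d2 d3). split. repeat apply Rmin_pos; lra.
  intros w Hw.
  destruct (Rmin_Rgt_l _ _ _ Hw) as [Hw2 Hw3].
  specialize (H2 w Hw2). specialize (H1 _ (H3 w Hw3)).
  replace (f (g w) - f (g z) - (w - z) * (m * l))
    with ((f (g w) - f (g z) - (g w - g z) * l) + (g w - g z - (w - z) * m) * l) by ring.
  eapply Rle_trans. apply Cmod_triangle. rewrite Cmod_mult.
  set (x := Cmod (w - z)) in *. assert (Kx : (0 <= x)%R) by apply Cmod_ge_0.
  assert (H4 : (Cmod (g w - g z) <= (Cmod m + 1) * x)%R).
  { replace (g w - g z) with ((g w - g z - (w - z) * m) + (w - z) * m) by ring.
    eapply Rle_trans. apply Cmod_triangle. rewrite Cmod_mult. fold x. nra. }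
  pose proof (Cmod_ge_0 (g w - g z - (w - z) * m)) as K5.
  assert (e1 * Cmod (g w - g z) <= e1 * ((Cmod m + 1) * x))%R by (apply Rmult_le_compat_l; lra).
  assert (Cmod (g w - g z - (w - z) * m) * Cmod l <= e2 * x * Cmod l)%R by (apply Rmult_le_compat_r; lra).
  nra.
Qed.

Lemma cdv_val (f : C -> C) (z l m : C) : l = m -> cdv f z l -> cdv f z m.
Proof. intros ->. auto. Qed.

Lemma cdv_scal (a : C) (f : C -> C) (z l : C) : cdv f z l -> cdv (fun w => a * f w) z (a * l).
Proof.
  intros H. apply cdv_val with (0 * f z + a * l); [ring|].
  apply cdv_mult. apply cdv_const. exact H.
Qed.

Lemma cdv_inv_id (z : C) : z <> 0 -> cdv (fun w => / w) z (- / (z * z)).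
Proof.
  intros Hz. apply cdv_iff. intros e He.
  assert (Hm : (0 < Cmod z)%R) by (apply Cmod_gt_0; exact Hz).
  set (m := Cmod z) in *.
  (* The error is exactly (w - z)^2 / (w z^2). The first bound keeps |w| above m/2, the second then
     makes |w - z| / (|w| m^2) at most e. *)
  exists (Rmin (m / 2) (e * m * m * m / 2)). split.
  { apply Rmin_pos; [lra|]. assert (0 < e * m * m * m)%R by (repeat apply Rmult_lt_0_compat; lra). lra. }
  intros w Hw.
  destruct (Rmin_Rgt_l _ _ _ Hw) as [H1 H2].
  assert (Hw2 : (m / 2 < Cmod w)%R).
  { pose proof (Cmod_sub_ge z w). rewrite Cmod_sub_comm in H. fold m in H. lra. }
  assert (Hw0 : w <> 0) by (apply Cmod_pos_neq; lra).
  replace (/ w - / z - (w - z) * - / (z * z)) with ((w - z) * (w - z) / (w * (z * z)))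
    by (field; auto).
  rewrite Cmod_div, !Cmod_mult by (repeat apply Cmult_neq_0; auto). fold m.
  pose proof (Cmod_ge_0 (w - z)) as H0.
  assert (Hd : (m / 2 * (m * m) <= Cmod w * (m * m))%R) by (apply Rmult_le_compat_r; nra).
  assert (Hp : (0 < m / 2 * (m * m))%R) by nra.
  apply Rle_trans with (Cmod (w - z) * Cmod (w - z) / (m / 2 * (m * m)))%R.
  - apply Rmult_le_compat_l; [nra|]. apply Rinv_le_contravar; lra.
  - apply Rmult_le_reg_r with (m / 2 * (m * m))%R; [lra|].
    unfold Rdiv at 1. rewrite Rmult_assoc, Rinv_l, Rmult_1_r by lra.
    assert (Cmod (w - z) <= e * (m / 2 * (m * m)))%R by lra.
    replace (e * Cmod (w - z) * (m / 2 * (m * m)))%R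
      with (Cmod (w - z) * (e * (m / 2 * (m * m))))%R by ring.
    apply Rmult_le_compat_l; lra.
Qed.

Lemma cdv_inv (f : C -> C) (z l : C) : f z <> 0 -> cdv f z l ->
  cdv (fun w => / f w) z (- l / (f z * f z)).
Proof.
  intros H0 H. apply cdv_val with (l * - / (f z * f z)).
  { field. exact H0. }
  apply (cdv_comp (fun w => / w)). apply cdv_inv_id; auto. exact H.
Qed.

Lemma cdv_pow (n : nat) (z : C) : cdv (fun w => w ^ S n) z (RtoC (INR (S n)) * z ^ n).
Proof.
  induction n.
  - apply cdv_ext with (fun w => w). intros; simpl; ring.
    apply cdv_val with (RtoC 1). simpl; ring. apply cdv_id.
  - apply cdv_ext with (fun w => w * w ^ S n). intros; simpl; ring.
    apply cdv_val with (1 * z ^ S n + z * (RtoC (INR (S n)) * z ^ n)).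
    + rewrite (S_INR (S n)), RtoC_plus. simpl; ring.
    + apply cdv_mult. apply cdv_id. exact IHn.
Qed.

Lemma cdv_shift_pole (p z : C) : z <> p -> cdv (fun w => / (w - p)) z (- / ((z - p) * (z - p))).
Proof.
  intros H. assert (z - p <> 0) by (intros E; apply H; replace z with (z - p + p) by ring; rewrite E; ring).
  apply cdv_val with (- (1 - 0) / ((z - p) * (z - p))). field; auto.
  apply (cdv_inv (fun w => w - p)); auto. apply cdv_minus. apply cdv_id. apply cdv_const.
Qed.

(** * Complex power series *)

Notation csum_n := (sum_n (G := C_AbelianMonoid)).

Lemma cser_unique (a : nat -> C) (l l' : C) : cser a l -> cser a l' -> l = l'.
Proof.
  exact (filterlim_locally_unique (V := C_NormedModule) (F := eventually) (sum_n a) l l').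
Qed.

Lemma cser_plus (a b : nat -> C) (l m : C) : cser a l -> cser b m -> cser (fun n => a n + b n) (l + m).
Proof. exact (is_series_plus (V := C_NormedModule) a b l m). Qed.

Lemma cser_scal (c : C) (a : nat -> C) (l : C) : cser a l -> cser (fun n => c * a n) (c * l).
Proof. exact (is_series_scal (V := C_NormedModule) c a l). Qed.

Lemma cser_ext (a b : nat -> C) (l : C) : (forall n, a n = b n) -> cser a l -> cser b l.
Proof. exact (is_series_ext (V := C_NormedModule) a b l). Qed.

Lemma cser_tail (a : nat -> C) (l : C) : cser a l -> cser (fun n => a (S n)) (l - a O).
Proof.
  intros H. apply (is_series_incr_1 (V := C_NormedModule)).
  change (cser a (l - a O + a O)).
  replace (l - a O + a O) with l by ring. exact H.
Qed.

Lemma cser_cons (a : nat -> C) (l : C) : cser (fun n => a (S n)) l -> cser a (a O + l).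
Proof.
  intros H. apply (is_series_decr_1 (V := C_NormedModule)).
  change (cser (fun n => a (S n)) (a O + l + - a O)).
  replace (a O + l + - a O) with l by ring. exact H.
Qed.

(** Turns the definite description [CSeries] into a usable value: every later evaluation of a power
    series exhibits a convergent series with the wanted sum and ends here. *)
Lemma cser_value (a : nat -> C) (l : C) : cser a l -> CSeries a = l.
Proof.
  intros H. unfold CSeries. apply (iota_unique (V := C_CompleteNormedModule)); [|exact H].
  intros y Hy. exact (cser_unique a y l Hy H).
Qed.

Lemma cser_dominated (a : nat -> C) (b : nat -> R) :
  (forall n, (Cmod (a n) <= b n)%R) -> ex_series b -> cser a (CSeries a).
Proof.
  intros H Hb. destruct (ex_series_le (V := C_CompleteNormedModule) a b H Hb) as [l Hl].
  rewrite (cser_value a l Hl). exact Hl.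
Qed.

Lemma cser_Cmod_le (a : nat -> C) (b : nat -> R) (l : C) (m : R) :
  (forall n, (Cmod (a n) <= b n)%R) -> cser a l -> is_series b m -> (Cmod l <= m)%R.
Proof.
  intros H Ha Hb.
  assert (H1 : is_lim_seq (fun n => Cmod (csum_n a n)) (Cmod l)).
  { apply (filterlim_comp _ _ _ _ (fun x : C => Cmod x) _ _ _ Ha).
    exact (filterlim_norm (V := C_NormedModule) l). }
  assert (H2 : is_lim_seq (sum_n b) m) by exact Hb.
  refine (is_lim_seq_le _ _ (Finite (Cmod l)) (Finite m) _ H1 H2).
  intros n. induction n.
  - rewrite !sum_O. apply H.
  - rewrite !sum_Sn. eapply Rle_trans. apply Cmod_triangle.
    apply Rplus_le_compat; auto.
Qed.

Lemma cser_bounded (a : nat -> C) (l : C) : cser a l -> exists M, forall n, (Cmod (a n) <= M)%R.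
Proof.
  intros H.
  (* From some index on, two consecutive partial sums are within 1 of the limit, so their
     difference, a single term, has modulus at most 2. The finitely many earlier terms are bounded
     separately. *)
  destruct (proj1 (filterlim_locally (csum_n a) l) H (mkposreal (1/2) ltac:(lra))) as [N HN].
  assert (H1 : forall n, (N <= n)%nat -> (Cmod (a (S n)) <= 2)%R).
  { intros n Hn.
    assert (A1 : (Cmod (csum_n a n - l) < 1)%R).
    { apply Cmod_of_ball; [lra|]. exact (HN n Hn). }
    assert (A2 : (Cmod (csum_n a (S n) - l) < 1)%R).
    { apply Cmod_of_ball; [lra|]. apply (HN (S n)). lia. }
    rewrite sum_Sn in A2. change plus with Cplus in A2.
    replace (a (S n)) with ((csum_n a n + a (S n) - l) - (csum_n a n - l)) by ring.
    eapply Rle_trans. apply Cmod_sub_le. lra. }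
  clear H HN.
  assert (H2 : exists M, forall n, (n <= N)%nat -> (Cmod (a n) <= M)%R).
  { clear H1. induction N.
    - exists (Cmod (a O)). intros n Hn. replace n with O by lia. lra.
    - destruct IHN as [M HM]. exists (Rmax M (Cmod (a (S N)))). intros n Hn.
      destruct (Nat.eq_dec n (S N)) as [->|]; [apply Rmax_r|].
      eapply Rle_trans; [apply HM; lia | apply Rmax_l]. }
  destruct H2 as [M HM]. exists (Rmax M 2). intros n.
  destruct (le_lt_dec n N) as [Hn|Hn].
  - eapply Rle_trans; [apply HM; lia | apply Rmax_l].
  - destruct n; [lia|]. eapply Rle_trans; [apply H1; lia | apply Rmax_r].
Qed.

Definition psum (c : nat -> C) (z : C) : C := CSeries (fun n => c n * z ^ n).

Definition cbound (c : nat -> C) (r : R) : Prop :=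
  exists M, forall n, (Cmod (c n) * r ^ n <= M)%R.

(** Radius of convergence at least [R0], expressed by Abel's criterion: the terms are bounded at
    every smaller radius. Boundedness passes to shifts, sums and derivatives more easily than
    summability, which [rad_abs] recovers. *)
Definition rad (c : nat -> C) (R0 : R) : Prop := forall r, (0 <= r < R0)%R -> cbound c r.

Lemma cbound_le (c : nat -> C) (r s : R) : (0 <= r <= s)%R -> cbound c s -> cbound c r.
Proof.
  intros H [M HM]. exists M. intros n. eapply Rle_trans; [|apply HM].
  apply Rmult_le_compat_l; [apply Cmod_ge_0 | apply pow_incr; lra].
Qed.

Lemma rad_abs (c : nat -> C) (R0 r : R) : rad c R0 -> (0 <= r < R0)%R ->
  ex_series (fun n => Cmod (c n) * r ^ n)%R.
Proof.
  intros H Hr. set (s := ((r + R0) / 2)%R).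
  destruct (H s) as [M HM]. unfold s; lra.
  assert (Hs : (r < s)%R) by (unfold s; lra).
  apply (ex_series_le (V := R_CompleteNormedModule) _ (fun n => M * (r / s) ^ n)%R).
  - intros n. change norm with Rabs. rewrite Rabs_pos_eq
      by (apply Rmult_le_pos; [apply Cmod_ge_0 | apply pow_le; lra]).
    replace (r ^ n)%R with (s ^ n * (r / s) ^ n)%R
      by (rewrite <- Rpow_mult_distr; f_equal; field; lra).
    rewrite <- Rmult_assoc. apply Rmult_le_compat_r; [|apply HM].
    apply pow_le. apply Rle_div_r; lra.
  - apply (ex_series_scal_l M (fun n => (r / s) ^ n)%R). apply ex_series_geom.
    rewrite Rabs_pos_eq by (apply Rle_div_r; lra).
    apply (Rlt_div_l r 1 s); lra.
Qed.

Lemma psum_correct (c : nat -> C) (R0 : R) (z : C) : rad c R0 -> (Cmod z < R0)%R ->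
  cser (fun n => c n * z ^ n) (psum c z).
Proof.
  intros H Hz. apply cser_dominated with (fun n => Cmod (c n) * Cmod z ^ n)%R.
  - intros n. rewrite Cmod_mult, Cmod_pow. lra.
  - apply rad_abs with R0; auto. split; auto. apply Cmod_ge_0.
Qed.

Lemma rad_shift (c : nat -> C) (R0 : R) : rad c R0 -> rad (fun n => c (S n)) R0.
Proof.
  intros H r Hr. set (s := ((r + R0) / 2)%R).
  assert (Hs : (r <= s < R0 /\ 0 < s)%R) by (unfold s; lra).
  apply cbound_le with s; [lra|].
  destruct (H s) as [M HM]; [lra|]. exists (M / s)%R. intros n.
  apply (proj1 (Rle_div_r _ _ s ltac:(lra))). eapply Rle_trans; [|apply (HM (S n))]. simpl; lra.
Qed.

(** Bernoulli's inequality for 1/x = 1 + h gives 1 + n h <= x^(-n), so the linear factor is absorbed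
    by the geometric decay; x/(1 - x) is 1/h. *)
Lemma n_pow_bound (x : R) (n : nat) : (0 < x < 1)%R -> (INR (S n) * x ^ n <= 1 + x / (1 - x))%R.
Proof.
  intros Hx. set (h := ((1 - x) / x)%R).
  assert (Hh : (0 < h)%R) by (apply Rdiv_lt_0_compat; lra).
  assert (E : (x * (1 + h) = 1)%R) by (unfold h; field; lra).
  replace (x / (1 - x))%R with (/ h)%R by (unfold h; field; lra).
  assert (B : (1 + INR n * h <= (1 + h) ^ n)%R) by (apply poly; lra).
  assert (P : (x ^ n * (1 + h) ^ n = 1)%R) by (rewrite <- Rpow_mult_distr, E, pow1; lra).
  assert (Q : (0 < x ^ n)%R) by (apply pow_lt; lra).
  assert (0 <= INR n)%R by apply pos_INR.
  assert (K : (INR (S n) <= (1 + / h) * (1 + h) ^ n)%R).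
  { apply Rle_trans with ((1 + / h) * (1 + INR n * h))%R.
    - rewrite S_INR. assert (0 < / h)%R by (apply Rinv_0_lt_compat; lra).
      replace ((1 + / h) * (1 + INR n * h))%R with (1 + INR n + / h + INR n * h)%R by (field; lra).
      nra.
    - apply Rmult_le_compat_l; auto. assert (0 < / h)%R by (apply Rinv_0_lt_compat; lra). lra. }
  apply Rle_trans with ((1 + / h) * (1 + h) ^ n * x ^ n)%R.
  - apply Rmult_le_compat_r; lra.
  - right. rewrite Rmult_assoc, (Rmult_comm ((1 + h) ^ n)), P. ring.
Qed.

Lemma rad_mul_n (c : nat -> C) (R0 : R) : rad c R0 -> rad (fun n => RtoC (INR (S n)) * c n) R0.
Proof.
  intros H r0 Hr0.
  set (r := ((r0 + R0) / 2)%R). assert (Hr : (r0 <= r < R0 /\ 0 < r)%R) by (unfold r; lra).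
  apply cbound_le with r; [lra|].
  set (s := ((r + R0) / 2)%R). assert (Hs : (r < s < R0)%R) by (unfold s; lra).
  destruct (H s) as [M HM]; [lra|].
  assert (HM0 : (0 <= M)%R).
  { eapply Rle_trans; [|apply (HM O)]. simpl. rewrite Rmult_1_r. apply Cmod_ge_0. }
  exists (M * (1 + r / s / (1 - r / s)))%R. intros n.
  rewrite Cmod_mult, Cmod_R, Rabs_pos_eq by apply pos_INR.
  replace (r ^ n)%R with (s ^ n * (r / s) ^ n)%R
      by (rewrite <- Rpow_mult_distr; f_equal; field; lra).
  replace (INR (S n) * Cmod (c n) * (s ^ n * (r / s) ^ n))%R
    with ((Cmod (c n) * s ^ n) * (INR (S n) * (r / s) ^ n))%R by ring.
  apply Rmult_le_compat; auto.
  - apply Rmult_le_pos; [apply Cmod_ge_0 | apply pow_le; lra].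
  - apply Rmult_le_pos; [apply pos_INR | apply pow_le; apply Rle_div_r; lra].
  - apply n_pow_bound. split; [apply Rdiv_lt_0_compat; lra | apply (Rlt_div_l r 1 s); lra].
Qed.

Definition pder (c : nat -> C) (n : nat) : C := RtoC (INR (S n)) * c (S n).

Lemma rad_pder (c : nat -> C) (R0 : R) : rad c R0 -> rad (pder c) R0.
Proof.
  intros H r Hr. 
  apply (rad_mul_n (fun n => c (S n)) R0); auto. apply rad_shift; auto.
Qed.

(** The second-order Taylor remainder of a monomial, by the recursion D_(n+1) = w D_n + (w - z)^2 (n
    + 1) z^n. The factor [rho] on the left spares the exponent n - 1, which would be awkward at n =
    0. *)
Lemma pow_second_difference (rho : R) (z w : C) (n : nat) : (0 <= rho)%R ->
  (Cmod z <= rho)%R -> (Cmod w <= rho)%R ->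
  (rho * Cmod (w ^ S n - z ^ S n - (w - z) * (RtoC (INR (S n)) * z ^ n))
   <= Cmod (w - z) ^ 2 * (INR (S n) * INR (S n) * rho ^ n))%R.
Proof.
  intros Hr Hz Hw. induction n.
  - replace (w ^ 1 - z ^ 1 - (w - z) * (RtoC (INR 1) * z ^ 0)) with (RtoC 0) by (simpl; ring).
    rewrite Cmod_0. simpl. nra.
  - set (D := w ^ S n - z ^ S n - (w - z) * (RtoC (INR (S n)) * z ^ n)) in *.
    replace (w ^ S (S n) - z ^ S (S n) - (w - z) * (RtoC (INR (S (S n))) * z ^ S n))
      with (w * D + (w - z) ^ 2 * (RtoC (INR (S n)) * z ^ n))
      by (unfold D; rewrite (S_INR (S n)), RtoC_plus; simpl; ring).
    apply Rle_trans with (rho * (Cmod w * Cmod D + Cmod (w - z) ^ 2 * (INR (S n) * rho ^ n)))%R.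
    + apply Rmult_le_compat_l; auto. eapply Rle_trans. apply Cmod_triangle.
      rewrite !Cmod_mult, !Cmod_pow, Cmod_R, Rabs_pos_eq by apply pos_INR.
      apply Rplus_le_compat_l. apply Rmult_le_compat_l. apply pow2_ge_0.
      apply Rmult_le_compat_l. apply pos_INR. apply pow_incr. split; auto. apply Cmod_ge_0.
    + set (x := (Cmod (w - z) ^ 2)%R) in *. assert (0 <= x)%R by apply pow2_ge_0.
      pose proof (Cmod_ge_0 D). pose proof (Cmod_ge_0 w).
      assert (Hp : (0 <= rho ^ n)%R) by (apply pow_le; auto).
      rewrite (S_INR (S n)). set (m := INR (S n)) in *. assert (0 <= m)%R by apply pos_INR.
      apply Rle_trans with (rho * (x * (m * m * rho ^ n)) + rho * (x * (m * rho ^ n)))%R.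
      { rewrite Rmult_plus_distr_l. apply Rplus_le_compat_r. apply Rmult_le_compat_l; auto.
        apply Rle_trans with (rho * Cmod D)%R; auto. apply Rmult_le_compat_r; auto. }
      simpl pow.
      replace (rho * (x * (m * m * rho ^ n)) + rho * (x * (m * rho ^ n)))%R
        with (x * rho * rho ^ n * (m * m + m))%R by ring.
      replace (x * ((m + 1) * (m + 1) * (rho * rho ^ n)))%R
        with (x * rho * rho ^ n * ((m + 1) * (m + 1)))%R by ring.
      apply Rmult_le_compat_l; [|nra].
      apply Rmult_le_pos; [apply Rmult_le_pos|]; assumption.
Qed.

Lemma psum_cdv (c : nat -> C) (R0 : R) (z : C) : rad c R0 -> (Cmod z < R0)%R ->
  cdv (psum c) z (psum (pder c) z).
Proof.
  intros H Hz. pose proof (Cmod_ge_0 z) as Hz0.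
  set (rho := ((Cmod z + R0) / 2)%R).
  assert (Hrho : (Cmod z < rho < R0)%R) by (unfold rho; lra).
  (* The series with terms (n + 1)^2 |c_(n+1)| rho^n has a finite sum [B]. By
     [pow_second_difference], summed termwise, the Taylor remainder of [psum c] is then at most |w -
     z|^2 B / rho. *)
  assert (HE : rad (fun n => RtoC (INR (S n)) * (RtoC (INR (S n)) * c (S n))) R0).
  { apply (rad_mul_n (fun n => RtoC (INR (S n)) * c (S n))). apply (rad_mul_n (fun n => c (S n))).
    apply rad_shift. exact H. }
  destruct (rad_abs _ _ rho HE) as [B HB]; [lra|].
  assert (HB0 : (0 <= B)%R).
  { eapply Rle_trans; [apply Cmod_ge_0|].
    eapply (cser_Cmod_le (fun n => RtoC (INR (S n)) * (RtoC (INR (S n)) * c (S n)) * RtoC rho ^ n)); [|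
      apply (psum_correct _ R0 _ HE); rewrite Cmod_R, Rabs_pos_eq; lra | exact HB].
    intros n. rewrite (Cmod_mult _ (RtoC rho ^ n)), Cmod_pow, Cmod_R, Rabs_pos_eq by lra. lra. }
  assert (M : forall w, (Cmod w <= rho)%R ->
    (Cmod (psum c w - psum c z - (w - z) * psum (pder c) z) <= Cmod (w - z) ^ 2 * (B / rho))%R).
  { intros w Hw.
    pose proof (cser_tail _ _ (psum_correct c R0 w H ltac:(lra))) as S1.
    pose proof (cser_tail _ _ (psum_correct c R0 z H Hz)) as S2.
    pose proof (psum_correct (pder c) R0 z (rad_pder c R0 H) Hz) as S3.
    pose proof (cser_plus _ _ _ _ S1 (cser_plus _ _ _ _ (cser_scal (-(1)) _ _ S2)
      (cser_scal (- (w - z)) _ _ S3))) as S4.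
    cbv beta in S4.
    eapply (cser_Cmod_le (fun n => c (S n) * (w ^ S n - z ^ S n - (w - z) * (RtoC (INR (S n)) * z ^ n)))).
    2:{ replace (psum c w - psum c z - (w - z) * psum (pder c) z) with
        (psum c w - c O * w ^ O + (-(1) * (psum c z - c O * z ^ O) + - (w - z) * psum (pder c) z))
          by (simpl; ring).
        eapply cser_ext; [|exact S4]. intros n. unfold pder. ring. }
    2:{ apply (is_series_scal (V := R_NormedModule) (Cmod (w - z) ^ 2)%R).
        apply (is_series_scal_r (/ rho)). exact HB. }
    intros n. unfold scal; cbn -[INR Cpow pow]; unfold mult; cbn -[INR Cpow pow].
    rewrite !Cmod_mult, Cmod_R, Rabs_pos_eq by apply pos_INR.
    pose proof (pow_second_difference rho z w n ltac:(lra) ltac:(lra) Hw) as Q.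
    set (D := Cmod (w ^ S n - z ^ S n - (w - z) * (INR (S n) * z ^ n))) in *.
    apply Rmult_le_reg_l with rho; [lra|].
    replace (rho * (Cmod (w - z) ^ 2 * (INR (S n) * (INR (S n) * Cmod (c (S n))) * rho ^ n * / rho)))%R
     with (Cmod (c (S n)) * (Cmod (w - z) ^ 2 * (INR (S n) * INR (S n) * rho ^ n)))%R by (field; lra).
    apply Rle_trans with (Cmod (c (S n)) * (rho * D))%R; [right; unfold D; ring|].
    apply (Rmult_le_compat_l (Cmod (c (S n)))); [apply Cmod_ge_0 | exact Q]. }
  apply cdv_iff. intros e He.
  set (b := (B / rho)%R) in *. assert (Hb : (0 <= b)%R) by (apply Rle_div_r; lra).
  exists (Rmin (rho - Cmod z) (e / (b + 1))). split.
  { apply Rmin_pos; [lra | apply Rdiv_lt_0_compat; lra]. }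
  intros w Hw.
  destruct (Rmin_Rgt_l _ _ _ Hw) as [Hw1 Hw2].
  eapply Rle_trans. apply M.
  - replace w with ((w - z) + z) by ring. eapply Rle_trans. apply Cmod_triangle. lra.
  - pose proof (Cmod_ge_0 (w - z)) as K.
    apply Rmult_lt_compat_r with (r := (b + 1)%R) in Hw2; [|lra].
    replace (e / (b + 1) * (b + 1))%R with e in Hw2 by (field; lra).
    replace (Cmod (w - z) ^ 2 * b)%R with ((Cmod (w - z) * b) * Cmod (w - z))%R by ring.
    apply Rmult_le_compat_r; auto. nra.
Qed.

(** The quotient has the explicit coefficients d_n = sum over j of c_(n+1+j) p^j. They satisfy d_n =
    c_(n+1) + p d_(n+1), which is the identity coefficient by coefficient, and the geometric bound
    in |p|/r shows that the radius does not shrink. *)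
Lemma psum_div (c : nat -> C) (R0 : R) (p : C) : rad c R0 -> (Cmod p < R0)%R ->
  exists d, rad d R0 /\ forall z, (Cmod z < R0)%R ->
    psum c z = psum c p + (z - p) * psum d z.
Proof.
  intros H Hp. pose proof (Cmod_ge_0 p) as Hp0.
  set (a := fun n j => c (S n + j)%nat * p ^ j).
  exists (fun n => CSeries (a n)).
  assert (Ha : forall r, (Cmod p < r < R0)%R -> exists M, forall n, 
     cser (a n) (CSeries (a n)) /\ (Cmod (CSeries (a n)) * r ^ n <= M)%R).
  { intros r Hr. destruct (H r) as [M HM]; [lra|].
    assert (Hq : (0 <= Cmod p / r < 1)%R).
    { split. apply Rdiv_le_0_compat; lra. apply (Rlt_div_l _ 1); lra. }
    assert (G : forall n, is_series (fun j => M / r ^ S n * (Cmod p / r) ^ j)%R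
       (M / r ^ S n * / (1 - Cmod p / r))%R).
    { intros n. apply (is_series_scal_l (V := R_NormedModule) (M / r ^ S n)%R). apply is_series_geom.
      rewrite Rabs_pos_eq; lra. }
    assert (D : forall n j, (Cmod (a n j) <= M / r ^ S n * (Cmod p / r) ^ j)%R).
    { intros n j. unfold a. rewrite Cmod_mult, Cmod_pow.
      assert (0 < r ^ S n)%R by (apply pow_lt; lra).
      assert (0 < r ^ j)%R by (apply pow_lt; lra).
      unfold Rdiv. rewrite Rpow_mult_distr, pow_inv.
      replace (M * / r ^ S n * (Cmod p ^ j * / r ^ j))%R with (M / r ^ (S n + j) * Cmod p ^ j)%R
        by (rewrite pow_add; field; split; apply Rgt_not_eq; assumption).
      apply Rmult_le_compat_r. apply pow_le; lra.
      apply (proj1 (Rle_div_r _ _ (r ^ (S n + j)) ltac:(apply pow_lt; lra))). apply HM. }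
    exists (M / r * / (1 - Cmod p / r))%R. intros n.
    assert (S1 : cser (a n) (CSeries (a n))).
    { apply cser_dominated with (1 := D n). eexists; apply G. }
    split; auto.
    pose proof (cser_Cmod_le _ _ _ _ (D n) S1 (G n)) as Q.
    assert (0 < r ^ n)%R by (apply pow_lt; lra).
    apply Rle_trans with (M / r ^ S n * / (1 - Cmod p / r) * r ^ n)%R.
    - apply Rmult_le_compat_r; lra.
    - right. simpl. field. repeat split; lra. }
  set (r1 := ((Cmod p + R0) / 2)%R).
  destruct (Ha r1) as [M1 HM1]; [unfold r1; lra|].
  assert (Hs : forall n, cser (a n) (CSeries (a n))) by (intros n; apply HM1).
  assert (Hrec : forall n, CSeries (a n) = c (S n) + p * CSeries (a (S n))).
  { intros n. apply cser_value.
    replace (c (S n)) with (a n O) by (unfold a; rewrite Nat.add_0_r; simpl; ring).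
    apply cser_cons. apply cser_ext with (fun j => p * a (S n) j); [|apply cser_scal, Hs].
    intros j. unfold a. replace (S n + S j)%nat with (S (S n) + j)%nat by lia. simpl; ring. }
  assert (Hrad : rad (fun n => CSeries (a n)) R0).
  { intros r Hr. apply cbound_le with (Rmax r r1). split; [lra | apply Rmax_l].
    destruct (Ha (Rmax r r1)) as [M HM].
    { unfold r1, Rmax. destruct Rle_dec; lra. }
    exists M. apply HM. }
  split; auto. intros z Hz.
  assert (Hc0 : psum c p = c O + p * CSeries (a O)).
  { apply cser_value. replace (c O) with (c O * p ^ O) at 1 by (simpl; ring).
    apply (cser_cons (fun n => c n * p ^ n)).
    apply cser_ext with (fun j => p * a O j); [|apply cser_scal, Hs].
    intros j. unfold a. simpl; ring. }
  set (D := psum (fun n => CSeries (a n)) z).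
  assert (S1 : cser (fun n => CSeries (a n) * z ^ n) D) by (apply (psum_correct _ R0); auto).
  pose proof (cser_tail _ _ S1) as S2. cbv beta in S2.
  pose proof (cser_plus _ _ _ _ (cser_scal z _ _ S1) (cser_scal (- p) _ _ S2)) as S3. cbv beta in S3.
  assert (S4 : cser (fun n => c (S n) * z ^ S n) (z * D + - p * (D - CSeries (a O) * z ^ 0))).
  { eapply cser_ext; [|exact S3]. intros n. cbv beta. rewrite (Hrec n). simpl; ring. }
  apply (cser_cons (fun n => c n * z ^ n)) in S4.
  unfold psum at 1. rewrite (cser_value _ _ S4), Hc0. simpl; ring.
Qed.

(** Analyticity on the open disc of radius [R0] about 0, with one power series valid on the whole
    disc. Divisions at points other than 0 stay in this class by [psum_div]. *)
Definition holo (f : C -> C) (R0 : R) : Prop :=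
  exists c, rad c R0 /\ forall z, (Cmod z < R0)%R -> f z = psum c z.

Lemma holo_ext (f g : C -> C) (R0 : R) : (forall z, (Cmod z < R0)%R -> f z = g z) ->
  holo f R0 -> holo g R0.
Proof.
  intros E [c [H1 H2]]. exists c. split; auto. intros z Hz. rewrite <- E; auto.
Qed.

Lemma holo_weaken (f : C -> C) (r R0 : R) : (r <= R0)%R -> holo f R0 -> holo f r.
Proof.
  intros Hr [c [H1 H2]]. exists c. split; [intros s Hs; apply H1; lra | intros; apply H2; lra].
Qed.

Lemma holo_cdv (f : C -> C) (R0 : R) : holo f R0 ->
  exists f', holo f' R0 /\ forall z, (Cmod z < R0)%R -> cdv f z (f' z).
Proof.
  intros [c [H1 H2]]. exists (psum (pder c)). split.
  - exists (pder c). split; auto. apply rad_pder; auto.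
  - intros z Hz. apply cdv_ext_loc with (psum c) (R0 - Cmod z)%R; [lra| |].
    + intros w Hw. symmetry; apply H2. replace w with (w - z + z) by ring.
      eapply Rle_lt_trans; [apply Cmod_triangle | lra].
    + apply psum_cdv with R0; auto.
Qed.

Lemma holo_cont (f : C -> C) (R0 : R) (z : C) : holo f R0 -> (Cmod z < R0)%R -> ccont f z.
Proof.
  intros H Hz. destruct (holo_cdv f R0 H) as [f' [_ H1]]. eapply cdv_cont. apply H1; auto.
Qed.

Lemma holo_div (f : C -> C) (R0 : R) (p : C) : holo f R0 -> (Cmod p < R0)%R ->
  exists g, holo g R0 /\ forall z, (Cmod z < R0)%R -> f z = f p + (z - p) * g z.
Proof.
  intros [c [H1 H2]] Hp. destruct (psum_div c R0 p H1 Hp) as [d [Hd1 Hd2]].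
  exists (psum d). split. exists d; auto.
  intros z Hz. rewrite !H2 by auto. auto.
Qed.

Lemma rad_plus (c d : nat -> C) (R0 : R) : rad c R0 -> rad d R0 -> rad (fun n => c n + d n) R0.
Proof.
  intros H1 H2 r Hr. destruct (H1 r Hr) as [M HM], (H2 r Hr) as [N HN].
  exists (M + N)%R. intros n.
  apply Rle_trans with ((Cmod (c n) + Cmod (d n)) * r ^ n)%R.
  - apply Rmult_le_compat_r; [apply pow_le; lra | apply Cmod_triangle].
  - rewrite Rmult_plus_distr_r. apply Rplus_le_compat; auto.
Qed.

Lemma holo_plus (f g : C -> C) (R0 : R) : holo f R0 -> holo g R0 -> holo (fun z => f z + g z) R0.
Proof.
  intros [c [H1 H2]] [d [H3 H4]]. exists (fun n => c n + d n). split. apply rad_plus; auto.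
  intros z Hz. rewrite H2, H4 by auto. symmetry. apply cser_value.
  apply cser_ext with (fun n => c n * z ^ n + d n * z ^ n). intros; ring.
  apply cser_plus; eapply psum_correct; eauto.
Qed.

Lemma holo_scal (a : C) (f : C -> C) (R0 : R) : holo f R0 -> holo (fun z => a * f z) R0.
Proof.
  intros [c [H1 H2]]. exists (fun n => a * c n). split.
  - intros r Hr. destruct (H1 r Hr) as [M HM]. exists (Cmod a * M)%R. intros n.
    rewrite Cmod_mult, Rmult_assoc. apply Rmult_le_compat_l; auto. apply Cmod_ge_0.
  - intros z Hz. rewrite H2 by auto. symmetry. apply cser_value.
    apply cser_ext with (fun n => a * (c n * z ^ n)). intros; ring.
    apply cser_scal; eapply psum_correct; eauto.
Qed.

Lemma cser_0 : cser (fun _ => RtoC 0) 0.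
Proof.
  apply (filterlim_ext (U := C_UniformSpace) (fun _ : nat => RtoC 0)); [|apply filterlim_const].
  intros n. symmetry. induction n.
  - apply (sum_O (G := C_AbelianMonoid)).
  - etransitivity. apply (sum_Sn (G := C_AbelianMonoid)).
    etransitivity. apply (f_equal (fun x => x + 0) IHn). exact (Cplus_0_l 0).
Qed.

Lemma holo_const (a : C) (R0 : R) : holo (fun _ => a) R0.
Proof.
  exists (fun n => match n with O => a | _ => 0 end). split.
  - intros r Hr. exists (Cmod a). intros [|n].
    + simpl. lra.
    + rewrite Cmod_0, Rmult_0_l. apply Cmod_ge_0.
  - intros z _. symmetry. apply cser_value.
    pose proof (cser_cons (fun n => match n with O => a | _ => 0 end * z ^ n) 0) as S.
    cbv beta iota in S. replace (a * z ^ 0 + 0) with a in S by (simpl; ring). apply S.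
    eapply cser_ext; [|apply cser_0]. intros; simpl; ring.
Qed.

Lemma cser_geom (q : C) : (Cmod q < 1)%R -> cser (fun n => q ^ n) (/ (1 - q)).
Proof.
  intros Hq.
  assert (Hn : 1 - q <> 0).
  { intros E. replace q with (1 - (1 - q)) in Hq by ring. rewrite E in Hq.
    replace (1 - 0) with (RtoC 1) in Hq by ring. rewrite Cmod_1 in Hq. lra. }
  assert (S : cser (fun n => q ^ n) (CSeries (fun n => q ^ n))).
  { apply cser_dominated with (fun n => (Cmod q ^ n)%R).
    intros; rewrite Cmod_pow; lra. apply ex_series_geom.
    rewrite Rabs_pos_eq; auto. apply Cmod_ge_0. }
  set (s := CSeries (fun n => q ^ n)) in *.
  pose proof (cser_cons (fun n => q ^ n) _ (cser_scal q _ _ S)) as S2.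
  pose proof (cser_unique _ _ _ S S2) as E. simpl in E.
  replace (/ (1 - q)) with s; auto.
  assert (E1 : (1 - q) * s = 1).
  { replace ((1 - q) * s) with (s - q * s) by ring. rewrite E at 1. ring. }
  replace s with ((1 - q) * s * / (1 - q)) by (field; auto). rewrite E1. ring.
Qed.

(** A geometric series in z/p. The pole may lie on the boundary circle, which is what happens later
    for the disc whose radius is the first zero. *)
Lemma holo_pole (p : C) (R0 : R) : (0 < R0)%R -> (R0 <= Cmod p)%R -> holo (fun z => / (z - p)) R0.
Proof.
  intros HR Hp. assert (Hp0 : p <> 0) by (apply Cmod_pos_neq; lra).
  exists (fun n => - / p * (/ p) ^ n). split.
  - intros r Hr. exists (/ Cmod p)%R. intros n.
    rewrite Cmod_mult, Cmod_opp, Cmod_pow, Cmod_inv by auto.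
    rewrite Rmult_assoc, <- Rpow_mult_distr.
    apply Rle_trans with (/ Cmod p * 1)%R; [|lra]. apply Rmult_le_compat_l.
    left; apply Rinv_0_lt_compat; lra.
    rewrite <- (pow1 n). apply pow_incr. rewrite Rmult_comm. split.
    apply Rdiv_le_0_compat; lra. apply (Rle_div_l r 1); lra.
  - intros z Hz. symmetry. apply cser_value.
    assert (Hq : (Cmod (z / p) < 1)%R).
    { rewrite Cmod_div by auto. apply (Rlt_div_l _ 1); lra. }
    replace (/ (z - p)) with (- / p * / (1 - z / p)).
    2:{ assert (p - z <> 0).
        { intros E. replace z with (p - (p - z)) in Hz by ring. rewrite E in Hz.
          replace (p - 0) with p in Hz by ring. lra. }
        assert (z - p <> 0).
        { intros E. apply H. replace (p - z) with (- (z - p)) by ring. rewrite E. ring. }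
        field. repeat split; auto. }
    apply cser_ext with (fun n => - / p * (z / p) ^ n).
    + intros n. unfold Cdiv. rewrite Cpow_mult_l. ring.
    + apply cser_scal. apply cser_geom. exact Hq.
Qed.

Lemma cser_spread (a : nat -> C) (l : C) : cser a l ->
  cser (fun n => if Nat.even n then a (Nat.div2 n) else RtoC 0) l.
Proof.
  intros H. set (b := fun n => if Nat.even n then a (Nat.div2 n) else 0).
  assert (E : forall n, csum_n b (2 * n) = csum_n a n /\
     csum_n b (S (2 * n)) = csum_n a n).
  { assert (B1 : forall n, b (2 * n)%nat = a n).
    { intros n. unfold b. rewrite Nat.even_mul, Nat.div2_double. reflexivity. }
    assert (B2 : forall n, b (S (2 * n)) = 0).
    { intros n. unfold b. rewrite Nat.even_succ, Nat.odd_mul. reflexivity. }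
    assert (B3 : forall n, csum_n b (2 * n) = csum_n a n ->
       csum_n b (S (2 * n)) = csum_n a n).
    { intros n E. rewrite sum_Sn, E, B2. exact (Cplus_0_r _). }
    induction n.
    - assert (E0 : csum_n b (2 * 0) = csum_n a 0).
      { simpl. rewrite !sum_O. apply (B1 O). }
      split; auto.
    - assert (E1 : csum_n b (2 * S n) = csum_n a (S n)).
      { replace (2 * S n)%nat with (S (S (2 * n))) by lia.
        rewrite sum_Sn, (proj2 IHn), (sum_Sn a). f_equal.
        replace (S (S (2 * n))) with (2 * S n)%nat by lia. apply B1. }
      split; auto. }
  intros P HP. destruct (H P HP) as [N HN]. exists (2 * N)%nat. intros n Hn.
  destruct (Nat.Even_or_Odd n) as [[m ->]|[m ->]].
  - change (P (csum_n b (2 * m))).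
    rewrite (proj1 (E m)). apply HN. lia.
  - change (P (csum_n b (2 * m + 1))).
    rewrite Nat.add_1_r, (proj2 (E m)). apply HN. lia.
Qed.

(** Substituting z^2 inserts a zero between consecutive coefficients. This is how the series in
    (z/2)^2 that defines J_q becomes a power series in z. *)
Lemma holo_square (c : nat -> C) (R0 : R) : (0 <= R0)%R -> rad c (R0 * R0) ->
  holo (fun z => psum c (z * z)) R0.
Proof.
  intros HR H. exists (fun n => if Nat.even n then c (Nat.div2 n) else 0). split.
  - intros r Hr. destruct (H (r * r)%R) as [M HM]. nra.
    assert (HM0 : (0 <= M)%R).
    { eapply Rle_trans; [|apply (HM O)]. simpl. rewrite Rmult_1_r. apply Cmod_ge_0. }
    exists M. intros n. destruct (Nat.even n) eqn:En.
    + apply Nat.even_spec in En. destruct En as [m ->]. rewrite Nat.div2_double, pow_mult.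
      replace (r ^ 2)%R with (r * r)%R by ring. apply HM.
    + rewrite Cmod_0. lra.
  - intros z Hz. symmetry. apply cser_value.
    apply cser_ext with (fun n => if Nat.even n then c (Nat.div2 n) * (z * z) ^ Nat.div2 n else RtoC 0).
    + intros n. destruct (Nat.even n) eqn:En; [|ring].
      apply Nat.even_spec in En. destruct En as [m ->]. rewrite Nat.div2_double, Cpow_mult_r.
      replace (z ^ 2) with (z * z) by (simpl; ring). reflexivity.
    + apply (cser_spread (fun n => c n * (z * z) ^ n)). apply psum_correct with (R0 * R0)%R; auto.
      rewrite Cmod_mult. pose proof (Cmod_ge_0 z). nra.
Qed.

(** * Functions of a real variable with complex values *)

Notation tc f x := (@continuous _ C_UniformSpace f%C x) (only parsing).

Lemma tc_iff (T : UniformSpace) (f : T -> C) (x : T) :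
  tc f x <-> continuous (fun y => Re (f y)) x /\ continuous (fun y => Im (f y)) x.
Proof.
  split.
  - intros H. split; apply filterlim_locally; intros e;
      pose proof (proj1 (filterlim_locally _ _) H e) as H1; revert H1; apply filter_imp;
      intros y Hy; apply Hy.
  - intros [H1 H2]. apply filterlim_locally. intros e.
    pose proof (proj1 (filterlim_locally _ _) H1 e) as K1.
    pose proof (proj1 (filterlim_locally _ _) H2 e) as K2.
    generalize (filter_and _ _ K1 K2). apply filter_imp.
    intros y Hy. exact Hy.
Qed.

Lemma tc_const (T : UniformSpace) (a : C) (x : T) : tc (fun _ => a) x.
Proof. apply continuous_const. Qed.

Lemma tc_plus (T : UniformSpace) (f g : T -> C) (x : T) :
  tc f x -> tc g x -> tc (fun y => f y + g y) x.
Proof. exact (continuous_plus (V := C_NormedModule) f g x). Qed.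

Lemma tc_minus (T : UniformSpace) (f g : T -> C) (x : T) :
  tc f x -> tc g x -> tc (fun y => f y - g y) x.
Proof. exact (continuous_minus (V := C_NormedModule) f g x). Qed.

Lemma tc_mult (T : UniformSpace) (f g : T -> C) (x : T) :
  tc f x -> tc g x -> tc (fun y => f y * g y) x.
Proof.
  intros Hf Hg. apply tc_iff in Hf. apply tc_iff in Hg. destruct Hf as [F1 F2], Hg as [G1 G2].
  apply tc_iff. split.
  - exact (continuous_minus (V := R_NormedModule) _ _ _
      (continuous_mult (K := R_AbsRing) _ _ _ F1 G1) (continuous_mult (K := R_AbsRing) _ _ _ F2 G2)).
  - exact (continuous_plus (V := R_NormedModule) _ _ _
      (continuous_mult (K := R_AbsRing) _ _ _ F1 G2) (continuous_mult (K := R_AbsRing) _ _ _ F2 G1)).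
Qed.

Lemma tc_RtoC (T : UniformSpace) (f : T -> R) (x : T) :
  continuous f x -> tc (fun y => RtoC (f y)) x.
Proof. intros H. apply tc_iff. split. exact H. apply continuous_const. Qed.

Lemma tc_comp (T : UniformSpace) (f : T -> C) (g : C -> C) (x : T) :
  tc f x -> ccont g (f x) -> tc (fun y => g (f y)) x.
Proof. exact (continuous_comp f g x). Qed.

Lemma tc_inv (T : UniformSpace) (f : T -> C) (x : T) :
  f x <> 0 -> tc f x -> tc (fun y => / f y) x.
Proof.
  intros H0 H. apply (tc_comp T f (fun w => / w)); auto.
  eapply cdv_cont. apply cdv_inv_id. auto.
Qed.

Lemma tc_pow (T : UniformSpace) (f : T -> C) (n : nat) (x : T) :
  tc f x -> tc (fun y => f y ^ n) x.
Proof.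
  intros H. induction n. apply tc_const. apply (tc_mult T f (fun y => f y ^ n)); auto.
Qed.

Lemma tc_Cmod (T : UniformSpace) (f : T -> C) (x : T) :
  tc f x -> continuous (fun y => Cmod (f y)) x.
Proof.
  intros H. apply (continuous_comp f Cmod); auto.
  exact (filterlim_norm (V := C_NormedModule) (f x)).
Qed.

(** Componentwise, so that real results (mean value theorem, fundamental theorem, differentiation
    under the integral) apply to each part. [cder_iff] gives the equivalent complex estimate, which
    the chain rule with a complex derivative uses. *)
Definition cder (g : R -> C) (t : R) (l : C) : Prop :=
  is_derive (fun x => Re (g x)) t (Re l) /\ is_derive (fun x => Im (g x)) t (Im l).

Lemma rder_iff (f : R -> R) (t l : R) :
  is_derive f t l <-> forall e, (0 < e)%R -> exists d, (0 < d)%R /\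
    forall s, (Rabs (s - t) < d)%R -> (Rabs (f s - f t - (s - t) * l) <= e * Rabs (s - t))%R.
Proof.
  split.
  - intros [_ H] e He.
    destruct (H t (fun P HP => HP) (mkposreal e He)) as [d Hd].
    exists d. split. apply cond_pos. intros s Hs. exact (Hd s Hs).
  - intros H. split. apply is_linear_scal_l.
    intros x Hx.
    apply (is_filter_lim_locally_unique (V := R_NormedModule)) in Hx. subst x.
    intros e. destruct (H e (cond_pos e)) as [d [Hd H1]].
    exists (mkposreal d Hd). intros w Hw. exact (H1 w Hw).
Qed.

Lemma cder_iff (g : R -> C) (t : R) (l : C) :
  cder g t l <-> forall e, (0 < e)%R -> exists d, (0 < d)%R /\
    forall s, (Rabs (s - t) < d)%R ->
    (Cmod (g s - g t - RtoC (s - t) * l) <= e * Rabs (s - t))%R.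
Proof.
  split.
  - intros [H1 H2] e He.
    destruct (proj1 (rder_iff _ _ _) H1 (e / 2)%R ltac:(lra)) as [d1 [Hd1 K1]].
    destruct (proj1 (rder_iff _ _ _) H2 (e / 2)%R ltac:(lra)) as [d2 [Hd2 K2]].
    exists (Rmin d1 d2). split. apply Rmin_pos; auto. intros s Hs.
    specialize (K1 s (Rlt_le_trans _ _ _ Hs (Rmin_l _ _))).
    specialize (K2 s (Rlt_le_trans _ _ _ Hs (Rmin_r _ _))).
    eapply Rle_trans. apply Cmod_le_Re_Im.
    replace (Re (g s - g t - RtoC (s - t) * l)) with (Re (g s) - Re (g t) - (s - t) * Re l)%R
      by (unfold Re, Cminus, Cplus, Copp, Cmult, RtoC; simpl; ring).
    replace (Im (g s - g t - RtoC (s - t) * l)) with (Im (g s) - Im (g t) - (s - t) * Im l)%R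
      by (unfold Im, Cminus, Cplus, Copp, Cmult, RtoC; simpl; ring).
    lra.
  - intros H. split; apply rder_iff; intros e He; destruct (H e He) as [d [Hd K]];
      exists d; (split; [exact Hd|]); intros s Hs; (eapply Rle_trans; [|apply (K s Hs)]).
    + replace (Re (g s) - Re (g t) - (s - t) * Re l)%R with (Re (g s - g t - RtoC (s - t) * l))
        by (unfold Re, Cminus, Cplus, Copp, Cmult, RtoC; simpl; ring).
      apply re_le_Cmod.
    + replace (Im (g s) - Im (g t) - (s - t) * Im l)%R with (Im (g s - g t - RtoC (s - t) * l))
        by (unfold Im, Cminus, Cplus, Copp, Cmult, RtoC; simpl; ring).
      apply Im_le_Cmod.
Qed.

Lemma cder_tc (g : R -> C) (t : R) (l : C) : cder g t l -> tc g t.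
Proof.
  intros [H1 H2]. apply tc_iff. split.
  - apply (ex_derive_continuous (fun x => Re (g x))). eexists; apply H1.
  - apply (ex_derive_continuous (fun x => Im (g x))). eexists; apply H2.
Qed.

Lemma cder_val (g : R -> C) (t : R) (l m : C) : l = m -> cder g t l -> cder g t m.
Proof. intros ->; auto. Qed.

Lemma cder_ext (f g : R -> C) (t : R) (l : C) : (forall s, f s = g s) -> cder f t l -> cder g t l.
Proof.
  intros E [H1 H2]. split; [eapply is_derive_ext; [|apply H1] | eapply is_derive_ext; [|apply H2]];
  intros s; cbv beta; rewrite E; reflexivity.
Qed.

Lemma cder_const (a : C) (t : R) : cder (fun _ => a) t 0.
Proof. split; apply (is_derive_const (V := R_NormedModule)). Qed.

Lemma cder_plus (f g : R -> C) (t : R) (l m : C) :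
  cder f t l -> cder g t m -> cder (fun s => f s + g s) t (l + m).
Proof.
  intros [F1 F2] [G1 G2]. split.
  exact (is_derive_plus (V := R_NormedModule) _ _ _ _ _ F1 G1).
  exact (is_derive_plus (V := R_NormedModule) _ _ _ _ _ F2 G2).
Qed.

Lemma cder_minus (f g : R -> C) (t : R) (l m : C) :
  cder f t l -> cder g t m -> cder (fun s => f s - g s) t (l - m).
Proof.
  intros [F1 F2] [G1 G2]. split.
  exact (is_derive_minus (V := R_NormedModule) _ _ _ _ _ F1 G1).
  exact (is_derive_minus (V := R_NormedModule) _ _ _ _ _ F2 G2).
Qed.

Lemma rder_mult (f g : R -> R) (t l m : R) :
  is_derive f t l -> is_derive g t m -> is_derive (fun s => f s * g s)%R t (l * g t + f t * m)%R.
Proof. intros F G. exact (is_derive_mult (K := R_AbsRing) f g t l m F G Rmult_comm). Qed.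

Lemma cder_mult (f g : R -> C) (t : R) (l m : C) :
  cder f t l -> cder g t m -> cder (fun s => f s * g s) t (l * g t + f t * m).
Proof.
  intros [F1 F2] [G1 G2]. split.
  - replace (Re (l * g t + f t * m)) with
     ((Re l * Re (g t) + Re (f t) * Re m) - (Im l * Im (g t) + Im (f t) * Im m))%R
     by (unfold Re, Im, Cplus, Cmult; simpl; ring).
    exact (is_derive_minus (V := R_NormedModule) _ _ _ _ _
      (rder_mult _ _ _ _ _ F1 G1) (rder_mult _ _ _ _ _ F2 G2)).
  - replace (Im (l * g t + f t * m)) with
     ((Re l * Im (g t) + Re (f t) * Im m) + (Im l * Re (g t) + Im (f t) * Re m))%R
     by (unfold Re, Im, Cplus, Cmult; simpl; ring).
    exact (is_derive_plus (V := R_NormedModule) _ _ _ _ _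
      (rder_mult _ _ _ _ _ F1 G2) (rder_mult _ _ _ _ _ F2 G1)).
Qed.

Lemma cder_scal (a : C) (f : R -> C) (t : R) (l : C) : cder f t l -> cder (fun s => a * f s) t (a * l).
Proof.
  intros H. apply cder_val with (0 * f t + a * l); [ring|].
  apply (cder_mult (fun _ => a)); auto. apply cder_const.
Qed.

Lemma cder_RtoC (f : R -> R) (t l : R) : is_derive f t l -> cder (fun s => RtoC (f s)) t (RtoC l).
Proof. intros H. split. exact H. exact (is_derive_const (V := R_NormedModule) 0%R t). Qed.

Lemma cder_RtoC_id (t : R) : cder RtoC t 1.
Proof. apply (cder_RtoC (fun s => s)). apply (is_derive_id (K := R_AbsRing)). Qed.

Lemma cder_comp_real (g : R -> C) (f : R -> R) (t m : R) (l : C) :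
  cder g (f t) l -> is_derive f t m -> cder (fun s => g (f s)) t (RtoC m * l).
Proof.
  intros [G1 G2] Hf. split.
  - replace (Re (RtoC m * l)) with (m * Re l)%R by (unfold Re; simpl; ring).
    exact (is_derive_comp (V := R_NormedModule) (fun x => Re (g x)) f t _ _ G1 Hf).
  - replace (Im (RtoC m * l)) with (m * Im l)%R by (unfold Im; simpl; ring).
    exact (is_derive_comp (V := R_NormedModule) (fun x => Im (g x)) f t _ _ G2 Hf).
Qed.

Lemma cder_comp (f : C -> C) (g : R -> C) (t : R) (l m : C) :
  cdv f (g t) l -> cder g t m -> cder (fun s => f (g s)) t (m * l).
Proof.
  intros Hf Hg. pose proof (cder_tc _ _ _ Hg) as Cg. 
  apply cder_iff. intros e He. pose proof (proj1 (cder_iff _ _ _) Hg) as Hg'. clear Hg.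
  pose proof (Cmod_ge_0 m) as Km. pose proof (Cmod_ge_0 l) as Kl.
  set (e1 := (e / (2 * (Cmod m + 1)))%R). set (e2 := Rmin 1 (e / (2 * (Cmod l + 1)))%R).
  assert (He1 : (0 < e1)%R) by (apply Rdiv_lt_0_compat; lra).
  assert (He2 : (0 < e2)%R) by (apply Rmin_pos; [lra | apply Rdiv_lt_0_compat; lra]).
  assert (Q1 : (e1 * (Cmod m + 1) = e / 2)%R) by (unfold e1; field; lra).
  assert (Q2 : (e2 * (Cmod l + 1) <= e / 2)%R).
  { apply Rle_trans with (e / (2 * (Cmod l + 1)) * (Cmod l + 1))%R; [|right; field; lra].
    apply Rmult_le_compat_r; [lra | apply Rmin_r]. }
  assert (Q3 : (e2 <= 1)%R) by apply Rmin_l.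
  destruct (proj1 (cdv_iff _ _ _) Hf _ He1) as [d1 [Hd1 H1]].
  destruct (Hg' _ He2) as [d2 [Hd2 H2]].
  destruct (proj1 (filterlim_locally _ _) Cg (mkposreal (d1 / 2) ltac:(lra))) as [d3 H3].
  exists (Rmin d2 d3). split. apply Rmin_pos; [lra | apply cond_pos].
  intros s Hs.
  destruct (Rmin_Rgt_l _ _ _ Hs) as [Hw2 Hw3].
  specialize (H2 s Hw2).
  specialize (H1 _ (Cmod_of_ball _ _ d1 Hd1 (H3 s Hw3))).
  replace (f (g s) - f (g t) - RtoC (s - t) * (m * l))
    with ((f (g s) - f (g t) - (g s - g t) * l) + (g s - g t - RtoC (s - t) * m) * l) by ring.
  eapply Rle_trans. apply Cmod_triangle. rewrite Cmod_mult.
  set (x := Rabs (s - t)) in *. assert (Kx : (0 <= x)%R) by apply Rabs_pos.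
  assert (H4 : (Cmod (g s - g t) <= (Cmod m + 1) * x)%R).
  { replace (g s - g t) with ((g s - g t - RtoC (s - t) * m) + RtoC (s - t) * m) by ring.
    eapply Rle_trans. apply Cmod_triangle. rewrite Cmod_mult, Cmod_R. fold x. nra. }
  pose proof (Cmod_ge_0 (g s - g t - RtoC (s - t) * m)) as K5.
  assert (e1 * Cmod (g s - g t) <= e1 * ((Cmod m + 1) * x))%R by (apply Rmult_le_compat_l; lra).
  assert (Cmod (g s - g t - RtoC (s - t) * m) * Cmod l <= e2 * x * Cmod l)%R by (apply Rmult_le_compat_r; lra).
  nra.
Qed.

Definition cis (t : R) : C := (cos t, sin t).

Lemma cder_cis (t : R) : cder cis t (Ci * cis t).
Proof.
  unfold cis, Ci, Cmult. split; simpl; auto_derive; auto; ring.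
Qed.

Lemma Cmod_cis (t : R) : Cmod (cis t) = 1%R.
Proof.
  unfold Cmod, cis. simpl. transitivity (sqrt 1); [f_equal | apply sqrt_1].
  pose proof (sin2_cos2 t) as H. unfold Rsqr in H. lra.
Qed.

Definition circ (r t : R) : C := RtoC r * cis t.

Lemma Cmod_circ (r t : R) : (0 <= r)%R -> Cmod (circ r t) = r.
Proof. intros H. unfold circ. rewrite Cmod_mult, Cmod_cis, Cmod_R, Rabs_pos_eq; lra. Qed.

Lemma cder_circ (r t : R) : cder (circ r) t (Ci * circ r t).
Proof.
  apply cder_val with (RtoC r * (Ci * cis t)). unfold circ; ring.
  apply cder_scal. apply cder_cis.
Qed.

Lemma circ_2PI (r : R) : circ r (2 * PI) = circ r 0.
Proof. unfold circ, cis. rewrite cos_2PI, sin_2PI, cos_0, sin_0. reflexivity. Qed.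

Lemma tc_circ (r t : R) : tc (circ r) t.
Proof. eapply cder_tc. apply cder_circ. Qed.

(** * Circle integrals and Cauchy's formula *)

Notation R2 := (prod_UniformSpace R_UniformSpace R_UniformSpace).

Definition CInt (g : R -> C) (a b : R) : C :=
  (RInt (fun t => Re (g t)) a b, RInt (fun t => Im (g t)) a b).

Lemma tc_ex_RInt (g : R -> C) (a b : R) : (a <= b)%R -> (forall t, (a <= t <= b)%R -> tc g t) ->
  ex_RInt (fun t => Re (g t)) a b /\ ex_RInt (fun t => Im (g t)) a b.
Proof.
  intros H Hg. split; apply (ex_RInt_continuous (V := R_CompleteNormedModule)); intros t Ht;
  rewrite Rmin_left, Rmax_right in Ht by auto; apply (proj1 (tc_iff _ g t) (Hg t Ht)).
Qed.

Lemma CInt_plus (f g : R -> C) (a b : R) : (a <= b)%R ->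
  (forall t, (a <= t <= b)%R -> tc f t) -> (forall t, (a <= t <= b)%R -> tc g t) ->
  CInt (fun t => f t + g t) a b = CInt f a b + CInt g a b.
Proof.
  intros H Hf Hg. destruct (tc_ex_RInt f a b H Hf), (tc_ex_RInt g a b H Hg).
  unfold CInt, Cplus. simpl. f_equal.
  - apply (RInt_plus (V := R_CompleteNormedModule)); auto.
  - apply (RInt_plus (V := R_CompleteNormedModule)); auto.
Qed.

Lemma CInt_scal (c : C) (g : R -> C) (a b : R) : (a <= b)%R ->
  (forall t, (a <= t <= b)%R -> tc g t) ->
  CInt (fun t => c * g t) a b = c * CInt g a b.
Proof.
  intros H Hg. destruct (tc_ex_RInt g a b H Hg) as [H1 H2].
  assert (S : forall k h, ex_RInt h a b -> ex_RInt (fun t => k * h t)%R a b /\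
     RInt (fun t => k * h t)%R a b = (k * RInt h a b)%R).
  { intros k h Hh. split. apply (ex_RInt_scal (V := R_CompleteNormedModule)); auto.
    apply (RInt_scal (V := R_CompleteNormedModule)); auto. }
  destruct (S (Re c) _ H1) as [A1 B1], (S (Im c) _ H1) as [A2 B2],
    (S (Re c) _ H2) as [A3 B3], (S (Im c) _ H2) as [A4 B4].
  unfold CInt, Cmult. simpl. f_equal.
  - transitivity (RInt (fun t => Re c * Re (g t))%R a b - RInt (fun t => Im c * Im (g t))%R a b)%R.
    + apply (RInt_minus (V := R_CompleteNormedModule)); auto.
    + rewrite B1, B4. reflexivity.
  - transitivity (RInt (fun t => Re c * Im (g t))%R a b + RInt (fun t => Im c * Re (g t))%R a b)%R.
    + apply (RInt_plus (V := R_CompleteNormedModule)); auto.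
    + rewrite B2, B3. reflexivity.
Qed.

Lemma CInt_ext (f g : R -> C) (a b : R) : (a <= b)%R ->
  (forall t, (a <= t <= b)%R -> f t = g t) -> CInt f a b = CInt g a b.
Proof.
  intros H E. unfold CInt. f_equal; apply RInt_ext; intros t Ht;
  rewrite Rmin_left, Rmax_right in Ht by auto; rewrite E; auto; lra.
Qed.

(** Real and imaginary parts are bounded separately, hence the factor 2; only orders of magnitude
    matter in the sequel. *)
Lemma CInt_Cmod_le (g : R -> C) (h : R -> R) (a b m : R) : (a <= b)%R ->
  (forall t, (a <= t <= b)%R -> tc g t) ->
  (forall t, (a <= t <= b)%R -> (Cmod (g t) <= h t)%R) ->
  is_RInt h a b m -> (Cmod (CInt g a b) <= 2 * m)%R.
Proof.
  intros H Hg Hb Hm. destruct (tc_ex_RInt g a b H Hg) as [H1 H2].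
  eapply Rle_trans. apply Cmod_le_Re_Im.
  assert (K1 : (Rabs (Re (CInt g a b)) <= m)%R).
  { apply (norm_RInt_le (V := R_NormedModule) (fun t => Re (g t)) h a b); auto.
    - intros t Ht. eapply Rle_trans; [apply re_le_Cmod | auto].
    - apply (RInt_correct (V := R_CompleteNormedModule)). auto. }
  assert (K2 : (Rabs (Im (CInt g a b)) <= m)%R).
  { apply (norm_RInt_le (V := R_NormedModule) (fun t => Im (g t)) h a b); auto.
    - intros t Ht. eapply Rle_trans; [apply Im_le_Cmod | auto].
    - apply (RInt_correct (V := R_CompleteNormedModule)). auto. }
  lra.
Qed.

Lemma CInt_deriv (G g : R -> C) (a b : R) : (a <= b)%R ->
  (forall t, (a <= t <= b)%R -> cder G t (g t)) ->
  (forall t, (a <= t <= b)%R -> tc g t) ->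
  CInt g a b = G b - G a.
Proof.
  intros H HG Hg. unfold CInt.
  rewrite (is_RInt_unique _ _ _ (minus (Re (G b)) (Re (G a)))).
  rewrite (is_RInt_unique _ _ _ (minus (Im (G b)) (Im (G a)))).
  - reflexivity.
  - apply (is_RInt_derive (V := R_CompleteNormedModule) (fun t => Im (G t))); intros t Ht;
    rewrite Rmin_left, Rmax_right in Ht by auto. apply HG; auto.
    apply (proj1 (tc_iff _ g t) (Hg t Ht)).
  - apply (is_RInt_derive (V := R_CompleteNormedModule) (fun t => Re (G t))); intros t Ht;
    rewrite Rmin_left, Rmax_right in Ht by auto. apply HG; auto.
    apply (proj1 (tc_iff _ g t) (Hg t Ht)).
Qed.

Definition oint (g : R -> C) : C := CInt g 0 (2 * PI).

Lemma two_PI_pos : (0 < 2 * PI)%R.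
Proof. pose proof PI_RGT_0. lra. Qed.

Lemma oint_const (c : C) : oint (fun _ => c) = c * RtoC (2 * PI).
Proof.
  pose proof two_PI_pos.
  unfold oint. rewrite (CInt_deriv (fun t => RtoC t * c)).
  - rewrite RtoC_mult. ring.
  - lra.
  - intros t _. apply cder_val with (RtoC 1 * c + RtoC t * 0). ring.
    apply (cder_mult (fun t => RtoC t) (fun _ => c)); [|apply cder_const].
    apply cder_RtoC_id.
  - intros; apply tc_const.
Qed.

Lemma RInt_param_derive (f f' : R -> R -> R) (a b x d : R) : (a <= b)%R -> (0 < d)%R ->
  (forall u v, (Rabs (u - x) < d)%R -> is_derive (fun u => f u v) u (f' u v)) ->
  (forall v, continuity_2d_pt f' x v) ->
  (forall u v, (Rabs (u - x) < d)%R -> continuous (f u) v) ->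
  is_derive (fun u => RInt (f u) a b) x (RInt (f' x) a b).
Proof.
  intros Hab Hd H1 H2 H3.
  replace (RInt (f' x) a b) with (RInt (fun t => Derive (fun u => f u t) x) a b).
  2:{ apply RInt_ext. intros t _. apply is_derive_unique. apply H1.
      unfold Rminus; rewrite Rplus_opp_r, Rabs_R0; auto. }
  apply (is_derive_RInt_param f a b x).
  - exists (mkposreal d Hd). intros u Hu t _. eexists. apply H1. exact Hu.
  - intros t _. apply continuity_2d_pt_ext_loc with (2 := H2 t).
    exists (mkposreal d Hd). intros u v Hu _. symmetry. apply is_derive_unique. apply H1. exact Hu.
  - exists (mkposreal d Hd). intros u Hu. apply (ex_RInt_continuous (V := R_CompleteNormedModule)).
    intros v _. apply H3. exact Hu.
Qed.

(** A deformation argument: the integral has zero derivative in the parameter. The hypotheses hold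
    on an open interval around [0,1] so that two-sided derivatives exist at both ends. *)
Lemma oint_param_const (F F' : R -> R -> C) (d : R) : (0 < d)%R ->
  (forall u v, (- d < u < 1 + d)%R -> cder (fun u => F u v) u (F' u v)) ->
  (forall u v, (- d < u < 1 + d)%R ->
     tc (fun z : R2 => F' (fst z) (snd z)) (u, v)) ->
  (forall u v, (- d < u < 1 + d)%R -> tc (F u) v) ->
  (forall u, (0 <= u <= 1)%R -> oint (F' u) = 0) ->
  oint (F 0%R) = oint (F 1%R).
Proof.
  intros Hd H1 H2 H3 H4. pose proof two_PI_pos as Hpi.
  assert (Hr : forall x u, (0 <= x <= 1)%R -> (Rabs (u - x) < d)%R -> (- d < u < 1 + d)%R).
  { intros x u Hx Hu. apply Rabs_def2 in Hu. lra. }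
  assert (K : forall f f' : R -> R -> R,
    (forall u v, (- d < u < 1 + d)%R -> is_derive (fun u => f u v) u (f' u v)) ->
    (forall u v, (- d < u < 1 + d)%R -> continuity_2d_pt f' u v) ->
    (forall u v, (- d < u < 1 + d)%R -> continuous (f u) v) ->
    (forall u, (0 <= u <= 1)%R -> RInt (f' u) 0 (2 * PI) = 0%R) ->
    RInt (f 0%R) 0 (2 * PI) = RInt (f 1%R) 0 (2 * PI)).
  { intros f f' K1 K2 K3 K4.
    apply (eq_is_derive (V := R_NormedModule) (fun u => RInt (f u) 0 (2 * PI)) 0 1); [|lra].
    intros t Ht. refine (eq_ind _ (fun l : R => @is_derive R_AbsRing R_NormedModule _ t l) _ _ (K4 t Ht)).
    apply (RInt_param_derive f f' _ _ _ d); eauto; try lra.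
    intros v. apply K2. lra. }
  unfold oint, CInt. f_equal.
  - apply (K (fun u v => Re (F u v)) (fun u v => Re (F' u v))); intros u; intros.
    + apply H1; auto.
    + apply continuity_2d_pt_filterlim. apply (proj1 (tc_iff _ _ _) (H2 u v H)).
    + apply (proj1 (tc_iff _ _ _) (H3 u v H)).
    + exact (f_equal Re (H4 u H)).
  - apply (K (fun u v => Im (F u v)) (fun u v => Im (F' u v))); intros u; intros.
    + apply H1; auto.
    + apply continuity_2d_pt_filterlim. apply (proj1 (tc_iff _ _ _) (H2 u v H)).
    + apply (proj1 (tc_iff _ _ _) (H3 u v H)).
    + exact (f_equal Im (H4 u H)).
Qed.

Lemma circ_sub_neq_0 (r t : R) (a : C) : (Cmod a < r)%R -> circ r t - a <> 0.
Proof.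
  intros H E. pose proof (Cmod_ge_0 a).
  assert (E1 : circ r t = a) by (replace a with (circ r t - (circ r t - a)) by ring; rewrite E; ring).
  assert (Hr : (0 <= r)%R) by lra. rewrite <- E1, Cmod_circ in H; lra.
Qed.

Lemma circ_neq_0 (r t : R) : (0 < r)%R -> circ r t <> 0.
Proof. intros H. apply Cmod_pos_neq. rewrite Cmod_circ; lra. Qed.

Lemma tc_pole (r : R) (p : C) (t : R) : (Cmod p < r)%R -> tc (fun t => / (circ r t - p)) t.
Proof.
  intros Hp. apply tc_inv. apply circ_sub_neq_0; auto. apply tc_minus. apply tc_circ. apply tc_const.
Qed.

Lemma tc_circ_quot (r : R) (z : C) (t : R) : (Cmod z < r)%R -> tc (fun t => circ r t / (circ r t - z)) t.
Proof. intros Hz. apply (tc_mult _ (circ r)). apply tc_circ. apply tc_pole; auto. Qed.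

Lemma tc_circ_inv_pow (r : R) (n : nat) (t : R) : (0 < r)%R -> tc (fun t => / circ r t ^ n) t.
Proof.
  intros Hr. apply (tc_inv _ (fun t => circ r t ^ n)). apply Cpow_nz, circ_neq_0; auto.
  apply tc_pow, tc_circ.
Qed.

Lemma oint_lin (a : C) (f g : R -> C) : (forall t, tc f t) -> (forall t, tc g t) ->
  oint (fun t => a * (f t - g t)) = a * (oint f - oint g).
Proof.
  intros Hf Hg. pose proof two_PI_pos. unfold oint.
  rewrite CInt_scal; [|lra|intros; apply tc_minus; auto]. f_equal.
  transitivity (CInt (fun t => f t + - (1) * g t) 0 (2 * PI)).
  { apply CInt_ext. lra. intros; ring. }
  rewrite CInt_plus; [|lra|auto|intros; apply (tc_mult _ (fun _ => - (1)) g); auto; apply tc_const].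
  rewrite CInt_scal by (auto; lra). ring.
Qed.

Lemma oint_ext (f g : R -> C) : (forall t, f t = g t) -> oint f = oint g.
Proof. intros E. apply CInt_ext; auto. pose proof two_PI_pos. lra. Qed.

Lemma Ci_neq_0 : Ci <> 0.
Proof. apply Cmod_pos_neq. rewrite Cmod_Ci. lra. Qed.

(* A periodic function has zero total derivative; here the derivative is
   [c * g], so that the integral of [g] itself vanishes. *)
Lemma oint_deriv_0 (G g : R -> C) (c : C) : c <> 0 ->
  G (2 * PI)%R = G 0%R -> (forall t, cder G t (c * g t)) -> (forall t, tc g t) -> oint g = 0.
Proof.
  intros Hc HG HD Hg. pose proof two_PI_pos.
  assert (E : c * oint g = 0).
  { unfold oint. rewrite <- CInt_scal by (try lra; auto).
    rewrite (CInt_deriv G (fun t => c * g t)).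
    - rewrite HG. ring.
    - lra.
    - auto.
    - intros t _. apply (tc_mult _ (fun _ => c)); auto. apply tc_const. }
  replace (oint g) with (/ c * (c * oint g)) by (field; auto). rewrite E. ring.
Qed.

(** Moving the pole to the centre along u a turns the integrand into the constant 1. For each u the
    u-derivative is, up to a constant, the total derivative of a/(w - u a), so it integrates to
    0. *)
Lemma oint_circ_quot (r : R) (a : C) : (0 < r)%R -> (Cmod a < r)%R ->
  oint (fun t => circ r t / (circ r t - a)) = RtoC (2 * PI).
Proof.
  intros Hr Ha. pose proof (Cmod_ge_0 a) as Ha0.
  (* Chosen so that the pole u a stays inside the circle for u up to 1 + d. *)
  set (d := ((r - Cmod a) / (2 * r))%R).
  assert (Hd : (0 < d)%R) by (apply Rdiv_lt_0_compat; lra).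
  assert (Hd1 : (d * r = (r - Cmod a) / 2)%R) by (unfold d; field; lra).
  assert (Hd2 : (d <= 1 / 2)%R).
  { apply Rmult_le_reg_r with r; [lra|]. rewrite Hd1. lra. }
  assert (Hu : forall u, (- d < u < 1 + d)%R -> (Cmod (RtoC u * a) < r)%R).
  { intros u Hu. rewrite Cmod_mult, Cmod_R.
    assert (Rabs u < 1 + d)%R by (apply Rabs_def1; lra).
    destruct (Rle_lt_dec (Cmod a) 0). nra.
    apply Rlt_le_trans with ((1 + d) * Cmod a)%R; [apply Rmult_lt_compat_r; auto|]. nra. }
  rewrite <- (Cmult_1_l (RtoC (2 * PI))), <- oint_const.
  transitivity (oint (fun t => circ r t / (circ r t - RtoC 1 * a))).
  { apply CInt_ext. pose proof two_PI_pos; lra. intros. now rewrite Cmult_1_l. }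
  transitivity (oint (fun t => circ r t / (circ r t - RtoC 0 * a))).
  2:{ apply CInt_ext. pose proof two_PI_pos; lra. intros. 
      replace (circ r t - RtoC 0 * a) with (circ r t) by ring. field. apply circ_neq_0; auto. }
  symmetry.
  apply (oint_param_const (fun u t => circ r t / (circ r t - RtoC u * a))
     (fun u t => circ r t * a / ((circ r t - RtoC u * a) * (circ r t - RtoC u * a))) d); auto.
  - intros u v H. pose proof (circ_sub_neq_0 r v _ (Hu u H)) as N.
    apply cder_val with (circ r v * (- a * (- / ((circ r v - RtoC u * a) * (circ r v - RtoC u * a))))).
    field; auto.
    apply (cder_scal (circ r v) (fun u => / (circ r v - RtoC u * a))).
    apply (cder_comp (fun w => / w) (fun u => circ r v - RtoC u * a)). apply cdv_inv_id; auto.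
    apply cder_val with (0 - (RtoC 1 * a + RtoC u * 0)). ring.
    apply cder_minus. apply cder_const.
    apply (cder_mult (fun t => RtoC t) (fun _ => a)); [|apply cder_const].
    apply cder_RtoC_id.
  - intros u v H. pose proof (circ_sub_neq_0 r v _ (Hu u H)) as N.
    assert (T1 : tc (fun z : R2 => circ r (snd z)) (u, v)).
    { apply (continuous_comp (fun z : R2 => snd z) (circ r)).
      apply continuous_snd. apply tc_circ. }
    assert (T2 : tc (fun z : R2 => RtoC (fst z)) (u, v)).
    { apply tc_RtoC. apply continuous_fst. }
    assert (T3 : tc (fun z : R2 => circ r (snd z) - RtoC (fst z) * a) (u, v)).
    { apply tc_minus; auto. apply tc_mult; auto. apply tc_const. }
    apply tc_mult. apply tc_mult; auto. apply tc_const.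
    apply (tc_inv _ (fun z => (circ r (snd z) - RtoC (fst z) * a) * (circ r (snd z) - RtoC (fst z) * a))).
    apply Cmult_neq_0; auto. apply tc_mult; auto.
  - intros u v H. pose proof (circ_sub_neq_0 r v _ (Hu u H)) as N.
    apply tc_mult. apply tc_circ. apply tc_inv; auto. apply tc_minus. apply tc_circ. apply tc_const.
  - intros u H.
    assert (Hb : (Cmod (RtoC u * a) < r)%R) by (apply Hu; lra).
    set (b := RtoC u * a) in *.
    apply oint_deriv_0 with (G := fun t => a * / (circ r t - b)) (c := - Ci).
    + intros E. apply Ci_neq_0. replace Ci with (- - Ci) by ring. rewrite E. ring.
    + rewrite circ_2PI. reflexivity.
    + intros t. pose proof (circ_sub_neq_0 r t b Hb) as N.
      apply cder_val with (a * ((Ci * circ r t - 0) * (- / ((circ r t - b) * (circ r t - b))))).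
      field; auto.
      apply cder_scal. apply (cder_comp (fun w => / w) (fun t => circ r t - b)). apply cdv_inv_id; auto.
      apply cder_minus. apply cder_circ. apply cder_const.
    + intros t. pose proof (circ_sub_neq_0 r t b Hb) as N.
      apply tc_mult. apply tc_mult. apply tc_circ. apply tc_const.
      assert (T : tc (fun t => circ r t - b) t) by (apply tc_minus; [apply tc_circ | apply tc_const]).
      apply (tc_inv _ (fun t => (circ r t - b) * (circ r t - b))). apply Cmult_neq_0; auto.
      exact (tc_mult _ _ _ t T T).
Qed.

Lemma oint_circ_inv_pow (r : R) (n : nat) : (0 < r)%R -> oint (fun t => / circ r t ^ S n) = 0.
Proof.
  intros Hr.
  assert (N : forall t, circ r t <> 0) by (intros; apply circ_neq_0; auto).
  apply oint_deriv_0 with (G := fun t => / circ r t ^ S n) (c := - (RtoC (INR (S n)) * Ci)).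
  - intros E. assert (E2 : RtoC (INR (S n)) * Ci = 0)
      by (replace (RtoC (INR (S n)) * Ci) with (- - (RtoC (INR (S n)) * Ci)) by ring; rewrite E; ring).
    apply (f_equal Cmod) in E2. rewrite Cmod_mult, Cmod_Ci, Cmod_0, Cmod_R, Rabs_pos_eq in E2 by apply pos_INR.
    rewrite S_INR in E2. pose proof (pos_INR n). lra.
  - rewrite circ_2PI. reflexivity.
  - intros t.
    apply cder_val with ((Ci * circ r t * (RtoC (INR (S n)) * circ r t ^ n)) * (- / (circ r t ^ S n * circ r t ^ S n))).
    { pose proof (Cpow_nz _ n (N t)). simpl. field. auto. }
    apply (cder_comp (fun w => / w) (fun t => circ r t ^ S n)). apply cdv_inv_id. apply Cpow_nz; auto.
    apply (cder_comp (fun w => w ^ S n) (circ r)). apply cdv_pow. apply cder_circ.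
  - intros t. apply tc_circ_inv_pow; auto.
Qed.

Lemma cauchy_formula (V V' : C -> C) (r R0 : R) (a : C) : (0 < r < R0)%R -> (Cmod a < r)%R ->
  (forall z, (Cmod z < R0)%R -> cdv V z (V' z)) ->
  (forall z, (Cmod z < R0)%R -> ccont V' z) ->
  oint (fun t => V (circ r t) * (circ r t / (circ r t - a))) = V a * RtoC (2 * PI).
Proof.
  intros Hr Ha HV HV'. pose proof (Cmod_ge_0 a) as Ha0. pose proof two_PI_pos as Hpi.
  (* The point a + u (w - a) has modulus at most (|1 - u| + |u|) r <= (1 + 2 d) r, which is (r +
     R0)/2. *)
  set (d := ((R0 - r) / (4 * r))%R).
  assert (Hd : (0 < d)%R) by (apply Rdiv_lt_0_compat; lra).
  assert (Hd1 : (d * r = (R0 - r) / 4)%R) by (unfold d; field; lra).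
  set (pt := fun u t => a + RtoC u * (circ r t - a)).
  assert (Hpt : forall u t, (- d < u < 1 + d)%R -> (Cmod (pt u t) < R0)%R).
  { intros u t Hu. unfold pt.
    replace (a + RtoC u * (circ r t - a)) with (RtoC (1 - u) * a + RtoC u * circ r t)
      by (rewrite RtoC_minus; ring).
    eapply Rle_lt_trans. apply Cmod_triangle. rewrite !Cmod_mult, !Cmod_R, Cmod_circ by lra.
    assert (K : (Rabs (1 - u) + Rabs u <= 1 + 2 * d)%R)
      by (unfold Rabs; repeat destruct Rcase_abs; lra).
    assert (Rabs (1 - u) * Cmod a <= Rabs (1 - u) * r)%R
      by (apply Rmult_le_compat_l; [apply Rabs_pos | lra]).
    nra. }
  assert (N : forall t, circ r t - a <> 0) by (intros; apply circ_sub_neq_0; auto).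
  rewrite <- (oint_circ_quot r a) by lra.
  assert (Tq : forall t, tc (fun t => circ r t / (circ r t - a)) t).
  { intros t. apply tc_circ_quot; auto. }
  transitivity (oint (fun t => V a * (circ r t / (circ r t - a)))).
  2:{ apply CInt_scal; auto. lra. }
  transitivity (oint (fun t => V (pt 1%R t) * (circ r t / (circ r t - a)))).
  { apply CInt_ext. lra. intros t _. f_equal. f_equal. unfold pt. ring. }
  transitivity (oint (fun t => V (pt 0%R t) * (circ r t / (circ r t - a)))).
  2:{ apply CInt_ext. lra. intros t _. f_equal. f_equal. unfold pt. ring. }
  symmetry.
  assert (Dpt : forall u t, cder (fun u => pt u t) u (circ r t - a)).
  { intros u t. unfold pt. apply cder_val with (0 + (RtoC 1 * (circ r t - a) + RtoC u * 0)). ring.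
    apply cder_plus. apply cder_const. apply (cder_mult (fun t => RtoC t)); [|apply cder_const].
    apply cder_RtoC_id. }
  assert (Dpt2 : forall u t, cder (pt u) t (RtoC u * Ci * circ r t)).
  { intros u t. unfold pt. apply cder_val with (0 + RtoC u * (Ci * circ r t - 0)). ring.
    apply cder_plus. apply cder_const. apply cder_scal. apply cder_minus. apply cder_circ. apply cder_const. }
  apply (oint_param_const (fun u t => V (pt u t) * (circ r t / (circ r t - a)))
     (fun u t => V' (pt u t) * circ r t) d); auto.
  - intros u t Hu.
    apply cder_val with (((circ r t - a) * V' (pt u t)) * (circ r t / (circ r t - a)) + V (pt u t) * 0).
    field; auto.
    apply (cder_mult (fun u => V (pt u t)) (fun _ => circ r t / (circ r t - a))); [|apply cder_const].
    apply (cder_comp V (fun u => pt u t)). apply HV; auto. apply Dpt.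
  - intros u t Hu.
    assert (T1 : tc (fun z : R2 => circ r (snd z)) (u, t)).
    { apply (continuous_comp (fun z : R2 => snd z) (circ r)).
      apply continuous_snd. apply tc_circ. }
    apply tc_mult; auto.
    apply (tc_comp _ (fun z : R2 => pt (fst z) (snd z)) V').
    2: apply HV'; apply Hpt; auto.
    unfold pt. apply tc_plus. apply tc_const. apply tc_mult. apply tc_RtoC, continuous_fst.
    apply tc_minus; auto. apply tc_const.
  - intros u t Hu. apply (tc_mult _ (fun t => V (pt u t))); auto.
    apply tc_comp. eapply cder_tc; apply Dpt2. eapply cdv_cont, HV; auto.
  - intros u Hu.
    assert (Hu' : (- d < u < 1 + d)%R) by lra.
    assert (Tw : forall t, tc (fun t => V' (pt u t) * circ r t) t).
    { intros t. apply (tc_mult _ (fun t => V' (pt u t))); [|apply tc_circ].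
      apply tc_comp. eapply cder_tc; apply Dpt2. apply HV'; auto. }
    (* For u <> 0 the integrand is the t-derivative of V at the moving point divided by i u. At u =
       0 that point is constantly a, and the primitive is V'(a) w / i instead. *)
    destruct (Req_dec u 0) as [->|Hu0].
    + apply oint_deriv_0 with (G := fun t => V' a * circ r t) (c := Ci).
      * apply Ci_neq_0.
      * rewrite circ_2PI. reflexivity.
      * intros t. replace (pt 0%R t) with a by (unfold pt; ring).
        apply cder_val with (V' a * (Ci * circ r t)). ring. apply cder_scal. apply cder_circ.
      * exact Tw.
    + apply oint_deriv_0 with (G := fun t => V (pt u t)) (c := RtoC u * Ci).
      * apply Cmult_neq_0; [|apply Ci_neq_0]. intros E. apply Hu0. exact (f_equal Re E).
      * unfold pt. rewrite circ_2PI. reflexivity.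
      * intros t. apply cder_val with (RtoC u * Ci * circ r t * V' (pt u t)). ring.
        apply (cder_comp V (pt u)). apply HV; auto. apply Dpt2.
      * exact Tw.
Qed.

Lemma holo_cauchy (f : C -> C) (r R0 : R) (a : C) : (0 < r < R0)%R -> (Cmod a < r)%R -> holo f R0 ->
  oint (fun t => f (circ r t) * (circ r t / (circ r t - a))) = f a * RtoC (2 * PI).
Proof.
  intros Hr Ha Hf. destruct (holo_cdv f R0 Hf) as [f' [H1 H2]].
  apply cauchy_formula with f' R0; auto. intros z Hz. eapply holo_cont; eauto.
Qed.

Lemma oint_Cmod_le_const (g : R -> C) (m : R) : (forall t, tc g t) ->
  (forall t, (Cmod (g t) <= m)%R) -> (Cmod (oint g) <= 4 * PI * m)%R.
Proof.
  intros Hg Hm. pose proof two_PI_pos as Hpi.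
  replace (4 * PI * m)%R with (2 * ((2 * PI - 0) * m))%R by ring.
  apply CInt_Cmod_le with (fun _ => m); auto. lra.
  apply (is_RInt_const (V := R_NormedModule) 0 (2 * PI) m).
Qed.

Lemma cser_limit (a : nat -> C) (l : C) (e : nat -> R) :
  (forall n, (Cmod (l - csum_n a n) <= e n)%R) -> is_lim_seq e 0 -> cser a l.
Proof.
  intros H He. apply filterlim_locally. intros eps.
  destruct (proj1 (filterlim_locally _ _) He eps) as [N HN].
  exists N. intros n Hn. apply ball_of_Cmod. rewrite Cmod_sub_comm.
  eapply Rle_lt_trans. apply H. specialize (HN n Hn).
  unfold ball in HN. simpl in HN. unfold AbsRing_ball, abs, minus, plus, opp in HN. simpl in HN.
  apply Rabs_def2 in HN. lra.
Qed.

Lemma tc_bounded (g : R -> C) (a b : R) : (a <= b)%R -> (forall t, (a <= t <= b)%R -> tc g t) ->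
  exists t0, (a <= t0 <= b)%R /\ forall t, (a <= t <= b)%R -> (Cmod (g t) <= Cmod (g t0))%R.
Proof.
  intros Hab H.
  destruct (continuity_ab_maj (fun t => Cmod (g t)) a b Hab) as [t0 [H1 H2]].
  - intros t Ht. apply continuity_pt_filterlim. apply tc_Cmod. auto.
  - exists t0. auto.
Qed.

(** Converts complex differentiability with continuous derivative into a power series, at the price
    of a smaller disc. The coefficients are Cauchy's integrals; a finite geometric identity with an
    explicit remainder takes the place of exchanging a series with the integral. *)
Lemma cauchy_power_series (V V' : C -> C) (r R0 : R) : (0 < r < R0)%R ->
  (forall z, (Cmod z < R0)%R -> cdv V z (V' z)) ->
  (forall z, (Cmod z < R0)%R -> ccont V' z) -> holo V r.
Proof.
  intros Hr HV HV'. pose proof two_PI_pos as Hpi.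
  assert (N : forall t, circ r t <> 0) by (intros; apply circ_neq_0; lra).
  assert (TV : forall t, tc (fun t => V (circ r t)) t).
  { intros t. apply tc_comp. apply tc_circ. eapply cdv_cont, HV. rewrite Cmod_circ; lra. }
  destruct (tc_bounded (fun t => V (circ r t)) 0 (2 * PI)) as [t0 [_ Ht0]]; [lra | auto|].
  set (M := Cmod (V (circ r t0))) in *.
  assert (HM0 : (0 <= M)%R) by apply Cmod_ge_0.
  assert (Tp : forall n t, tc (fun t => / circ r t ^ n) t).
  { intros n t. apply tc_circ_inv_pow. lra. }
  set (c := fun n => oint (fun t => V (circ r t) * / circ r t ^ n) / RtoC (2 * PI)).
  assert (Hpic : RtoC (2 * PI) <> 0).
  { apply Cmod_pos_neq. rewrite Cmod_R, Rabs_pos_eq; lra. }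
  assert (Tc : forall n t, tc (fun t => V (circ r t) * / circ r t ^ n) t).
  { intros. apply (tc_mult _ (fun t => V (circ r t)) (fun t => / circ r t ^ n)); auto. }
  assert (Hc : cbound c r).
  { exists (2 * (2 * PI * M) / (2 * PI))%R. intros n.
    assert (Hrn : (0 < r ^ n)%R) by (apply pow_lt; lra).
    unfold c. rewrite Cmod_div by auto. rewrite Cmod_R, Rabs_pos_eq by lra.
    assert (K : (Cmod (oint (fun t => V (circ r t) * / circ r t ^ n)%C) <= 2 * ((2 * PI - 0) * (M / r ^ n)))%R).
    { apply CInt_Cmod_le with (fun _ => (M / r ^ n)%R); auto. lra.
      2: apply (is_RInt_const (V := R_NormedModule)).
      intros t Ht. rewrite Cmod_mult, Cmod_inv by (apply Cpow_nz; auto).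
      rewrite Cmod_pow, Cmod_circ by lra. apply Rmult_le_compat_r; auto.
      left; apply Rinv_0_lt_compat; auto. }
    apply Rmult_le_compat_r with (r := (r ^ n / (2 * PI))%R) in K.
    - unfold Rdiv in *. eapply Rle_trans; [|eapply Rle_trans; [exact K|]].
      right; ring. right. field. pose proof PI_neq0. repeat split; lra.
    - apply Rdiv_le_0_compat; lra. }
  exists c. split.
  { intros s Hs. apply cbound_le with r; auto. lra. }
  intros a Ha. symmetry. apply cser_value.
  pose proof (Cmod_ge_0 a) as Ha0.
  assert (Na : forall t, circ r t - a <> 0) by (intros; apply circ_sub_neq_0; auto).
  (* [rem n] is 2 pi times the tail of the series from index n on. It obeys [R1] because w/(w - a) =
     1 + (a/w) w/(w - a), and it decays like (|a|/r)^n. *)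
  set (rem := fun n => oint (fun t => V (circ r t) * ((a / circ r t) ^ n * (circ r t / (circ r t - a))))).
  assert (Tq : forall t, tc (fun t => circ r t / (circ r t - a)) t).
  { intros t. apply tc_circ_quot; auto. }
  assert (Trem : forall n t, tc (fun t => V (circ r t) * ((a / circ r t) ^ n * (circ r t / (circ r t - a)))) t).
  { intros n t. apply (tc_mult _ (fun t => V (circ r t))); auto.
    apply (tc_mult _ (fun t => (a / circ r t) ^ n)); auto.
    apply tc_pow. apply tc_mult. apply tc_const. apply tc_inv; auto. apply tc_circ. }
  assert (R1 : forall n, rem n = c n * a ^ n * RtoC (2 * PI) + rem (S n)).
  { intros n. unfold rem, c.
    replace (oint (fun t => V (circ r t) * / circ r t ^ n) / RtoC (2 * PI) * a ^ n * RtoC (2 * PI))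
      with (a ^ n * oint (fun t => V (circ r t) * / circ r t ^ n)) by (field; auto).
    unfold oint at 2. rewrite <- CInt_scal by (try lra; auto).
    unfold oint at 2. rewrite <- CInt_plus; [|lra| |auto].
    2:{ intros t _. apply (tc_mult _ (fun _ => a ^ n) (fun t => V (circ r t) * / circ r t ^ n)); auto. apply tc_const. }
    apply CInt_ext. lra. intros t _. unfold Cdiv at 1 3. rewrite !Cpow_mult_l, !Cpow_inv by auto.
    simpl. pose proof (Cpow_nz _ n (N t)). field. auto. }
  assert (R2 : forall n, V a * RtoC (2 * PI) = csum_n (fun n => c n * a ^ n) n * RtoC (2 * PI) + rem (S n)).
  { induction n.
    - rewrite sum_O, <- R1. rewrite <- (cauchy_formula V V' r R0 a) by auto.
      apply CInt_ext. lra. intros t _. simpl. f_equal. ring.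
    - rewrite sum_Sn. change plus with Cplus. rewrite IHn, (R1 (S n)). ring. }
  apply cser_limit with (e := fun n => (2 * M * (r / (r - Cmod a)) * (Cmod a / r) * (Cmod a / r) ^ n)%R).
  - intros n. 
    replace (V a - csum_n (fun n => c n * a ^ n) n) with (rem (S n) / RtoC (2 * PI)).
    2:{ transitivity (V a * RtoC (2 * PI) / RtoC (2 * PI) - csum_n (fun n => c n * a ^ n) n).
        rewrite (R2 n). field; auto. f_equal. field; auto. }
    rewrite Cmod_div by auto. rewrite (Cmod_R (2 * PI)), Rabs_pos_eq by lra.
    apply (proj2 (Rle_div_l _ _ _ Hpi)).
    assert (K : (Cmod (rem (S n)) <= 2 * ((2 * PI - 0) * (M * ((Cmod a / r) ^ S n * (r / (r - Cmod a))))))%R).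
    { apply CInt_Cmod_le with (fun _ => (M * ((Cmod a / r) ^ S n * (r / (r - Cmod a))))%R); auto. lra.
      2: apply (is_RInt_const (V := R_NormedModule)).
      intros t Ht. rewrite !Cmod_mult. apply Rmult_le_compat; auto; try apply Cmod_ge_0.
      apply Rmult_le_pos; apply Cmod_ge_0.
      rewrite Cmod_pow, !Cmod_div, Cmod_circ by (auto; lra).
      apply Rmult_le_compat_l. apply pow_le, Rdiv_le_0_compat; lra.
      apply Rmult_le_compat_l. lra. apply Rinv_le_contravar. lra.
      pose proof (Cmod_sub_ge (circ r t) a) as Q. rewrite Cmod_circ in Q; lra. }
    eapply Rle_trans. exact K. right. simpl. ring.
  - apply is_lim_seq_ext with (fun n => (2 * M * (r / (r - Cmod a)) * (Cmod a / r)) * ((Cmod a / r) ^ n))%R.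
    reflexivity.
    replace (Finite 0) with (Rbar_mult (2 * M * (r / (r - Cmod a)) * (Cmod a / r))%R 0).
    2:{ simpl. f_equal. ring. }
    apply is_lim_seq_scal_l. apply is_lim_seq_geom. rewrite Rabs_pos_eq.
    apply (Rlt_div_l _ 1); lra. apply Rdiv_le_0_compat; lra.
Qed.

(** * Liouville's theorem and Laurent expansions *)

Lemma Cminus_neq_0 (a b : C) : a <> b -> a - b <> 0.
Proof. intros H E. apply H. replace a with (a - b + b) by ring. rewrite E. ring. Qed.

(** The reciprocal is visibly differentiable but its coefficients are not explicit, so the power
    series comes from Cauchy's formula. This is where the disc shrinks. *)
Lemma holo_inv (U : C -> C) (r R0 : R) : (0 < r < R0)%R -> holo U R0 ->
  (forall z, (Cmod z < R0)%R -> U z <> 0) -> holo (fun z => / U z) r.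
Proof.
  intros Hr HU H0. destruct (holo_cdv U R0 HU) as [U' [H1 H2]].
  apply cauchy_power_series with (fun z => - U' z / (U z * U z)) R0; auto.
  - intros z Hz. apply cdv_inv; auto.
  - intros z Hz.
    assert (CU : ccont U z) by (eapply holo_cont; eauto).
    assert (CU' : ccont U' z) by (eapply holo_cont; eauto).
    apply (tc_mult _ (fun z => - U' z) (fun z => / (U z * U z))).
    + apply (continuous_opp (V := C_NormedModule) U' z CU').
    + apply (tc_inv _ (fun z => U z * U z)). apply Cmult_neq_0; auto. apply tc_mult; auto.
Qed.

Lemma psum_shift (c : nat -> C) (R0 : R) (z : C) : rad c R0 -> (Cmod z < R0)%R ->
  psum c z = c O + z * psum (fun n => c (S n)) z.
Proof.
  intros H Hz. apply cser_value.
  replace (c O) with (c O * z ^ O) by (simpl; ring).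
  apply (cser_cons (fun n => c n * z ^ n)).
  apply cser_ext with (fun n => z * (c (S n) * z ^ n)). intros; simpl; ring.
  apply cser_scal. apply psum_correct with R0; auto. apply rad_shift; auto.
Qed.

Lemma psum_0 (c : nat -> C) : psum c 0 = c O.
Proof.
  apply cser_value. replace (c O) with (c O * 0 ^ O + 0) by (simpl; ring).
  apply (cser_cons (fun n => c n * 0 ^ n)).
  eapply cser_ext; [|apply cser_0]. intros; simpl; ring.
Qed.

(** The constant coefficient vanishes by continuity at 0; dividing by z shifts the coefficients and
    the induction goes on. Asking for zeros only on the punctured disc makes this division
    legitimate. *)
Lemma psum_identity (R0 : R) (n : nat) : (0 < R0)%R -> forall c, rad c R0 ->
  (forall z, (0 < Cmod z < R0)%R -> psum c z = 0) -> c n = 0.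
Proof.
  intros HR.
  assert (Z : forall c, rad c R0 -> (forall z, (0 < Cmod z < R0)%R -> psum c z = 0) -> c O = 0).
  { intros c Hc H. apply NNPP. intros N.
    assert (Hm : (0 < Cmod (c O))%R) by (apply Cmod_gt_0; auto).
    assert (K : ccont (psum c) (RtoC 0)).
    { eapply cdv_cont, psum_cdv; eauto. rewrite Cmod_0; auto. }
    destruct (proj1 (ccont_iff _ _) K _ Hm) as [d [Hd H1]].
    set (x := (Rmin d R0 / 2)%R).
    assert (Hx : (0 < x < d /\ x < R0)%R).
    { pose proof (Rmin_pos _ _ Hd HR). pose proof (Rmin_l d R0). pose proof (Rmin_r d R0). unfold x. lra. }
    assert (Hmx : Cmod (RtoC x) = x) by (rewrite Cmod_R, Rabs_pos_eq; lra).
    specialize (H1 (RtoC x)). rewrite H, psum_0 in H1 by lra.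
    replace (RtoC x - 0) with (RtoC x) in H1 by ring.
    replace (0 - c O) with (- c O) in H1 by ring. rewrite Cmod_opp in H1.
    rewrite Hmx in H1. lra. }
  induction n; intros c Hc H; [auto|].
  apply (IHn (fun n => c (S n))).
  - apply rad_shift; auto.
  - intros z Hz. pose proof (psum_shift c R0 z Hc ltac:(lra)) as E.
    rewrite H, (Z c Hc H) in E by auto.
    assert (Hz0 : z <> 0) by (apply Cmod_pos_neq; lra).
    replace (psum (fun n => c (S n)) z) with ((0 + z * psum (fun n => c (S n)) z) / z)
      by (field; auto).
    rewrite <- E. field; auto.
Qed.

(** Subtracting Cauchy's formulas at a and at 0 leaves the kernel a/(w - a), of size |a|/(r - |a|),
    which tends to 0. The bound on the function is required only far from the origin, the form in
    which [laurent_zero] supplies it. *)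
Lemma liouville (c : nat -> C) (rho M : R) : (forall R0, rad c R0) ->
  (forall z, (rho <= Cmod z)%R -> (Cmod (psum c z) <= M)%R) ->
  forall a, psum c a = psum c 0.
Proof.
  intros Hc HM a.
  assert (HM0 : (0 <= M)%R).
  { eapply Rle_trans; [|apply (HM (RtoC (Rabs rho)))]. apply Cmod_ge_0.
    rewrite Cmod_R, Rabs_Rabsolu. apply Rle_abs. }
  assert (Hh : forall R0, holo (psum c) R0) by (intros; exists c; auto).
  pose proof (Cmod_ge_0 a) as Ha0. pose proof two_PI_pos as Hpi.
  assert (K : forall r, (Rmax rho (Cmod a) < r)%R ->
    (Cmod (psum c a - psum c 0) <= 2 * (M * (Cmod a / (r - Cmod a))))%R).
  { intros r Hr. assert (Hr1 : (rho < r)%R) by (eapply Rle_lt_trans; [apply Rmax_l | eauto]).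
    assert (Hr2 : (Cmod a < r)%R) by (eapply Rle_lt_trans; [apply Rmax_r | eauto]).
    assert (N : forall t, circ r t <> 0) by (intros; apply circ_neq_0; lra).
    assert (Na : forall t, circ r t - a <> 0) by (intros; apply circ_sub_neq_0; auto).
    assert (TV : forall t, tc (fun t => psum c (circ r t)) t).
    { intros t. apply tc_comp. apply tc_circ. apply holo_cont with (r + 1)%R; auto. rewrite Cmod_circ; lra. }
    assert (TQ : forall x, (Cmod x < r)%R -> forall t, tc (fun t => psum c (circ r t) * (circ r t / (circ r t - x))) t).
    { intros x Hx t. apply (tc_mult _ (fun t => psum c (circ r t))); auto. apply tc_circ_quot; auto. }
    assert (Hr0 : (Cmod 0 < r)%R) by (rewrite Cmod_0; lra).
    assert (E3 : (psum c a - psum c 0) * RtoC (2 * PI) = oint (fun t => psum c (circ r t) * (a * / (circ r t - a)))).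
    { transitivity (1 * (psum c a * RtoC (2 * PI) - psum c 0 * RtoC (2 * PI))); [ring|].
      rewrite <- (holo_cauchy (psum c) r (r + 1) a), <- (holo_cauchy (psum c) r (r + 1) 0) by (auto; lra).
      rewrite <- oint_lin by (intros; apply TQ; auto). apply oint_ext. intros t.
      pose proof (N t). pose proof (Na t). pose proof (circ_sub_neq_0 r t 0 Hr0). field. auto. }
    assert (Q : (Cmod (oint (fun t => psum c (circ r t) * (a * / (circ r t - a)))%C) <= 4 * PI * (M * (Cmod a / (r - Cmod a))))%R).
    { apply oint_Cmod_le_const.
      - intros t. apply (tc_mult _ (fun t => psum c (circ r t))); auto.
        apply (tc_mult _ (fun _ => a) (fun t => / (circ r t - a))). apply tc_const. apply tc_pole; auto.
      - intros t. rewrite !Cmod_mult, Cmod_inv by auto.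
        apply Rmult_le_compat; try apply Cmod_ge_0.
        + apply Rmult_le_pos; [lra|]. left. apply Rinv_0_lt_compat. apply Cmod_gt_0; auto.
        + apply HM. rewrite Cmod_circ; lra.
        + apply Rmult_le_compat_l; auto. apply Rinv_le_contravar. lra.
          pose proof (Cmod_sub_ge (circ r t) a) as Q. rewrite Cmod_circ in Q; lra. }
    rewrite <- E3, Cmod_mult, (Cmod_R (2 * PI)), Rabs_pos_eq in Q by lra.
    apply Rmult_le_reg_r with (2 * PI)%R; lra. }
  assert (Z : Cmod (psum c a - psum c 0) = 0%R).
  { apply Rle_antisym; [|apply Cmod_ge_0]. apply Rnot_lt_le. intros Hlt.
    set (e := Cmod (psum c a - psum c 0)) in *.
    (* With this radius r - |a| exceeds 4 M |a| / e, so the estimate [K] would give e <= e/2. *)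
    set (r := (Rabs rho + Cmod a + 1 + 4 * M * Cmod a / e)%R).
    assert (0 <= 4 * M * Cmod a / e)%R by (apply Rdiv_le_0_compat; [|auto]; repeat apply Rmult_le_pos; lra).
    pose proof (Rabs_pos rho). pose proof (Rle_abs rho).
    assert (Hr : (Rmax rho (Cmod a) < r)%R) by (apply Rmax_lub_lt; unfold r; lra).
    specialize (K r Hr).
    assert (Hd : (0 < r - Cmod a)%R) by (unfold r; lra).
    apply Rmult_le_compat_r with (r := (r - Cmod a)%R) in K; [|lra].
    replace (2 * (M * (Cmod a / (r - Cmod a))) * (r - Cmod a))%R with (2 * M * Cmod a)%R in K by (field; lra).
    assert (e * (4 * M * Cmod a / e) = 4 * M * Cmod a)%R by (field; lra).
    assert (e * (r - Cmod a) = e * (Rabs rho + 1) + 4 * M * Cmod a)%R by (unfold r; nra).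
    assert (0 <= M * Cmod a)%R by nra.
    nra. }
  apply Cmod_eq_0 in Z. replace (psum c a) with (psum c a - psum c 0 + psum c 0) by ring. rewrite Z; ring.
Qed.

Lemma rad_of_cser (d : nat -> C) (R0 : R) : 
  (forall z, (0 < Cmod z < R0)%R -> exists s, cser (fun n => d n * z ^ n) s) -> rad d R0.
Proof.
  intros H r Hr. set (s := ((r + R0) / 2)%R).
  assert (Hs : (0 < s < R0)%R) by (unfold s; lra).
  apply cbound_le with s; [unfold s; lra|].
  destruct (H (RtoC s)) as [l Hl].
  { rewrite Cmod_R, Rabs_pos_eq; lra. }
  destruct (cser_bounded _ _ Hl) as [M HM]. exists M. intros n. specialize (HM n).
  cbv beta in HM. rewrite Cmod_mult, Cmod_pow, Cmod_R, Rabs_pos_eq in HM by lra. exact HM.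
Qed.

(* The principal part is an entire function of 1/z, bounded near infinity because
   there it is minus the regular part. *)
Lemma laurent_zero (d : Z -> C) (r : R) : (0 < r)%R ->
  (forall z, (0 < Cmod z < r)%R -> exists s t,
     cser (fun n => d (Z.of_nat n) * z ^ n) s /\
     cser (fun n => d (- Z.of_nat (S n))%Z / z ^ S n) t /\ s + t = 0) ->
  forall n, d n = 0.
Proof.
  intros Hr H.
  set (a := fun n => d (Z.of_nat n)).
  set (b := fun n => match n with O => RtoC 0 | S k => d (- Z.of_nat (S k))%Z end).
  assert (Ha : rad a r).
  { apply rad_of_cser. intros z Hz. destruct (H z Hz) as [s [t [H1 _]]]. exists s; auto. }
  assert (Hb1 : forall z, (0 < Cmod z < r)%R -> cser (fun n => b n * (/ z) ^ n) (- psum a z)).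
  { intros z Hz. destruct (H z Hz) as [s [t [H1 [H2 H3]]]].
    assert (Hz0 : z <> 0) by (apply Cmod_pos_neq; lra).
    replace (psum a z) with s by (symmetry; apply cser_value; auto).
    replace (- s) with (b O * (/ z) ^ O + t)
      by (simpl; replace t with (s + t - s) by ring; rewrite H3; ring).
    apply (cser_cons (fun n => b n * (/ z) ^ n)). eapply cser_ext; [|apply H2].
    intros n. rewrite Cpow_inv by auto. reflexivity. }
  assert (Hb : forall R0, rad b R0).
  { intros R0 s Hs. set (x := (s + 1 + / r)%R).
    assert (Hx : (0 < / r)%R) by (apply Rinv_0_lt_compat; auto).
    assert (Hx2 : (0 < / x < r)%R).
    { split. apply Rinv_0_lt_compat; unfold x; lra. rewrite <- (Rinv_inv r).
      apply Rinv_lt_contravar. apply Rmult_lt_0_compat; unfold x; lra. unfold x; lra. }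
    apply cbound_le with x; [unfold x; lra|].
    assert (Hm : Cmod (RtoC (/ x)) = (/ x)%R) by (rewrite Cmod_R, Rabs_pos_eq; lra).
    specialize (Hb1 (RtoC (/ x))). rewrite Hm in Hb1. specialize (Hb1 Hx2).
    destruct (cser_bounded _ _ Hb1) as [M HM]. exists M. intros n. specialize (HM n).
    cbv beta in HM. rewrite Cmod_mult, Cmod_pow, Cmod_inv, Hm, Rinv_inv in HM; auto.
    apply Cmod_pos_neq; rewrite Hm; lra. }
  assert (Hinv : forall z, (0 < Cmod z < r)%R -> psum b (/ z) = - psum a z).
  { intros z Hz. apply cser_value. auto. }
  destruct (rad_abs a r (r / 2) Ha ltac:(lra)) as [M HM].
  assert (Hbz : forall u, psum b u = 0).
  { intros u. rewrite (liouville b (2 / r) M Hb).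
    - rewrite psum_0. reflexivity.
    - intros z Hz. assert (Hr2 : (0 < 2 / r)%R) by (apply Rdiv_lt_0_compat; lra).
      assert (Hz0 : z <> 0) by (apply Cmod_pos_neq; lra).
      assert (Hi : (0 < Cmod (/ z) <= r / 2)%R).
      { rewrite Cmod_inv by auto. split. apply Rinv_0_lt_compat; lra.
        replace (r / 2)%R with (/ (2 / r))%R by (field; lra). apply Rinv_le_contravar; auto. }
      replace z with (/ / z) by (field; auto). rewrite Hinv by lra. rewrite Cmod_opp.
      apply (cser_Cmod_le (fun n => a n * (/ z) ^ n) (fun n => (Cmod (a n) * (r / 2) ^ n)%R)); auto.
      + intros n. rewrite Cmod_mult, Cmod_pow. apply Rmult_le_compat_l. apply Cmod_ge_0.
        apply pow_incr; lra.
      + apply psum_correct with r; auto. lra. }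
  assert (Hb0 : forall n, b n = 0).
  { intros n. apply (psum_identity 1 n Rlt_0_1); auto. }
  assert (Ha0 : forall n, a n = 0).
  { intros n. apply (psum_identity r n Hr); auto. intros z Hz.
    replace (psum a z) with (- - psum a z) by ring. rewrite <- Hinv, Hbz by auto. ring. }
  intros n. destruct (Z_lt_le_dec n 0) as [Hn|Hn].
  - specialize (Hb0 (Z.to_nat (- n))). unfold b in Hb0.
    destruct (Z.to_nat (- n)) as [|k] eqn:E; [lia|]. replace n with (- Z.of_nat (S k))%Z by lia. exact Hb0.
  - specialize (Ha0 (Z.to_nat n)). unfold a in Ha0. rewrite Z2Nat.id in Ha0 by auto. exact Ha0.
Qed.

Lemma is_laurent_unique (f : C -> C) (c : C) (a b : Z -> C) :
  is_laurent f c a -> is_laurent f c b -> forall n, a n = b n.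
Proof.
  intros [r1 [Hr1 H1]] [r2 [Hr2 H2]].
  pose proof (Rmin_pos _ _ Hr1 Hr2) as Hr.
  assert (K : forall n, (fun n => a n - b n) n = 0).
  { apply laurent_zero with (Rmin r1 r2); auto. intros z Hz.
    assert (E : z + c - c = z) by ring.
    pose proof (Rmin_l r1 r2). pose proof (Rmin_r r1 r2).
    specialize (H1 (z + c)). specialize (H2 (z + c)). rewrite E in H1, H2.
    destruct H1 as [s1 [t1 [S1 [T1 E1]]]]; [lra|]. destruct H2 as [s2 [t2 [S2 [T2 E2]]]]; [lra|].
    exists (s1 + - (1) * s2), (t1 + - (1) * t2). repeat split.
    - eapply cser_ext; [|apply (cser_plus _ _ _ _ S1 (cser_scal (- (1)) _ _ S2))]. intros; cbv beta; ring.
    - eapply cser_ext; [|apply (cser_plus _ _ _ _ T1 (cser_scal (- (1)) _ _ T2))]. intros; cbv beta.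
      unfold Cdiv. ring.
    - replace (s1 + - (1) * s2 + (t1 + - (1) * t2)) with (s1 + t1 - (s2 + t2)) by ring.
      rewrite <- E1, <- E2. ring. }
  intros n. specialize (K n). cbv beta in K.
  replace (a n) with (a n - b n + b n) by ring. rewrite K. ring.
Qed.

(** Uniqueness of the expansion is what makes the definite description return the coefficient of any
    expansion at hand. *)
Lemma laurent_coeff_eq (f : C -> C) (c : C) (a : Z -> C) (n : Z) :
  is_laurent f c a -> laurent_coeff f c n = a n.
Proof.
  intros H. apply (iota_unique (V := C_CompleteNormedModule)).
  - intros y [b [Hb <-]]. apply (is_laurent_unique f c b a Hb H).
  - exists a. auto.
Qed.

(** * Partial fractions *)

Fixpoint csum (f : nat -> C) (n : nat) : C :=
  match n with O => 0 | S k => csum f k + f k end.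

Fixpoint cprod (f : nat -> C) (n : nat) : C :=
  match n with O => 1 | S k => cprod f k * f k end.

Lemma csum_ext (f g : nat -> C) (n : nat) :
  (forall i, (i < n)%nat -> f i = g i) -> csum f n = csum g n.
Proof.
  induction n; intros H; simpl; auto. rewrite IHn, H; auto.
Qed.

Lemma csum_plus (f g : nat -> C) (n : nat) : csum (fun i => f i + g i) n = csum f n + csum g n.
Proof. induction n; simpl. ring. rewrite IHn. ring. Qed.

Lemma csum_scal (a : C) (f : nat -> C) (n : nat) : csum (fun i => a * f i) n = a * csum f n.
Proof. induction n; simpl. ring. rewrite IHn. ring. Qed.

Lemma csum_shift (f : nat -> C) (n : nat) : csum f (S n) = f O + csum (fun i => f (S i)) n.
Proof. induction n. simpl; ring. simpl in *. rewrite IHn. ring. Qed.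

Lemma csum_remove (f : nat -> C) (n i : nat) : (i < n)%nat ->
  csum f n = f i + csum (fun l => if Nat.eq_dec l i then RtoC 0 else f l) n.
Proof.
  induction n; intros Hi; simpl; [lia|]. destruct (Nat.eq_dec n i) as [->|Hne].
  - rewrite (csum_ext (fun l => if Nat.eq_dec l i then RtoC 0 else f l) f). ring.
    intros l Hl. destruct (Nat.eq_dec l i); [lia|auto].
  - rewrite IHn by lia. ring.
Qed.

Lemma cprod_neq_0 (f : nat -> C) (n : nat) : (forall i, (i < n)%nat -> f i <> 0) -> cprod f n <> 0.
Proof.
  induction n; intros H; simpl. 
  - intros E. apply (f_equal Cmod) in E. rewrite Cmod_1, Cmod_0 in E. lra.
  - apply Cmult_neq_0; auto.
Qed.

Lemma cprod_eq_0 (f : nat -> C) (n i : nat) : (i < n)%nat -> f i = 0 -> cprod f n = 0.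
Proof.
  induction n; intros Hi H; simpl. lia.
  destruct (Nat.eq_dec i n) as [->|]. rewrite H; ring. rewrite IHn by (auto; lia). ring.
Qed.

Lemma cser_finite (a : nat -> C) (q : nat) : (forall n, (q <= n)%nat -> a n = 0) -> cser a (csum a q).
Proof.
  intros H.
  assert (E : forall n, csum_n a n = csum a (S n)).
  { induction n. rewrite sum_O. simpl. ring.
    rewrite sum_Sn, IHn. reflexivity. }
  assert (E2 : forall k, csum a (q + k) = csum a q).
  { induction k. rewrite Nat.add_0_r; auto. rewrite Nat.add_succ_r. simpl. rewrite IHk, H by lia. ring. }
  apply cser_limit with (fun n => if le_lt_dec q n then 0%R else Cmod (csum a q - csum a (S n))).
  - intros n. rewrite E. destruct (le_lt_dec q n).
    + replace (S n) with (q + (S n - q))%nat by lia. rewrite E2.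
      replace (csum a q - csum a q) with (RtoC 0) by ring. rewrite Cmod_0. lra.
    + lra.
  - apply is_lim_seq_ext_loc with (fun _ => 0%R).
    + exists q. intros n Hn. destruct (le_lt_dec q n); auto. lia.
    + apply is_lim_seq_const.
Qed.

Lemma holo_csum (f : nat -> C -> C) (n : nat) (R0 : R) :
  (forall i, (i < n)%nat -> holo (f i) R0) -> holo (fun z => csum (fun i => f i z) n) R0.
Proof.
  induction n; intros H; simpl. apply holo_const.
  apply (holo_plus (fun z => csum (fun i => f i z) n)); auto.
Qed.

Lemma is_laurent_of_parts (f h : C -> C) (b : nat -> C) (q : nat) (R0 : R) : (0 < R0)%R -> holo h R0 ->
  (forall z, (0 < Cmod z < R0)%R -> f z = csum (fun j => b j / z ^ S j) q + h z) ->
  exists a, is_laurent f 0 a /\ forall j, (j < q)%nat -> a (- Z.of_nat (S j))%Z = b j.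
Proof.
  intros HR [c [Hc1 Hc2]] Hf.
  (* Nonnegative indices carry the power series of [h]. The coefficient of z^(-(k+1)) is [b k],
     whence the predecessor, and it is cut off at k = q. *)
  exists (fun n => if (0 <=? n)%Z then c (Z.to_nat n) else
     if (Nat.ltb (pred (Z.to_nat (- n))) q) then b (pred (Z.to_nat (- n))) else 0).
  set (a := fun n => if (0 <=? n)%Z then c (Z.to_nat n) else
     if (Nat.ltb (pred (Z.to_nat (- n))) q) then b (pred (Z.to_nat (- n))) else RtoC 0).
  assert (A1 : forall n, a (Z.of_nat n) = c n).
  { intros n. unfold a. rewrite (proj2 (Z.leb_le _ _)) by lia. f_equal. lia. }
  assert (A2 : forall n, a (- Z.of_nat (S n))%Z = if Nat.ltb n q then b n else RtoC 0).
  { intros n. unfold a. rewrite (proj2 (Z.leb_gt _ _)) by lia.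
    replace (pred (Z.to_nat (- - Z.of_nat (S n)))) with n by lia. reflexivity. }
  split.
  - exists R0. split; auto. intros z Hz. replace (z - 0) with z in * by ring.
    exists (h z), (csum (fun j => b j / z ^ S j) q). split; [|split].
    + rewrite Hc2 by lra. eapply cser_ext; [|apply (psum_correct c R0); auto; lra].
      intros n. cbv beta. fold (a (Z.of_nat n)). rewrite A1. replace (z - 0) with z by ring. reflexivity.
    + apply cser_ext with (fun n => (if Nat.ltb n q then b n else RtoC 0) / z ^ S n).
      { intros n. fold (a (- Z.of_nat (S n))%Z). rewrite A2. replace (z - 0) with z by ring. reflexivity. }
      replace (csum (fun j => b j / z ^ S j) q) with
        (csum (fun n => (if Nat.ltb n q then b n else RtoC 0) / z ^ S n) q).
      * apply cser_finite. intros n Hn. rewrite (proj2 (Nat.ltb_ge _ _)) by lia.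
        unfold Cdiv. apply Cmult_0_l.
      * apply csum_ext. intros i Hi. rewrite (proj2 (Nat.ltb_lt _ _)) by lia. reflexivity.
    + rewrite Hf by auto. ring.
  - intros j Hj. fold (a (- Z.of_nat (S j))%Z). rewrite A2, (proj2 (Nat.ltb_lt _ _)) by lia. reflexivity.
Qed.

(** Each new pole divides the previous identity by z - p_n: the regular part is split by [holo_div],
    and a product of two simple poles separates because the poles are distinct. The coefficients
    [al] are left unspecified; the residues of 1/J_q are identified afterwards by a local
    argument. *)
Lemma partial_fractions (W : C -> C) (R0 : R) (p : nat -> C) (n : nat) : holo W R0 ->
  (forall i, (i < n)%nat -> (Cmod (p i) < R0)%R) ->
  (forall i j, (i < j < n)%nat -> p i <> p j) ->
  exists al K, holo K R0 /\ forall z, (Cmod z < R0)%R -> (forall i, (i < n)%nat -> z <> p i) ->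
    W z / cprod (fun i => z - p i) n = csum (fun i => al i / (z - p i)) n + K z.
Proof.
  intros HW Hp Hd. induction n.
  - exists (fun _ => RtoC 0), W. split; auto. intros z _ _. simpl. field.
  - destruct IHn as [al [K [HK H]]]; [intros; apply Hp; lia | intros; apply Hd; lia |].
    destruct (holo_div K R0 (p n) HK (Hp n ltac:(lia))) as [K2 [HK2 H2]].
    exists (fun i => if Nat.eq_dec i n then K (p n) - csum (fun i => al i / (p i - p n)) n
                     else al i / (p i - p n)), K2.
    split; auto. intros z Hz Hzp. simpl.
    assert (N : z - p n <> 0) by (apply Cminus_neq_0; apply Hzp; lia).
    assert (NP : cprod (fun i => z - p i) n <> 0).
    { apply cprod_neq_0. intros i Hi. apply Cminus_neq_0, Hzp. lia. }
    replace (W z / (cprod (fun i => z - p i) n * (z - p n)))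
      with (W z / cprod (fun i => z - p i) n * / (z - p n)) by (field; auto).
    rewrite H by (auto; intros; apply Hzp; lia). rewrite (H2 z Hz).
    destruct (Nat.eq_dec n n) as [_|]; [|lia].
    rewrite (csum_ext (fun i => (if Nat.eq_dec i n then _ else al i / (p i - p n)) / (z - p i))
      (fun i => / (z - p n) * (al i / (z - p i)) + / (z - p n) * (al i / (p i - p n)))).
    + rewrite csum_plus, !csum_scal. field. auto.
    + intros i Hi. destruct (Nat.eq_dec i n); [lia|].
      assert (z - p i <> 0) by (apply Cminus_neq_0; apply Hzp; lia).
      assert (p i - p n <> 0) by (apply Cminus_neq_0; apply Hd; lia).
      field. auto.
Qed.

(** Dividing once more by z moves each [be j] one order up, and the values at 0 of the other terms
    form the new coefficient of 1/z. The alternative m = 0 keeps the point z = 0 available, as the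
    case q = 0 of the theorem demands. *)
Lemma partial_fractions_at_0 (W : C -> C) (R0 : R) (p : nat -> C) (n m : nat) : (0 < R0)%R -> holo W R0 ->
  (forall i, (i < n)%nat -> (Cmod (p i) < R0)%R) ->
  (forall i, (i < n)%nat -> p i <> 0) ->
  (forall i j, (i < j < n)%nat -> p i <> p j) ->
  exists al be K, holo K R0 /\ forall z, (Cmod z < R0)%R -> (forall i, (i < n)%nat -> z <> p i) ->
    (m = O \/ z <> 0) ->
    W z / (cprod (fun i => z - p i) n * z ^ m)
    = csum (fun i => al i / (z - p i)) n + csum (fun j => be j / z ^ S j) m + K z.
Proof.
  intros HR HW Hp Hp0 Hd. induction m.
  - destruct (partial_fractions W R0 p n HW Hp Hd) as [al [K [HK H]]].
    exists al, (fun _ => RtoC 0), K. split; auto. intros z Hz Hzp _. simpl.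
    rewrite Cmult_1_r, H by auto. ring.
  - destruct IHm as [al [be [K [HK H]]]].
    destruct (holo_div K R0 0 HK ltac:(rewrite Cmod_0; auto)) as [K2 [HK2 H2]].
    exists (fun i => al i / p i), 
      (fun j => match j with O => K 0 - csum (fun i => al i / p i) n | S k => be k end), K2.
    split; auto. intros z Hz Hzp [|Hz0]; [lia|].
    assert (NP : cprod (fun i => z - p i) n <> 0).
    { apply cprod_neq_0. intros i Hi. apply Cminus_neq_0, Hzp. lia. }
    pose proof (Cpow_nz z m Hz0) as Nm.
    replace (W z / (cprod (fun i => z - p i) n * z ^ S m))
      with (/ z * (W z / (cprod (fun i => z - p i) n * z ^ m))) by (simpl; field; auto).
    rewrite H by auto. rewrite (H2 z Hz).
    rewrite csum_shift.
    rewrite (csum_ext (fun i => be i / z ^ S (S i)) (fun i => / z * (be i / z ^ S i))).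
    2:{ intros i _. pose proof (Cpow_nz z i Hz0). simpl. field; auto. }
    rewrite csum_scal.
    rewrite (csum_ext (fun i => al i / p i / (z - p i)) (fun i => / z * (al i / (z - p i)) + / z * (al i / p i))).
    2:{ intros i Hi. assert (z - p i <> 0) by (apply Cminus_neq_0; apply Hzp; lia).
        pose proof (Hp0 i Hi). field. auto. }
    rewrite csum_plus, !csum_scal. simpl. field. auto.
Qed.

Lemma csum_cdv (f : nat -> C -> C) (n : nat) (z : C) :
  (forall i, (i < n)%nat -> exists l, cdv (f i) z l) -> exists l, cdv (fun w => csum (fun i => f i w) n) z l.
Proof.
  induction n; intros H; simpl.
  - eexists. apply cdv_const.
  - destruct IHn as [l Hl]; auto. destruct (H n) as [m Hm]; auto.
    eexists. apply (cdv_plus (fun w => csum (fun i => f i w) n)); eauto.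
Qed.

Lemma cprod_cdv (f : nat -> C -> C) (n : nat) (z : C) :
  (forall i, (i < n)%nat -> exists l, cdv (f i) z l) -> exists l, cdv (fun w => cprod (fun i => f i w) n) z l.
Proof.
  induction n; intros H; simpl.
  - eexists. apply cdv_const.
  - destruct IHn as [l Hl]; auto. destruct (H n) as [m Hm]; auto.
    eexists. apply (cdv_mult (fun w => cprod (fun i => f i w) n)); eauto.
Qed.

Lemma holo_factor (f : C -> C) (R0 : R) (p : nat -> C) (n : nat) : holo f R0 ->
  (forall i, (i < n)%nat -> (Cmod (p i) < R0)%R) ->
  (forall i, (i < n)%nat -> f (p i) = 0) ->
  (forall i j, (i < j < n)%nat -> p i <> p j) ->
  exists U, holo U R0 /\ forall z, (Cmod z < R0)%R -> f z = cprod (fun i => z - p i) n * U z.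
Proof.
  intros Hf Hp H0 Hd. induction n.
  - exists f. split; auto. intros; simpl; ring.
  - destruct IHn as [U [HU H]]; [intros; apply Hp; lia | intros; apply H0; lia | intros; apply Hd; lia |].
    destruct (holo_div U R0 (p n) HU (Hp n ltac:(lia))) as [U2 [HU2 H2]].
    exists U2. split; auto. intros z Hz. simpl. rewrite (H z Hz), (H2 z Hz).
    assert (E : U (p n) = 0).
    { assert (NP : cprod (fun i => p n - p i) n <> 0).
      { apply cprod_neq_0. intros i Hi. apply Cminus_neq_0. apply not_eq_sym. apply Hd. lia. }
      pose proof (H (p n) (Hp n ltac:(lia))) as E. rewrite H0 in E by lia.
      replace (U (p n)) with (cprod (fun i => p n - p i) n * U (p n) / cprod (fun i => p n - p i) n) by (field; auto).
      rewrite <- E. field. auto. }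
    rewrite E. ring.
Qed.

(** * Bessel functions *)

Lemma cser_conj (a : nat -> C) (l : C) : cser a l -> cser (fun n => Cconj (a n)) (Cconj l).
Proof.
  intros H. 
  assert (E : forall n, csum_n (fun n => Cconj (a n)) n = Cconj (csum_n a n)).
  { induction n. rewrite !sum_O. reflexivity. rewrite !sum_Sn, IHn.
    symmetry. apply Cplus_conj. }
  apply filterlim_locally. intros e.
  destruct (proj1 (filterlim_locally _ _) H (mkposreal (e / 2) ltac:(pose proof (cond_pos e); lra))) as [N HN].
  exists N. intros n Hn. apply ball_of_Cmod.
  change (sum_n (fun n0 : nat => Cconj (a n0)) n) with (csum_n (fun n => Cconj (a n)) n).
  rewrite E, <- Cminus_conj, Cmod_conj.
  apply Cmod_of_ball. apply cond_pos. exact (HN n Hn).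
Qed.

Definition ecoef (n m : nat) : R := ((-1) ^ m / (INR (fact m) * INR (fact (m + n))))%R.

(* [J_n(z) = (z/2)^n E_n((z/2)^2)]. *)
Definition bE (n : nat) (s : C) : C := psum (fun m => RtoC (ecoef n m)) s.

Lemma INR_fact_ge_1 (n : nat) : (1 <= INR (fact n))%R.
Proof. apply (le_INR 1). apply lt_O_fact. Qed.

Lemma Rabs_ecoef_le (n m : nat) : (Rabs (ecoef n m) <= / INR (fact m))%R.
Proof.
  pose proof (INR_fact_ge_1 m). pose proof (INR_fact_ge_1 (m + n)).
  unfold ecoef, Rdiv. rewrite Rabs_mult, pow_1_abs, Rmult_1_l.
  rewrite Rabs_pos_eq.
  - apply Rinv_le_contravar; nra.
  - left. apply Rinv_0_lt_compat. nra.
Qed.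

Lemma rad_ecoef (n : nat) (R0 : R) : rad (fun m => RtoC (ecoef n m)) R0.
Proof.
  intros r Hr. exists (exp r). intros m. rewrite Cmod_R.
  apply Rle_trans with (r ^ m / INR (fact m))%R.
  - unfold Rdiv. rewrite Rmult_comm. apply Rmult_le_compat_l. apply pow_le; lra. apply Rabs_ecoef_le.
  - apply Rle_trans with (sum_f_R0 (fun k => r ^ k / INR (fact k))%R m); [|apply exp_ge_taylor; lra].
    destruct m; [simpl; lra|]. rewrite tech5.
    assert (0 <= sum_f_R0 (fun k => r ^ k / INR (fact k))%R m)%R.
    { apply cond_pos_sum. intros k. apply Rdiv_le_0_compat. apply pow_le; lra.
      pose proof (INR_fact_ge_1 k); lra. }
    lra.
Qed.

Lemma bE_series (n : nat) (s : C) : cser (fun m => RtoC (ecoef n m) * s ^ m) (bE n s).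
Proof. apply psum_correct with (Cmod s + 1)%R. apply rad_ecoef. lra. Qed.

Lemma bE_cdv (n : nat) (s : C) : cdv (bE n) s (- bE (S n) s).
Proof.
  apply cdv_val with (psum (pder (fun m => RtoC (ecoef n m))) s).
  - apply cser_value. replace (- bE (S n) s) with (- (1) * bE (S n) s) by ring.
    apply cser_ext with (fun m => - (1) * (RtoC (ecoef (S n) m) * s ^ m)).
    + intros m. unfold pder.
      replace (RtoC (INR (S m)) * RtoC (ecoef n (S m))) with (- (1) * RtoC (ecoef (S n) m)); [ring|].
      rewrite <- RtoC_opp, <- !RtoC_mult. f_equal. unfold ecoef.
      replace (m + S n)%nat with (S m + n)%nat by lia. rewrite fact_simpl, mult_INR.
      pose proof (INR_fact_ge_1 m). pose proof (INR_fact_ge_1 (S m + n)).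
      assert (INR (S m) <> 0)%R by (apply not_0_INR; lia).
      simpl pow. field. repeat split; auto; lra.
    + apply cser_scal, bE_series.
  - apply psum_cdv with (Cmod s + 1)%R. apply rad_ecoef. lra.
Qed.

(** For s = (z/2)^2 this is the recurrence J_n + J_(n+2) = (2 (n+1)/z) J_(n+1), freed of its
    denominators and so valid at 0. *)
Lemma bE_rec (n : nat) (s : C) :
  bE n s = RtoC (INR (S n)) * bE (S n) s - s * bE (S (S n)) s.
Proof.
  apply cser_value.
  assert (S2 : cser (fun m => match m with O => RtoC 0 | S k => RtoC (ecoef (S (S n)) k) * s ^ S k end) (s * bE (S (S n)) s)).
  { replace (s * bE (S (S n)) s) with (0 + s * bE (S (S n)) s) by ring.
    apply (cser_cons (fun m => match m with O => RtoC 0 | S k => RtoC (ecoef (S (S n)) k) * s ^ S k end)).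
    apply cser_ext with (fun m => s * (RtoC (ecoef (S (S n)) m) * s ^ m)). intros; simpl; ring.
    apply cser_scal, bE_series. }
  replace (RtoC (INR (S n)) * bE (S n) s - s * bE (S (S n)) s)
    with (RtoC (INR (S n)) * bE (S n) s + - (1) * (s * bE (S (S n)) s)) by ring.
  eapply cser_ext; [|apply (cser_plus _ _ _ _ (cser_scal (RtoC (INR (S n))) _ _ (bE_series (S n) s)) (cser_scal (- (1)) _ _ S2))].
  intros [|m]; cbv beta iota.
  - rewrite Cmult_assoc, <- RtoC_mult. unfold ecoef.
    replace (0 + S n)%nat with (S n) by lia. rewrite fact_simpl, mult_INR.
    pose proof (INR_fact_ge_1 n). assert (INR (S n) <> 0)%R by (apply not_0_INR; lia).
    replace (INR (S n) * ((-1) ^ 0 / (INR (fact 0) * (INR (S n) * INR (fact n)))))%R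
      with ((-1) ^ 0 / (INR (fact 0) * INR (fact (0 + n))))%R.
    ring. simpl (0 + n)%nat. pose proof (INR_fact_ge_1 0). field. repeat split; lra.
  - replace (RtoC (ecoef n (S m))) with (RtoC (INR (S n)) * RtoC (ecoef (S n) (S m)) - RtoC (ecoef (S (S n)) m)).
    ring. rewrite <- RtoC_mult, <- RtoC_minus. f_equal. unfold ecoef.
    replace (m + S (S n))%nat with (S (S m + n))%nat by lia.
    replace (S m + S n)%nat with (S (S m + n))%nat by lia.
    rewrite !(fact_simpl (S m + n)), (fact_simpl m), !mult_INR.
    pose proof (INR_fact_ge_1 m). pose proof (INR_fact_ge_1 (S m + n)).
    assert (INR (S m) <> 0)%R by (apply not_0_INR; lia).
    assert (E : INR (S (S m + n)) = (INR (S m) + INR (S n))%R).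
    { rewrite <- plus_INR. f_equal. lia. }
    assert (INR (S m) + INR (S n) <> 0)%R by (rewrite <- E; apply not_0_INR; lia).
    rewrite E. simpl pow. field. repeat split; auto; lra.
Qed.

Lemma bE_0 (n : nat) : bE n 0 = RtoC (/ INR (fact n)).
Proof.
  unfold bE. rewrite psum_0. unfold ecoef. f_equal. simpl. field.
  pose proof (INR_fact_ge_1 n). lra.
Qed.

Lemma bE_0_neq (n : nat) : bE n 0 <> 0.
Proof.
  rewrite bE_0. pose proof (INR_fact_ge_1 n).
  assert (0 < / INR (fact n))%R by (apply Rinv_0_lt_compat; lra).
  apply Cmod_pos_neq. rewrite Cmod_R, Rabs_pos_eq; lra.
Qed.

Lemma bE_conj (n : nat) (s : C) : bE n (Cconj s) = Cconj (bE n s).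
Proof.
  apply cser_value. eapply cser_ext; [|apply (cser_conj _ _ (bE_series n s))].
  intros m. cbv beta. rewrite Cmult_conj, Cpow_conj. f_equal.
  unfold Cconj, RtoC. simpl. f_equal. ring.
Qed.

Notation bJ := besselJ_nat.

Lemma bJ_bE (n : nat) (z : C) : bJ n z = (z / 2) ^ n * bE n (z / 2 * (z / 2)).
Proof.
  apply cser_value. eapply cser_ext; [|apply (cser_scal ((z / 2) ^ n) _ _ (bE_series n (z / 2 * (z / 2))))].
  intros m. cbv beta. fold (ecoef n m). rewrite Cpow_add_r, Cpow_mult_r.
  replace ((z / 2) ^ 2) with (z / 2 * (z / 2)) by (simpl; ring). ring.
Qed.

(** The derivative n J_n / z - J_(n+1), with the first term written as (n/2) (z/2)^(n-1) E_n so that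
    it also makes sense at z = 0. *)
Definition bJ' (n : nat) (z : C) : C :=
  match n with O => 0 | S k => RtoC (INR n) / 2 * (z / 2) ^ k * bE n (z / 2 * (z / 2)) end - bJ (S n) z.

Lemma C2_neq_0 : RtoC 2 <> 0.
Proof. apply Cmod_pos_neq. rewrite Cmod_R, Rabs_pos_eq; lra. Qed.

Lemma cdv_half (z : C) : cdv (fun w => w / 2) z (/ 2).
Proof.
  apply cdv_ext with (fun w => / 2 * w). intros; unfold Cdiv; ring.
  apply cdv_val with (/ 2 * 1). ring. apply cdv_scal, cdv_id.
Qed.

Lemma cdv_half_pow (n : nat) (z : C) : exists l, cdv (fun w => (w / 2) ^ n) z l.
Proof.
  destruct n as [|n].
  - exists 0. exact (cdv_const 1 z).
  - eexists. exact (cdv_comp (fun w => w ^ S n) (fun w => w / 2) z _ _ (cdv_pow n _) (cdv_half z)).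
Qed.

Lemma cdv_half_sq (z : C) : cdv (fun w => w / 2 * (w / 2)) z (z / 2).
Proof.
  pose proof (cdv_half z) as H.
  apply cdv_val with (/ 2 * (z / 2) + z / 2 * / 2). field.
  apply (cdv_mult (fun w => w / 2) (fun w => w / 2)); auto.
Qed.

Lemma bJ_cdv (n : nat) (z : C) : cdv (bJ n) z (bJ' n z).
Proof.
  apply cdv_ext with (fun w => (w / 2) ^ n * bE n (w / 2 * (w / 2))).
  { intros; symmetry; apply bJ_bE. }
  assert (H1 : cdv (fun w => bE n (w / 2 * (w / 2))) z (z / 2 * - bE (S n) (z / 2 * (z / 2)))).
  { apply (cdv_comp (bE n)). apply bE_cdv. apply cdv_half_sq. }
  pose proof (cdv_half z) as H.
  unfold bJ'. rewrite bJ_bE. destruct n as [|n].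
  - eapply cdv_val; [|apply (cdv_mult (fun w => (w / 2) ^ 0) _ _ 0 _ (cdv_const 1 z) H1)]. simpl; ring.
  - eapply cdv_val; [|apply (cdv_mult (fun w => (w / 2) ^ S n) _ _ _ _
      (cdv_comp (fun w => w ^ S n) (fun w => w / 2) z _ _ (cdv_pow n _) H) H1)].
    simpl pow. unfold Cdiv. rewrite !Cpow_S. ring.
Qed.

Lemma bJ'_rec (n : nat) (z : C) : z <> 0 -> bJ' n z = RtoC (INR n) / z * bJ n z - bJ (S n) z.
Proof.
  intros Hz. unfold bJ'. f_equal. rewrite bJ_bE. destruct n as [|n].
  - simpl. unfold Cdiv. ring.
  - rewrite Cpow_S. field. auto.
Qed.

Lemma bJ'_half (n : nat) (z : C) : RtoC 2 * bJ' (S n) z = bJ n z - bJ (S (S n)) z.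
Proof.
  unfold bJ'. rewrite !bJ_bE, (bE_rec n), !Cpow_S.
  set (s := z / 2). 
  replace (RtoC (INR (S n)) / 2 * s ^ n * bE (S n) (s * s)) with
    (/ 2 * (RtoC (INR (S n)) * s ^ n * bE (S n) (s * s))) by (unfold Cdiv; ring).
  set (x := RtoC (INR (S n)) * s ^ n * bE (S n) (s * s)).
  replace (s ^ n * (RtoC (INR (S n)) * bE (S n) (s * s) - s * s * bE (S (S n)) (s * s)))
    with (x - s ^ n * s * s * bE (S (S n)) (s * s)) by (unfold x; ring).
  field.
Qed.

Lemma bJ'_succ (n : nat) (z : C) : z <> 0 -> bJ' (S n) z = bJ n z - RtoC (INR (S n)) / z * bJ (S n) z.
Proof.
  intros Hz. pose proof (bJ'_half n z) as H1. pose proof (bJ'_rec (S n) z Hz) as H2.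
  replace (bJ' (S n) z) with (RtoC 2 * bJ' (S n) z - bJ' (S n) z) by ring.
  rewrite H1, H2. ring.
Qed.

Lemma besselJ_of_nat (q : nat) (z : C) : besselJ (Z.of_nat q) z = bJ q z.
Proof. unfold besselJ. rewrite (proj2 (Z.leb_le _ _)) by lia. rewrite Nat2Z.id. reflexivity. Qed.

(** For q = 0 the convention J_(-1) = -J_1 makes the left side -2 J_1, which is twice the derivative
    of J_0. *)
Lemma besselJ_diff (q : nat) (z : C) :
  besselJ (Z.of_nat q - 1) z - besselJ (Z.of_nat q + 1) z = RtoC 2 * bJ' q z.
Proof.
  replace (Z.of_nat q + 1)%Z with (Z.of_nat (S q)) by lia. rewrite besselJ_of_nat.
  destruct q as [|q].
  - unfold besselJ. simpl. change (Z.abs_nat (-1)) with 1%nat. change (Pos.to_nat 1) with 1%nat. 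
    unfold bJ'. replace (-1 * 1)%R with (- (1))%R by ring. rewrite RtoC_opp. ring.
  - replace (Z.of_nat (S q) - 1)%Z with (Z.of_nat q) by lia. rewrite besselJ_of_nat, bJ'_half. reflexivity.
Qed.

Lemma bJ_opp (n : nat) (z : C) : Cmod (bJ n (- z)) = Cmod (bJ n z).
Proof.
  rewrite !bJ_bE, !Cmod_mult, !Cmod_pow. f_equal.
  - f_equal. replace (- z / 2) with (- (z / 2)) by (unfold Cdiv; ring). apply Cmod_opp.
  - do 2 f_equal. unfold Cdiv. ring.
Qed.

Lemma bJ_conj (n : nat) (z : C) : bJ n (Cconj z) = Cconj (bJ n z).
Proof.
  assert (E : Cconj z / 2 = Cconj (z / 2)).
  { rewrite Cdiv_conj by apply C2_neq_0. f_equal. unfold Cconj, RtoC; simpl; f_equal; ring. }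
  rewrite !bJ_bE, E, Cmult_conj, Cpow_conj, <- Cmult_conj, bE_conj. reflexivity.
Qed.

(** J_n on the real line as a real function; by conjugation symmetry the discarded imaginary part is
    0. *)
Definition rJ (n : nat) (x : R) : R := Re (bJ n (RtoC x)).

Lemma bJ_real (n : nat) (x : R) : bJ n (RtoC x) = RtoC (rJ n x).
Proof.
  pose proof (bJ_conj n (RtoC x)) as H.
  replace (Cconj (RtoC x)) with (RtoC x) in H by (unfold Cconj, RtoC; simpl; f_equal; ring).
  apply (f_equal Im) in H. rewrite im_conj in H. unfold rJ.
  apply injective_projections; [reflexivity|]. change (Im (bJ n x) = 0%R). lra.
Qed.

Lemma bE_half_holo (n : nat) (R0 : R) : (0 <= R0)%R -> holo (fun z => bE n (z / 2 * (z / 2))) R0.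
Proof.
  intros HR.
  assert (Hr : forall R1, rad (fun m => RtoC (ecoef n m) * (/ 4) ^ m) R1).
  { intros R1 r Hr. destruct (rad_ecoef n R1 r Hr) as [M HM]. exists M. intros m.
    eapply Rle_trans; [|apply (HM m)]. rewrite Cmod_mult, Cmod_pow.
    apply Rmult_le_compat_r. apply pow_le; lra.
    assert (E4 : Cmod (/ 4) = (/ 4)%R).
    { assert (Cmod 4 = 4%R) by (rewrite Cmod_R; apply Rabs_pos_eq; lra).
      rewrite Cmod_inv by (apply Cmod_pos_neq; lra). congruence. }
    rewrite E4. apply Rle_trans with (Cmod (RtoC (ecoef n m)) * 1)%R; [|lra].
    apply Rmult_le_compat_l. apply Cmod_ge_0.
    apply Rle_trans with (1 ^ m)%R; [apply pow_incr; lra | rewrite pow1; lra]. }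
  apply holo_ext with (fun z => psum (fun m => RtoC (ecoef n m) * (/ 4) ^ m) (z * z)).
  2: apply holo_square; auto.
  intros z Hz. apply cser_value. eapply cser_ext; [|apply bE_series].
  intros m. cbv beta. replace (z / 2 * (z / 2)) with (/ 4 * (z * z)) by field.
  rewrite Cpow_mult_l. ring.
Qed.

(** * Zeros of Bessel functions *)

Lemma bJ_cder (n : nat) (g : R -> C) (t : R) (l : C) : cder g t l -> cder (fun s => bJ n (g s)) t (l * bJ' n (g t)).
Proof. intros H. apply (cder_comp (bJ n)); auto. apply bJ_cdv. Qed.

Lemma RtoC_neq (x y : R) : x <> y -> RtoC x <> RtoC y.
Proof. intros H E. apply H. exact (f_equal Re E). Qed.

Lemma rJ_derive (n : nat) (x : R) : (x <> 0)%R ->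
  is_derive (rJ n) x (INR n / x * rJ n x - rJ (S n) x)%R.
Proof.
  intros Hx. pose proof (bJ_cder n _ x _ (cder_RtoC_id x)) as [H _].
  rewrite Cmult_1_l, bJ'_rec in H by (apply RtoC_neq; auto).
  rewrite !bJ_real, <- RtoC_div, <- RtoC_mult, <- RtoC_minus in H by auto. exact H.
Qed.

Lemma rJ_derive_succ (n : nat) (x : R) : (x <> 0)%R ->
  is_derive (rJ (S n)) x (rJ n x - INR (S n) / x * rJ (S n) x)%R.
Proof.
  intros Hx. pose proof (bJ_cder (S n) _ x _ (cder_RtoC_id x)) as [H _].
  rewrite Cmult_1_l, bJ'_succ in H by (apply RtoC_neq; auto).
  rewrite !bJ_real, <- RtoC_div, <- RtoC_mult, <- RtoC_minus in H by auto. exact H.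
Qed.

Lemma bJ_near_0 (q : nat) : exists d, (0 < d)%R /\ forall z, (0 < Cmod z < d)%R -> bJ q z <> 0.
Proof.
  assert (Hc : ccont (fun z => bE q (z / 2 * (z / 2))) (RtoC 0)).
  { eapply cdv_cont. apply (cdv_comp (bE q)). apply bE_cdv. apply cdv_half_sq. }
  assert (E0 : RtoC 0 / 2 * (0 / 2) = 0) by field.
  assert (Hm : (0 < Cmod (bE q (RtoC 0 / 2 * (0 / 2))))%R).
  { apply Cmod_gt_0. rewrite E0. apply bE_0_neq. }
  destruct (proj1 (ccont_iff _ _) Hc _ Hm) as [d [Hd H]].
  exists d. split; auto. intros z Hz. rewrite bJ_bE. apply Cmult_neq_0.
  - apply Cpow_nz. apply Cmod_pos_neq. rewrite Cmod_div, Cmod_R, Rabs_pos_eq by (try apply C2_neq_0; lra). lra.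
  - intros E. specialize (H z). replace (z - RtoC 0) with z in H by ring. rewrite E in H.
    specialize (H (proj2 Hz)). rewrite Cmod_sub_comm in H.
    replace (bE q (RtoC 0 / 2 * (0 / 2)) - 0) with (bE q (RtoC 0 / 2 * (0 / 2))) in H by ring. lra.
Qed.

(* [sqrt x * rJ q x] solves u'' + (1 - kappa / x^2) u = 0, and its derivative is
   [sqrt x * rH q x]. *)
Definition rH (q : nat) (x : R) : R := ((INR q + / 2) / x * rJ q x - rJ (S q) x)%R.

Definition kappa (q : nat) : R := (INR q * INR q - / 4)%R.

(** u^2 + u'^2 for u = sqrt(x) J_q(x), with the common factor x taken out. *)
Definition energy (q : nat) (x : R) : R := (x * (rJ q x * rJ q x + rH q x * rH q x))%R.

Lemma rJ_derive_rH (q : nat) (x : R) : (x <> 0)%R ->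
  is_derive (rJ q) x (rH q x - rJ q x / (2 * x))%R.
Proof.
  intros Hx. replace (rH q x - rJ q x / (2 * x))%R with (INR q / x * rJ q x - rJ (S q) x)%R.
  apply rJ_derive; auto. unfold rH. field. auto.
Qed.

(** The second-order equation for u divided by sqrt(x); the term [rH q x / (2 * x)] comes from
    differentiating the factor sqrt(x) in u' = sqrt(x) [rH]. *)
Lemma rH_derive (q : nat) (x : R) : (x <> 0)%R ->
  is_derive (rH q) x (- (1 - kappa q / (x * x)) * rJ q x - rH q x / (2 * x))%R.
Proof.
  intros Hx. unfold rH at 1.
  assert (H1 : is_derive (fun x => (INR q + / 2) / x)%R x (- (INR q + / 2) / (x * x))%R).
  { auto_derive; auto. field; auto. }
  pose proof (is_derive_minus (V := R_NormedModule) _ _ _ _ _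
    (rder_mult _ _ _ _ _ H1 (rJ_derive q x Hx)) (rJ_derive_succ q x Hx)) as H.
  match type of H with is_derive _ _ ?l => replace (- (1 - kappa q / (x * x)) * rJ q x - rH q x / (2 * x))%R with l end.
  exact H.
  change (- (INR q + / 2) / (x * x) * rJ q x + (INR q + / 2) / x * (INR q / x * rJ q x - rJ (S q) x) - (rJ q x - INR (S q) / x * rJ (S q) x) = - (1 - kappa q / (x * x)) * rJ q x - rH q x / (2 * x))%R.
  unfold kappa, rH. rewrite S_INR. field. auto.
Qed.

Lemma energy_derive (q : nat) (x : R) : (x <> 0)%R ->
  is_derive (energy q) x (2 * kappa q * rJ q x * rH q x / x)%R.
Proof.
  intros Hx. unfold energy.
  pose proof (rJ_derive_rH q x Hx) as H1. pose proof (rH_derive q x Hx) as H2.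
  pose proof (rder_mult _ _ _ _ _ (is_derive_id (K := R_AbsRing) x)
     (is_derive_plus (V := R_NormedModule) _ _ _ _ _ (rder_mult _ _ _ _ _ H1 H1) (rder_mult _ _ _ _ _ H2 H2))) as H.
  match type of H with is_derive _ _ ?l => replace (2 * kappa q * rJ q x * rH q x / x)%R with l end.
  exact H.
  unfold plus, one; simpl. field. auto.
Qed.

Lemma energy_ge_0 (q : nat) (x : R) : (0 <= x)%R -> (0 <= energy q x)%R.
Proof. intros H. unfold energy. apply Rmult_le_pos; nra. Qed.

Lemma nondecreasing_of_derive (f df : R -> R) (a b : R) : (a <= b)%R ->
  (forall x, (a <= x <= b)%R -> is_derive f x (df x)) ->
  (forall x, (a <= x <= b)%R -> (0 <= df x)%R) -> (f a <= f b)%R.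
Proof.
  intros Hab H1 H2.
  destruct (MVT_gen f a b df) as [c [Hc E]]; rewrite ?Rmin_left, ?Rmax_right in * by auto.
  - intros x Hx. apply H1. lra.
  - intros x Hx. apply continuity_pt_filterlim. apply (ex_derive_continuous f). eexists; apply H1. lra.
  - specialize (H2 c Hc). nra.
Qed.

(** Since 2 |J H| <= J^2 + H^2, the energy satisfies E' >= -(k/x^2) E with k = |kappa|, so E
    exp(-k/x) is nondecreasing. The weight k/x^2 is integrable at infinity, hence the lower bound
    does not decay as y grows. *)
Lemma energy_lower (q : nat) (x y : R) : (0 < x <= y)%R ->
  (energy q x * exp (- Rabs (kappa q) / x) <= energy q y)%R.
Proof.
  intros H. set (k := Rabs (kappa q)).
  assert (Hk : (0 <= k)%R) by apply Rabs_pos.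
  apply Rle_trans with (energy q y * exp (- k / y))%R.
  - apply (nondecreasing_of_derive (fun x => energy q x * exp (- k / x))%R
      (fun x => (2 * kappa q * rJ q x * rH q x / x) * exp (- k / x) + energy q x * (k / (x * x) * exp (- k / x)))%R); [lra| |].
    + intros t Ht. apply (rder_mult (energy q) (fun x => exp (- k / x))%R).
      apply energy_derive; lra. auto_derive. lra. unfold Rdiv. field. lra.
    + intros t Ht. 
      replace (2 * kappa q * rJ q t * rH q t / t * exp (- k / t) + energy q t * (k / (t * t) * exp (- k / t)))%R
        with (exp (- k / t) * (/ t * (k * (rJ q t * rJ q t + rH q t * rH q t) + kappa q * (2 * rJ q t * rH q t))))%R
        by (unfold energy; field; lra).
      apply Rmult_le_pos. left; apply exp_pos. apply Rmult_le_pos. left; apply Rinv_0_lt_compat; lra.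
      set (a := rJ q t). set (b := rH q t).
      assert (Hkk : (- k <= kappa q <= k)%R) by (unfold k; split; [pose proof (Rle_abs (- kappa q)) as P; rewrite Rabs_Ropp in P; lra | apply Rle_abs]).
      assert (P1 : (0 <= (k + kappa q) * Rsqr (a + b))%R) by (apply Rmult_le_pos; [lra | apply Rle_0_sqr]).
      assert (P2 : (0 <= (k - kappa q) * Rsqr (a - b))%R) by (apply Rmult_le_pos; [lra | apply Rle_0_sqr]).
      unfold Rsqr in P1, P2. lra.
  - assert (Hi : (0 < / y)%R) by (apply Rinv_0_lt_compat; lra).
    assert (He : (exp (- k / y) <= exp 0)%R).
    { unfold Rdiv. destruct (Rle_lt_or_eq_dec 0 k Hk) as [Hk'|<-].
      - left. apply exp_increasing. nra.
      - rewrite Ropp_0, Rmult_0_l. lra. }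
    rewrite exp_0 in He. pose proof (energy_ge_0 q y ltac:(lra)). nra.
Qed.

(** J_q does not vanish near 0, so the energy is positive there, and [energy_lower] carries this to
    every y. It means that [rJ] and [rH] have no common positive zero: simplicity of the zeros,
    strictness in Rolle's theorem and unboundedness of the zeros all rest on it. *)
Lemma energy_pos (q : nat) (y : R) : (0 < y)%R -> (0 < energy q y)%R.
Proof.
  intros Hy. destruct (bJ_near_0 q) as [d [Hd H]].
  set (x := (Rmin d y / 2)%R).
  assert (Hx : (0 < x < d /\ x < y)%R).
  { pose proof (Rmin_pos _ _ Hd Hy). pose proof (Rmin_l d y). pose proof (Rmin_r d y). unfold x. lra. }
  eapply Rlt_le_trans; [|apply (energy_lower q x y); lra].
  apply Rmult_lt_0_compat; [|apply exp_pos]. unfold energy. apply Rmult_lt_0_compat; [lra|].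
  assert (N : rJ q x <> 0%R).
  { intros E. apply (H (RtoC x)). rewrite Cmod_R, Rabs_pos_eq; lra. rewrite bJ_real, E. reflexivity. }
  assert (0 < rJ q x * rJ q x)%R by nra. nra.
Qed.

Lemma bJ_simple_zero (q : nat) (x : R) : (0 < x)%R -> rJ q x = 0%R -> rJ (S q) x <> 0%R.
Proof.
  intros Hx H E. pose proof (energy_pos q x Hx) as P. unfold energy, rH in P. rewrite H, E in P. nra.
Qed.

(* Rolle, applied to [sqrt x * rJ q x]. *)
Lemma critical_point_between (q : nat) (x y : R) : (0 < x < y)%R -> rJ q x = 0%R -> rJ q y = 0%R ->
  exists r, (x < r < y)%R /\ rH q r = 0%R.
Proof.
  intros H Hx Hy.
  assert (D : forall t, (x <= t <= y)%R -> is_derive (fun t => sqrt t * rJ q t)%R t (sqrt t * rH q t)%R).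
  { intros t Ht. assert (0 < sqrt t)%R by (apply sqrt_lt_R0; lra).
    assert (E : (sqrt t * sqrt t = t)%R) by (apply sqrt_sqrt; lra).
    replace (sqrt t * rH q t)%R with (1 / (2 * sqrt t) * rJ q t + sqrt t * (rH q t - rJ q t / (2 * t)))%R.
    - apply rder_mult. apply (is_derive_sqrt (fun t => t)). apply (is_derive_id (K := R_AbsRing)). lra.
      apply rJ_derive_rH. lra.
    - replace (rJ q t / (2 * t))%R with (rJ q t / (2 * (sqrt t * sqrt t)))%R by (rewrite E; reflexivity).
      field. lra. }
  destruct (MVT_gen (fun t => sqrt t * rJ q t)%R x y (fun t => sqrt t * rH q t)%R) as [c [Hc E]];
    rewrite ?Rmin_left, ?Rmax_right in * by lra.
  - intros t Ht. apply D; lra.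
  - intros t Ht. apply continuity_pt_filterlim.
    apply (ex_derive_continuous (fun t => sqrt t * rJ q t)%R). eexists; apply D; lra.
  - rewrite Hx, Hy in E.
    assert (Hs : (0 < sqrt c)%R) by (apply sqrt_lt_R0; lra).
    assert (E2 : rH q c = 0%R).
    { assert (E3 : (sqrt c * rH q c * (y - x) = 0)%R) by lra.
      apply Rmult_integral in E3. destruct E3 as [E3|E3]; [|lra].
      apply Rmult_integral in E3. destruct E3; [lra|auto]. }
    exists c. split; auto.
    (* The mean value theorem places c in the closed interval. At an endpoint [rJ] would vanish
       together with [rH], against [energy_pos]. *)
    assert (N : rJ q c <> 0%R).
    { intros E3. pose proof (energy_pos q c ltac:(lra)) as P. unfold energy in P. rewrite E2, E3 in P. nra. }
    split; apply Rnot_le_lt; intros Hle; apply N.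
    replace c with x by lra. auto. replace c with y by lra. auto.
Qed.

Lemma cder_conj (g : R -> C) (t : R) (l : C) : cder g t l -> cder (fun s => Cconj (g s)) t (Cconj l).
Proof.
  intros [H1 H2]. split. exact H1. exact (is_derive_opp (V := R_NormedModule) _ _ _ H2).
Qed.

Lemma derive_zero_between_zeros (f df : R -> R) : (forall t, (0 <= t <= 1)%R -> is_derive f t (df t)) ->
  (forall t, (0 <= t <= 1)%R -> (0 <= df t)%R) -> f 0%R = 0%R -> f 1%R = 0%R ->
  forall t, (0 < t < 1)%R -> df t = 0%R.
Proof.
  intros H1 H2 H3 H4 t Ht.
  assert (Z : forall s, (0 <= s <= 1)%R -> f s = 0%R).
  { intros s Hs. apply Rle_antisym.
    - rewrite <- H4. apply nondecreasing_of_derive with df; intros; try apply H1; try apply H2; lra.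
    - rewrite <- H3. apply nondecreasing_of_derive with df; intros; try apply H1; try apply H2; lra. }
  rewrite <- (is_derive_unique f t (df t)) by (apply H1; lra).
  apply is_derive_unique. apply (is_derive_ext_loc (V := R_NormedModule) (fun _ => 0%R)).
  - assert (Hp : (0 < Rmin t (1 - t))%R) by (apply Rmin_pos; lra).
    exists (mkposreal _ Hp). intros s Hs. symmetry. apply Z.
    unfold ball in Hs; simpl in Hs. unfold AbsRing_ball, abs, minus, plus, opp in Hs; simpl in Hs.
    apply Rabs_def2 in Hs. pose proof (Rmin_l t (1 - t)). pose proof (Rmin_r t (1 - t)). lra.
  - apply (is_derive_const (V := R_NormedModule)).
Qed.

(* Lommel's argument: with f(t) = J_q(at) and h(t) = a J_{q+1}(at), the function
   Q = t h conj(f) has Q' = a^2 t |f|^2 - t |h|^2 and vanishes at 0 and 1. *)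
Lemma bJ_zeros_real (q : nat) (a : C) : a <> 0 -> bJ q a = 0 -> Im a = 0%R.
Proof.
  intros Ha H0. apply NNPP. intros Hi.
  set (f := fun t : R => bJ q (a * RtoC t)). set (h := fun t : R => a * bJ (S q) (a * RtoC t)).
  assert (Dw : forall t : R, cder (fun t => a * RtoC t) t a).
  { intros t. apply cder_val with (a * 1). ring. apply cder_scal, cder_RtoC_id. }
  assert (Df : forall t : R, cder f t (a * bJ' q (a * RtoC t))) 
    by (intros t; exact (bJ_cder q (fun t => a * RtoC t) t a (Dw t))).
  assert (Dh : forall t : R, cder h t (a * (a * bJ' (S q) (a * RtoC t)))).
  { intros t. exact (cder_scal a _ _ _ (bJ_cder (S q) (fun t => a * RtoC t) t a (Dw t))). }
  set (Q := fun t : R => RtoC t * (h t * Cconj (f t))).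
  set (dQ := fun t : R => a * a * RtoC (t * Cmod (f t) ^ 2) - RtoC (t * Cmod (h t) ^ 2)).
  assert (DQ : forall t, (0 <= t <= 1)%R -> cder Q t (dQ t)).
  { intros t _.
    pose proof (cder_mult _ _ _ _ _ (cder_RtoC_id t) (cder_mult _ _ _ _ _ (Dh t) (cder_conj _ _ _ (Df t)))) as D.
    eapply cder_val; [|exact D]. unfold dQ.
    destruct (Req_dec t 0) as [->|Ht].
    - unfold h, f. rewrite !Rmult_0_l, !Cmult_0_l.
      replace (a * RtoC 0) with (RtoC 0) by ring.
      rewrite (bJ_bE (S q) 0), Cpow_S. unfold Cdiv. ring.
    - assert (Hat : a * RtoC t <> 0) by (apply Cmult_neq_0; auto; apply RtoC_neq; auto).
      assert (Htc : RtoC t <> 0) by (apply RtoC_neq; auto).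
      rewrite !RtoC_mult, !Cmod2_conj.
      assert (E1 : a * bJ' q (a * RtoC t) = RtoC (INR q / t) * f t - h t).
      { rewrite bJ'_rec by auto. unfold f, h. rewrite RtoC_div by auto. field. auto. }
      assert (E2 : a * (a * bJ' (S q) (a * RtoC t)) = a * a * f t - RtoC (INR (S q) / t) * h t).
      { rewrite bJ'_succ by auto. unfold f, h. rewrite RtoC_div by auto. field. auto. }
      rewrite E1, E2, Cminus_conj, Cmult_conj.
      replace (Cconj (RtoC (INR q / t))) with (RtoC (INR q / t)) by (unfold Cconj, RtoC; simpl; f_equal; ring).
      rewrite !RtoC_div, (S_INR q), RtoC_plus by auto. field. auto. }
  assert (Q0 : Q 0%R = 0) by (unfold Q; ring).
  assert (Q1 : Q 1%R = 0).
  { unfold Q, f. replace (a * RtoC 1) with a by ring. rewrite H0.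
    replace (Cconj 0) with (RtoC 0) by (unfold Cconj, RtoC; simpl; f_equal; ring). ring. }
  assert (ReD : forall t, Re (dQ t) = (Re (a * a) * (t * Cmod (f t) ^ 2) - t * Cmod (h t) ^ 2)%R).
  { intros t. unfold dQ. simpl. ring. }
  assert (ImD : forall t, Im (dQ t) = (Im (a * a) * (t * Cmod (f t) ^ 2))%R).
  { intros t. unfold dQ. simpl. ring. }
  assert (F0 : forall t, (0 < t < 1)%R -> f t = 0).
  { assert (Hsq : forall t, (0 < t)%R -> (t * Cmod (f t) ^ 2 = 0)%R -> f t = 0).
    { intros t Ht E. apply Cmod_eq_0. apply Rmult_integral in E. destruct E; [lra|].
      simpl in H. nra. }
    (* If a^2 is not real, the imaginary part of Q' is a fixed nonzero multiple of t |f|^2. If a^2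
       is real while a is not, then a is purely imaginary, a^2 < 0, and both terms of Re Q' are
       nonpositive. Either way a monotone function vanishes at 0 and 1, which forces f = 0. *)
    destruct (Req_dec (Im (a * a)) 0) as [Hz|Hz].
    - assert (Hneg : (Re (a * a) < 0)%R).
      { simpl in *. unfold Im in Hi. assert (fst a = 0)%R by nra. nra. }
      intros t Ht.
      pose proof (derive_zero_between_zeros (fun t => - Re (Q t))%R (fun t => - Re (dQ t))%R) as K.
      assert (E : (- Re (dQ t) = 0)%R).
      { apply K; auto.
        - intros s Hs. exact (is_derive_opp (V := R_NormedModule) _ _ _ (proj1 (DQ s Hs))).
        - intros s Hs. rewrite ReD. pose proof (pow2_ge_0 (Cmod (f s))). pose proof (pow2_ge_0 (Cmod (h s))).
          assert (0 <= s * Cmod (f s) ^ 2)%R by nra. assert (0 <= s * Cmod (h s) ^ 2)%R by nra. nra.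
        - rewrite Q0. simpl; ring.
        - rewrite Q1. simpl; ring. }
      rewrite ReD in E. apply Hsq; [lra|].
      pose proof (pow2_ge_0 (Cmod (f t))). pose proof (pow2_ge_0 (Cmod (h t))).
      assert (0 <= t * Cmod (f t) ^ 2)%R by nra. assert (0 <= t * Cmod (h t) ^ 2)%R by nra. nra.
    - intros t Ht.
      pose proof (derive_zero_between_zeros (fun t => Im (a * a) * Im (Q t))%R (fun t => Im (a * a) * Im (dQ t))%R) as K.
      assert (E : (Im (a * a) * Im (dQ t) = 0)%R).
      { apply K; auto.
        - intros s Hs. exact (is_derive_scal _ _ _ _ (proj2 (DQ s Hs))).
        - intros s Hs. rewrite ImD. pose proof (pow2_ge_0 (Cmod (f s))).
          assert (0 <= s * Cmod (f s) ^ 2)%R by nra. nra.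
        - rewrite Q0. simpl; ring.
        - rewrite Q1. simpl; ring. }
      rewrite ImD in E. apply Hsq; [lra|].
      apply Rmult_integral in E. destruct E as [E|E]; [contradiction|].
      apply Rmult_integral in E. destruct E as [E|E]; [contradiction|]. auto. }
  (* f vanishes on all of (0,1), so J_q vanishes at points a t arbitrarily close to 0, where it has
     no zeros other than possibly 0 itself. *)
  destruct (bJ_near_0 q) as [d [Hd Hn]].
  assert (Hma : (0 < Cmod a)%R) by (apply Cmod_gt_0; auto).
  set (t := (Rmin 1 (d / Cmod a) / 2)%R).
  assert (Hda : (0 < d / Cmod a)%R) by (apply Rdiv_lt_0_compat; auto).
  pose proof (Rmin_pos _ _ Rlt_0_1 Hda). pose proof (Rmin_l 1 (d / Cmod a)). pose proof (Rmin_r 1 (d / Cmod a)).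
  assert (Ht : (0 < t < 1 /\ t < d / Cmod a)%R) by (unfold t; lra).
  apply (Hn (a * RtoC t)); [|apply (F0 t); lra].
  rewrite Cmod_mult, Cmod_R, Rabs_pos_eq by lra. split. nra.
  destruct Ht as [_ Ht]. apply (Rmult_lt_compat_l (Cmod a)) in Ht; auto.
  replace (Cmod a * (d / Cmod a))%R with d in Ht by (field; lra). exact Ht.
Qed.

(** * Lower bounds on circles *)

Definition cexp (z : C) : C := RtoC (exp (Re z)) * cis (Im z).

Lemma Cmod_cexp (z : C) : Cmod (cexp z) = exp (Re z).
Proof.
  unfold cexp. rewrite Cmod_mult, Cmod_cis, Cmod_R, Rabs_pos_eq. ring. left; apply exp_pos.
Qed.

Lemma cis_plus (a b : R) : cis (a + b) = cis a * cis b.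
Proof.
  unfold cis, Cmult. simpl. rewrite cos_plus, sin_plus. f_equal; ring.
Qed.

Lemma cexp_plus (a b : C) : cexp (a + b) = cexp a * cexp b.
Proof.
  unfold cexp. change (Re (a + b)) with (Re a + Re b)%R. change (Im (a + b)) with (Im a + Im b)%R.
  rewrite exp_plus, cis_plus, RtoC_mult. ring.
Qed.

Lemma cexp_0 : cexp 0 = 1.
Proof. unfold cexp, cis. simpl. rewrite exp_0, cos_0, sin_0. unfold Cmult, RtoC; simpl. f_equal; ring. Qed.

Lemma cder_cexp (g : R -> C) (t : R) (l : C) : cder g t l -> cder (fun s => cexp (g s)) t (l * cexp (g t)).
Proof.
  intros [H1 H2].
  assert (D1 : cder (fun s => RtoC (exp (Re (g s)))) t (RtoC (Re l * exp (Re (g t))))).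
  { apply cder_RtoC. exact (is_derive_comp (V := R_NormedModule) exp _ _ _ _ (is_derive_exp _) H1). }
  assert (D2 : cder (fun s => cis (Im (g s))) t (RtoC (Im l) * (Ci * cis (Im (g t))))).
  { exact (cder_comp_real cis _ t _ _ (cder_cis _) H2). }
  eapply cder_val; [|apply (cder_mult _ _ _ _ _ D1 D2)].
  unfold cexp. rewrite RtoC_mult.
  replace l with (RtoC (Re l) + RtoC (Im l) * Ci) at 3
    by (destruct l; unfold Cplus, Cmult, Ci, RtoC, Re, Im; simpl; f_equal; ring).
  ring.
Qed.

Lemma cder_bound (G g : R -> C) (a b m : R) : (a <= b)%R ->
  (forall t, (a <= t <= b)%R -> cder G t (g t)) ->
  (forall t, (a <= t <= b)%R -> (Cmod (g t) <= m)%R) ->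
  (Cmod (G b - G a) <= 2 * m * (b - a))%R.
Proof.
  intros Hab H1 H2. eapply Rle_trans. apply Cmod_le_Re_Im.
  assert (K : forall f df : R -> R, (forall t, (a <= t <= b)%R -> is_derive f t (df t)) ->
     (forall t, (a <= t <= b)%R -> (Rabs (df t) <= m)%R) -> (Rabs (f b - f a) <= m * (b - a))%R).
  { intros f df K1 K2.
    destruct (MVT_gen f a b df) as [c [Hc E]]; rewrite ?Rmin_left, ?Rmax_right in * by auto.
    - intros x Hx. apply K1. lra.
    - intros x Hx. apply continuity_pt_filterlim. apply (ex_derive_continuous f). eexists; apply K1. lra.
    - rewrite E, Rabs_mult, (Rabs_pos_eq (b - a)) by lra. apply Rmult_le_compat_r. lra. auto. }
  pose proof (K (fun t => Re (G t)) (fun t => Re (g t)) (fun t Ht => proj1 (H1 t Ht))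
    (fun t Ht => Rle_trans _ _ _ (re_le_Cmod _) (H2 t Ht))) as B1.
  pose proof (K (fun t => Im (G t)) (fun t => Im (g t)) (fun t Ht => proj2 (H1 t Ht))
    (fun t Ht => Rle_trans _ _ _ (Im_le_Cmod _) (H2 t Ht))) as B2.
  change (Re (G b - G a)) with (Re (G b) - Re (G a))%R.
  change (Im (G b - G a)) with (Im (G b) - Im (G a))%R. lra.
Qed.

(** The sum is 2 cosh(y + i x). Its zeros lie on the imaginary axis y = 0, with x an odd multiple of
    pi/2, and the condition x <= y keeps away from them. *)
Lemma cosh_sinh_lower (x y : R) : (0 <= x <= y)%R ->
  (exp y / 2 <= Cmod (cexp (- y, - x)%R + cexp (y, x)%R))%R.
Proof.
  intros H. unfold cexp. simpl (Re _). simpl (Im _).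
  assert (P1 : (0 < exp y)%R) by apply exp_pos. assert (P2 : (0 < exp (- y))%R) by apply exp_pos.
  (* For y <= 1/2 one has x <= 1/2 < pi/3, so the real part 2 cosh y cos x is large enough. For y >
     1/2, e^(2y) >= 1 + 2y > 2, so one exponential dominates the other. *)
  destruct (Rle_lt_dec y (/ 2)) as [Hy|Hy].
  - eapply Rle_trans; [|apply re_le_Cmod]. unfold cis.
    replace (Re _) with ((exp y + exp (- y)) * cos x)%R by (simpl; rewrite cos_neg; ring).
    assert (/ 2 <= cos x)%R.
    { replace (/ 2)%R with (cos (PI / 3)) by (rewrite cos_PI3; lra).
      pose proof PI2_3_2. pose proof PI_RGT_0. apply cos_decr_1; lra. }
    rewrite Rabs_pos_eq; nra.
  - assert (E : (2 * exp (- y) <= exp y)%R).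
    { assert (exp y = exp (- y) * exp (2 * y))%R by (rewrite <- exp_plus; f_equal; ring).
      assert (1 + 2 * y < exp (2 * y))%R by (apply exp_ineq1; lra). nra. }
    eapply Rle_trans; [|rewrite Cplus_comm; 
      replace (RtoC (exp y) * cis x + RtoC (exp (- y)) * cis (- x)) with
       (RtoC (exp y) * cis x - - (RtoC (exp (- y)) * cis (- x))) by ring; apply Cmod_sub_ge].
    rewrite Cmod_opp, !Cmod_mult, !Cmod_cis, !Cmod_R, !Rabs_pos_eq by lra. lra.
Qed.

(** Variation of constants along the arc. With kappa = 0 the solution starting from u' = 0 would be
    exactly [rJ q r] times cos(w - r); the term kappa/w^2 perturbs it by a relative error
    O(|kappa|/r), which the condition r >= 64 |kappa| makes harmless. *)
Lemma arc_lower_bound (q : nat) (r : R) : (0 < r)%R -> (64 * Rabs (kappa q) <= r)%R -> rH q r = 0%R ->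
  forall th, (0 <= th <= PI / 2)%R ->
  (Rabs (rJ q r) * exp (r * sin th) / 8 <= Cmod (bJ q (circ r th)))%R.
Proof.
  intros Hr Hk Hcrit. set (k := Rabs (kappa q)) in *.
  assert (Hk0 : (0 <= k)%R) by apply Rabs_pos.
  pose proof PI_RGT_0 as Hpi. pose proof PI_4 as Hpi4.
  set (w := circ r).
  assert (Nw : forall t, w t <> 0) by (intros; apply circ_neq_0; auto).
  (* [hc] is e^(it/2), that is, sqrt(w/r) followed continuously along the arc. So [u] is sqrt(w)
     J_q(w) and [g] its derivative in w, both divided by sqrt(r), without a branch of the complex
     square root. *)
  set (hc := fun t : R => cis (t / 2)).
  assert (Dhc : forall t, cder hc t (Ci / 2 * hc t)).
  { intros t. apply cder_val with (RtoC (/ 2) * (Ci * cis (t / 2))).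
    rewrite RtoC_inv by lra. unfold hc, Cdiv. ring.
    apply (cder_comp_real cis (fun t => t / 2)%R). apply cder_cis. auto_derive; auto; field. }
  set (u := fun t => hc t * bJ q (w t)).
  set (g := fun t => hc t * (RtoC (INR q + / 2) / w t * bJ q (w t) - bJ (S q) (w t))).
  assert (Eq : RtoC (INR q + / 2) = RtoC (INR q) + / 2).
  { rewrite RtoC_plus, RtoC_inv by lra. reflexivity. }
  assert (Ek : RtoC (kappa q) = RtoC (INR q) * RtoC (INR q) - / (2 * 2)).
  { unfold kappa. rewrite RtoC_minus, RtoC_mult, RtoC_inv by lra. do 2 f_equal.
    rewrite <- RtoC_mult. f_equal; ring. }
  assert (Du : forall t, cder u t (Ci * w t * g t)).
  { intros t. eapply cder_val; [|apply (cder_mult _ _ _ _ _ (Dhc t) (bJ_cder q _ _ _ (cder_circ r t)))].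
    fold w. rewrite bJ'_rec by auto. unfold g. rewrite Eq. field. auto. }
  assert (Dg : forall t, cder g t (- Ci * w t * (1 - RtoC (kappa q) / (w t * w t)) * u t)).
  { intros t. eapply cder_val; [|apply (cder_mult _ _ _ _ _ (Dhc t)
      (cder_minus _ _ _ _ _ (cder_mult _ _ _ _ _ 
         (cder_mult _ _ _ _ _ (cder_const (RtoC (INR q + / 2)) t)
            (cder_comp (fun z => / z) w _ _ _ (cdv_inv_id _ (Nw t)) (cder_circ r t)))
         (bJ_cder q _ _ _ (cder_circ r t))) (bJ_cder (S q) _ _ _ (cder_circ r t))))].
    fold w. rewrite bJ'_rec, bJ'_succ by auto. unfold u. rewrite Eq, Ek, S_INR, RtoC_plus. field. auto. }
  assert (CiCi : Ci * Ci = - (1)) by (apply injective_projections; simpl; ring).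
  set (E1 := fun t => cexp (Ci * w t)). set (E2 := fun t => cexp (- (Ci * w t))).
  assert (E12 : forall t, E1 t * E2 t = 1).
  { intros t. unfold E1, E2. rewrite <- cexp_plus. replace (Ci * w t + - (Ci * w t)) with (RtoC 0) by ring.
    apply cexp_0. }
  assert (DE1 : forall t, cder E1 t (- w t * E1 t)).
  { intros t. eapply cder_val; [|exact (cder_cexp _ t _ (cder_scal Ci w t _ (cder_circ r t)))].
    change (Ci * (Ci * w t) * E1 t = - w t * E1 t). rewrite Cmult_assoc, CiCi. ring. }
  assert (DE2 : forall t, cder E2 t (w t * E2 t)).
  { intros t. apply cder_ext with (fun t => cexp (- Ci * w t)).
    intros s; unfold E2; f_equal; ring.
    eapply cder_val; [|exact (cder_cexp _ t _ (cder_scal (- Ci) w t _ (cder_circ r t)))].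
    unfold E2. replace (- (Ci * w t)) with (- Ci * w t) by ring.
    change (- Ci * (Ci * w t) * cexp (- Ci * w t) = w t * cexp (- Ci * w t)).
    replace (- Ci * (Ci * w t)) with (- (Ci * Ci) * w t) by ring. rewrite CiCi. ring. }
  assert (ME1 : forall t, Cmod (E1 t) = exp (- (r * sin t))).
  { intros t. unfold E1. rewrite Cmod_cexp. f_equal. unfold w, circ, cis. simpl. ring. }
  assert (ME2 : forall t, Cmod (E2 t) = exp (r * sin t)).
  { intros t. unfold E2. rewrite Cmod_cexp. f_equal. unfold w, circ, cis. simpl. ring. }
  (* Up to constant factors, the coefficients of u on e^(-iw) and e^(iw). They would be constant for
     kappa = 0; in general their derivatives contain only the term with kappa. *)
  set (P := fun t => (g t - Ci * u t) * E1 t). set (M := fun t => (g t + Ci * u t) * E2 t).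
  assert (DP : forall t, cder P t (Ci * RtoC (kappa q) / w t * (u t * E1 t))).
  { intros t. eapply cder_val; [|apply (cder_mult _ _ _ _ _ (cder_minus _ _ _ _ _ (Dg t) (cder_scal Ci _ _ _ (Du t))) (DE1 t))].
    replace (Ci * (Ci * w t * g t)) with (- w t * g t) by (transitivity (Ci * Ci * w t * g t); [rewrite CiCi|]; ring).
    pose proof (Nw t). field. auto. }
  assert (DM : forall t, cder M t (Ci * RtoC (kappa q) / w t * (u t * E2 t))).
  { intros t. eapply cder_val; [|apply (cder_mult _ _ _ _ _ (cder_plus _ _ _ _ _ (Dg t) (cder_scal Ci _ _ _ (Du t))) (DE2 t))].
    replace (Ci * (Ci * w t * g t)) with (- w t * g t) by (transitivity (Ci * Ci * w t * g t); [rewrite CiCi|]; ring).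
    pose proof (Nw t). field. auto. }
  assert (Hu : forall t, RtoC 2 * Ci * u t = M t * E1 t - P t * E2 t).
  { intros t. unfold M, P.
    replace ((g t + Ci * u t) * E2 t * E1 t - (g t - Ci * u t) * E1 t * E2 t) with (RtoC 2 * Ci * u t * (E1 t * E2 t)) by ring.
    rewrite E12. ring. }
  set (j := rJ q r).
  assert (Hw0 : w 0%R = RtoC r).
  { unfold w, circ, cis. rewrite cos_0, sin_0. unfold Cmult, RtoC. simpl. f_equal; ring. }
  assert (Hhc0 : hc 0%R = 1).
  { unfold hc, cis. replace (0 / 2)%R with 0%R by field. rewrite cos_0, sin_0. reflexivity. }
  assert (Hu0 : u 0%R = RtoC j).
  { unfold u. rewrite Hhc0, Hw0, bJ_real. unfold j. ring. }
  assert (Hg0 : g 0%R = 0).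
  { unfold g. rewrite Hw0, !bJ_real, <- RtoC_div, <- RtoC_mult, <- RtoC_minus by lra.
    fold (rH q r). rewrite Hcrit. ring. }
  (* This is 2 j cos(w - r), since the second exponent equals -i (w - r): the unperturbed solution
     with u = j and u' = 0 at w = r, doubled. *)
  set (main := fun t => RtoC j * (cexp (- (r * sin t), - (r * (1 - cos t)))%R + cexp (r * sin t, r * (1 - cos t))%R)).
  assert (Hmain : forall t, M 0%R * E1 t - P 0%R * E2 t = Ci * main t).
  { intros t. unfold M, P, main. rewrite Hu0, Hg0.
    transitivity (Ci * RtoC j * (E2 0%R * E1 t + E1 0%R * E2 t)). ring.
    rewrite <- Cmult_assoc. f_equal. f_equal. unfold E1, E2. rewrite <- !cexp_plus, Hw0.
    f_equal; f_equal; unfold w, circ, cis, Ci, Cmult, Copp, Cplus, RtoC; simpl; f_equal; ring. }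
  (* X is the maximum of |u| e^(-r sin t) on the arc. The error is first estimated in terms of this
     unknown X, and the same estimate at the maximising point then bounds X by |j|. *)
  destruct (tc_bounded (fun t => u t * E1 t) 0 (PI / 2)) as [t0 [Ht0 HX]]; [lra | |].
  { intros t _. apply tc_mult; eapply cder_tc; [apply Du | apply DE1]. }
  set (X := Cmod (u t0 * E1 t0)) in *.
  assert (HX0 : (0 <= X)%R) by apply Cmod_ge_0.
  assert (err : forall t, (0 <= t <= PI / 2)%R -> (2 * Cmod (u t) >= Cmod (main t) - 8 * k * X * exp (r * sin t) / r)%R /\
     (2 * Cmod (u t) <= Cmod (main t) + 8 * k * X * exp (r * sin t) / r)%R).
  { intros t Ht.
    assert (Hsin : forall s, (0 <= s <= t)%R -> (sin s <= sin t)%R).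
    { intros s Hs. apply sin_incr_1; lra. }
    assert (Kc : forall s, Cmod (Ci * RtoC (kappa q) / w s) = (k / r)%R).
    { intros s. unfold Cdiv. rewrite !Cmod_mult, Cmod_Ci, Cmod_R, Cmod_inv by auto.
      unfold w. rewrite Cmod_circ by lra. fold k. field. lra. }
    assert (Hkr : (0 <= k / r)%R) by (apply Rdiv_le_0_compat; auto).
    assert (B1 : (Cmod (P t - P 0%R) <= 2 * (k / r * X) * (t - 0))%R).
    { apply cder_bound with (fun t => Ci * RtoC (kappa q) / w t * (u t * E1 t)); [lra | auto |].
      intros s Hs. rewrite Cmod_mult, Kc. apply Rmult_le_compat_l; auto. apply HX. lra. }
    set (y := (r * sin t)%R).
    (* u e^(-iw) is u e^(iw) times e^(-2iw), whose modulus e^(2 r sin s) is largest at s = t because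
       the sine increases on the quarter circle. This is why only a quarter circle is treated. *)
    assert (B2 : (Cmod (M t - M 0%R) <= 2 * (k / r * (X * exp (2 * y))) * (t - 0))%R).
    { apply cder_bound with (fun t => Ci * RtoC (kappa q) / w t * (u t * E2 t)); [lra | auto |].
      intros s Hs. rewrite Cmod_mult, Kc. apply Rmult_le_compat_l; auto.
      replace (u s * E2 s) with (u s * E1 s * (E2 s * E2 s))
        by (transitivity (u s * E2 s * (E1 s * E2 s)); [|rewrite E12]; ring).
      rewrite (Cmod_mult (u s * E1 s)). apply Rmult_le_compat; try apply Cmod_ge_0. apply HX; lra.
      rewrite Cmod_mult, ME2, <- exp_plus.
      specialize (Hsin s Hs). assert (r * sin s <= y)%R by (unfold y; apply Rmult_le_compat_l; lra).
      replace (r * sin s + r * sin s)%R with (2 * (r * sin s))%R by ring.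
      destruct (Req_dec (r * sin s) y) as [->|]; [lra|]. left. apply exp_increasing. lra. }
    assert (D : (Cmod (RtoC 2 * Ci * u t - Ci * main t) <= 8 * k * X * exp y / r)%R).
    { rewrite Hu, <- Hmain.
      replace (M t * E1 t - P t * E2 t - (M 0%R * E1 t - P 0%R * E2 t))
        with ((M t - M 0%R) * E1 t - (P t - P 0%R) * E2 t) by ring.
      eapply Rle_trans. apply Cmod_sub_le. rewrite !Cmod_mult, ME1, ME2. fold y.
      assert (Ey : (exp (2 * y) * exp (- y) = exp y)%R) by (rewrite <- exp_plus; f_equal; ring).
      assert (P1 : (0 < exp y)%R) by apply exp_pos. assert (P2 : (0 < exp (- y))%R) by apply exp_pos.
      apply Rle_trans with (2 * (k / r * (X * exp (2 * y))) * (t - 0) * exp (- y) + 2 * (k / r * X) * (t - 0) * exp y)%R.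
      { apply Rplus_le_compat; apply Rmult_le_compat_r; lra. }
      replace (2 * (k / r * (X * exp (2 * y))) * (t - 0) * exp (- y))%R
        with (2 * (k / r * X) * (t - 0) * (exp (2 * y) * exp (- y)))%R by ring. rewrite Ey.
      replace (8 * k * X * exp y / r)%R with (4 * ((k / r) * X * exp y) * 2)%R by (field; lra).
      replace (2 * (k / r * X) * (t - 0) * exp y + 2 * (k / r * X) * (t - 0) * exp y)%R
        with (4 * ((k / r) * X * exp y) * t)%R by ring.
      apply Rmult_le_compat_l; [|lra].
      apply Rmult_le_pos; [lra|]. apply Rmult_le_pos; [|lra]. apply Rmult_le_pos; auto. }
    assert (M2 : Cmod (RtoC 2 * Ci * u t) = (2 * Cmod (u t))%R).
    { rewrite !Cmod_mult, Cmod_Ci, Cmod_R, Rabs_pos_eq by lra. ring. }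
    assert (M3 : Cmod (Ci * main t) = Cmod (main t)) by (rewrite Cmod_mult, Cmod_Ci; ring).
    pose proof (Cmod_sub_ge (RtoC 2 * Ci * u t) (Ci * main t)) as Q1.
    pose proof (Cmod_sub_ge (Ci * main t) (RtoC 2 * Ci * u t)) as Q2. rewrite Cmod_sub_comm in Q2.
    rewrite M2, M3 in Q1, Q2. split; lra. }
  assert (Hmj : forall t, (0 <= t <= PI / 2)%R -> (Cmod (main t) <= 2 * Rabs j * exp (r * sin t))%R).
  { intros t Ht. unfold main. rewrite Cmod_mult, Cmod_R.
    replace (2 * Rabs j * exp (r * sin t))%R with (Rabs j * (exp (r * sin t) + exp (r * sin t)))%R by ring.
    apply Rmult_le_compat_l. apply Rabs_pos. eapply Rle_trans. apply Cmod_triangle.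
    rewrite !Cmod_cexp. simpl. apply Rplus_le_compat_r.
    assert (0 <= r * sin t)%R by (apply Rmult_le_pos; [lra | apply sin_ge_0; lra]).
    destruct (Req_dec (r * sin t) 0) as [->|]. rewrite Ropp_0; lra. left; apply exp_increasing; lra. }
  assert (HkX : (8 * k * X / r <= X / 8)%R).
  { apply (Rle_div_l _ _ r); [lra|]. nra. }
  assert (Hj0 : (0 <= Rabs j)%R) by apply Rabs_pos.
  assert (HXj : (X <= 2 * Rabs j)%R).
  { destruct (err t0 Ht0) as [_ K]. specialize (Hmj t0 Ht0).
    set (y := (r * sin t0)%R) in *.
    assert (EX : (X * exp y = Cmod (u t0))%R).
    { unfold X. rewrite Cmod_mult, ME1. fold y. rewrite Rmult_assoc, <- exp_plus.
      replace (- y + y)%R with 0%R by ring. rewrite exp_0. ring. }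
    rewrite <- EX in K. assert (0 < exp y)%R by apply exp_pos.
    replace (8 * k * X * exp y / r)%R with (8 * k * X / r * exp y)%R in K by (field; lra).
    assert (2 * X <= 2 * Rabs j + X / 8)%R.
    { apply Rmult_le_reg_r with (exp y); auto. nra. }
    lra. }
  intros t Ht.
  destruct (err t Ht) as [K _].
  assert (Hc : Cmod (u t) = Cmod (bJ q (circ r t))).
  { unfold u, hc, w. rewrite Cmod_mult, Cmod_cis. ring. }
  rewrite Hc in K.
  assert (Hs : (0 <= sin t)%R) by (apply sin_ge_0; lra).
  assert (Hco : (0 <= cos t)%R) by (apply cos_ge_0; lra).
  pose proof (sin2_cos2 t) as S1. unfold Rsqr in S1.
  (* On the quarter circle sin t + cos t >= 1, which gives the hypothesis x <= y of
     [cosh_sinh_lower]. The main term then contributes |j| e^y / 2 and the error at most |j| e^y /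
     4, leaving |j| e^y / 8 for |u|. *)
  assert (Hxy : (0 <= r * (1 - cos t) <= r * sin t)%R).
  { split. apply Rmult_le_pos; nra. apply Rmult_le_compat_l; nra. }
  pose proof (cosh_sinh_lower _ _ Hxy) as L.
  assert (Lm : (Rabs j * (exp (r * sin t) / 2) <= Cmod (main t))%R).
  { unfold main. rewrite Cmod_mult, Cmod_R. apply Rmult_le_compat_l; auto. }
  assert (0 < exp (r * sin t))%R by apply exp_pos.
  replace (8 * k * X * exp (r * sin t) / r)%R with (8 * k * X / r * exp (r * sin t))%R in K by (field; lra).
  assert (8 * k * X / r * exp (r * sin t) <= Rabs j / 4 * exp (r * sin t))%R by (apply Rmult_le_compat_r; lra).
  change (Rabs j * exp (r * sin t) / 8 <= Cmod (bJ q (circ r t)))%R. lra.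
Qed.

Lemma first_quadrant_polar (x y : R) : (0 <= x)%R -> (0 <= y)%R -> (0 < Cmod (x, y))%R ->
  exists th, (0 <= th <= PI / 2)%R /\ (x, y) = circ (Cmod (x, y)) th.
Proof.
  intros Hx Hy Hr. set (r := Cmod (x, y)) in *.
  assert (Hr2 : (r * r = x * x + y * y)%R).
  { unfold r, Cmod. simpl. rewrite sqrt_sqrt; nra. }
  assert (Hxr : (x <= r)%R) by nra.
  assert (Hq : (0 <= x / r <= 1)%R).
  { split. apply Rdiv_le_0_compat; lra. apply (Rle_div_l x 1 r); lra. }
  exists (acos (x / r)). split.
  - pose proof (acos_bound (x / r)) as Hb. pose proof PI_RGT_0. split; [lra|].
    apply Rnot_lt_le. intros Hlt. pose proof (cos_lt_0 (acos (x / r)) Hlt ltac:(lra)) as Hc.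
    rewrite cos_acos in Hc; lra.
  - unfold circ, cis. rewrite cos_acos by lra. rewrite sin_acos by lra.
    replace (1 - (x / r)²)%R with ((y / r) * (y / r))%R.
    2:{ unfold Rsqr. apply Rmult_eq_reg_r with (r * r)%R; [|nra].
        replace (y / r * (y / r) * (r * r))%R with (y * y)%R by (field; lra).
        replace ((1 - x / r * (x / r)) * (r * r))%R with (r * r - x * x)%R by (field; lra). lra. }
    rewrite sqrt_square by (apply Rdiv_le_0_compat; lra).
    apply injective_projections; simpl; field; lra.
Qed.

(** Parity and conjugation symmetry reduce the whole circle to its arc in the first quadrant. *)
Lemma Cmod_bJ_fold (q : nat) (x y : R) : Cmod (bJ q (x, y)) = Cmod (bJ q (Rabs x, Rabs y)).
Proof.
  assert (Cj : forall a b, Cmod (bJ q (a, - b)%R) = Cmod (bJ q (a, b))).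
  { intros a b. change (a, - b)%R with (Cconj (a, b)). rewrite bJ_conj. apply Cmod_conj. }
  assert (Op : forall a b, Cmod (bJ q (- a, - b)%R) = Cmod (bJ q (a, b))).
  { intros a b. change (- a, - b)%R with (- (a, b)). apply bJ_opp. }
  unfold Rabs. destruct (Rcase_abs x), (Rcase_abs y).
  - rewrite Op. reflexivity.
  - rewrite <- Op. apply Cj.
  - rewrite Cj. reflexivity.
  - reflexivity.
Qed.

(** At a critical radius the energy is r J_q(r)^2, so [energy_lower] from the point 1 gives |J_q(r)|
    >= sqrt(e/r) with e independent of r. The factor 1/8 in c and the threshold 64 |kappa| in r0
    come from [arc_lower_bound]. *)
Lemma circle_lower_bound (q : nat) : exists c r0, (0 < c)%R /\ (1 <= r0)%R /\
  forall r w, (r0 <= r)%R -> rH q r = 0%R -> Cmod w = r ->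
  (c / sqrt r * exp (Rabs (Im w)) <= Cmod (bJ q w))%R.
Proof.
  set (e := (energy q 1 * exp (- Rabs (kappa q)))%R).
  assert (He : (0 < e)%R) by (apply Rmult_lt_0_compat; [apply energy_pos; lra | apply exp_pos]).
  assert (Hse : (0 < sqrt e)%R) by (apply sqrt_lt_R0; auto).
  exists (sqrt e / 8)%R, (Rmax 1 (64 * Rabs (kappa q))).
  split; [lra|]. split; [apply Rmax_l|].
  intros r w Hr Hc Hw.
  pose proof (Rmax_l 1 (64 * Rabs (kappa q))). pose proof (Rmax_r 1 (64 * Rabs (kappa q))).
  assert (Hsr : (0 < sqrt r)%R) by (apply sqrt_lt_R0; lra).
  destruct w as [x y]. rewrite Cmod_bJ_fold. simpl (Im _).
  assert (Hm : Cmod (Rabs x, Rabs y) = r).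
  { rewrite <- Hw. unfold Cmod. f_equal. simpl. rewrite !Rmult_1_r.
    rewrite <- !Rabs_mult, !Rabs_pos_eq by nra. reflexivity. }
  destruct (first_quadrant_polar (Rabs x) (Rabs y)) as [th [Hth E]]; try apply Rabs_pos; [lra|].
  rewrite Hm in E. 
  assert (Ey : Rabs y = (r * sin th)%R).
  { apply (f_equal Im) in E. simpl in E. rewrite E. ring. }
  rewrite E, Ey. eapply Rle_trans; [|apply arc_lower_bound; auto; lra].
  assert (Hj : (sqrt e / sqrt r <= Rabs (rJ q r))%R).
  { apply (Rle_div_l _ _ (sqrt r)); auto.
    rewrite <- (Rabs_pos_eq (sqrt r)) by lra. rewrite <- Rabs_mult, <- sqrt_Rsqr_abs.
    apply sqrt_le_1_alt. unfold Rsqr.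
    pose proof (energy_lower q 1 r ltac:(lra)) as L. unfold energy at 2 in L. rewrite Hc in L.
    replace (- Rabs (kappa q) / 1)%R with (- Rabs (kappa q))%R in L by field. fold e in L.
    replace (rJ q r * sqrt r * (rJ q r * sqrt r))%R with (rJ q r * rJ q r * (sqrt r * sqrt r))%R by ring.
    rewrite sqrt_sqrt by lra. lra. }
  assert (0 < exp (r * sin th))%R by apply exp_pos.
  apply Rmult_le_compat_r with (r := (exp (r * sin th) / 8)%R) in Hj; [|lra].
  unfold Rdiv in *. lra.
Qed.

(** A weak form of Jordan's inequality: up to pi/3 the cosine exceeds 1/4, and beyond it sin t >=
    1/2 while t/4 <= 1/2. *)
Lemma sin_lower (t : R) : (0 <= t <= PI / 2)%R -> (t / 4 <= sin t)%R.
Proof.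
  intros Ht. pose proof PI_RGT_0. pose proof PI_4.
  destruct (Rle_lt_dec t (PI / 3)) as [H1|H1].
  - assert (K : (sin 0 - 0 / 4 <= sin t - t / 4)%R); [|rewrite sin_0 in K; lra].
    apply (nondecreasing_of_derive (fun t => sin t - t / 4)%R (fun t => cos t - / 4)%R); [lra| |].
    + intros s Hs. auto_derive; auto. field.
    + intros s Hs. assert (/ 2 <= cos s)%R; [|lra].
      replace (/ 2)%R with (cos (PI / 3)) by (rewrite cos_PI3; lra). apply cos_decr_1; lra.
  - assert (sin (PI / 6) <= sin t)%R by (apply sin_incr_1; lra).
    rewrite sin_PI6 in *. lra.
Qed.

Lemma exp_neg_le (a b : R) : (a <= b)%R -> (exp (- b) <= exp (- a))%R.
Proof. intros H. destruct (Req_dec a b) as [->|]. lra. left. apply exp_increasing. lra. Qed.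

(** Jordan's lemma on a half period between two zeros of the sine. The weight is dominated by two
    exponentials decaying from the two ends, with integral at most 8 m / r, and the factor 2 of
    [CInt_Cmod_le] makes it 16. *)
Lemma CInt_exp_sin_bound (g : R -> C) (a r m : R) : (0 < r)%R -> (0 <= m)%R -> Rabs (sin a) = 0%R ->
  (forall t, tc g t) ->
  (forall t, (a <= t <= a + PI)%R -> (Cmod (g t) <= m * exp (- (r * Rabs (sin t))))%R) ->
  (Cmod (CInt g a (a + PI)) <= 16 * m / r)%R.
Proof.
  intros Hr Hm Ha Hg Hb. pose proof PI_RGT_0 as Hpi.
  set (h := fun t => (m * (exp (- (r * (t - a) / 4)) + exp (- (r * (a + PI - t) / 4))))%R).
  set (Hh := fun t => (m * (4 / r) * (exp (- (r * (a + PI - t) / 4)) - exp (- (r * (t - a) / 4))))%R).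
  assert (I : is_RInt h a (a + PI) (Hh (a + PI) - Hh a)%R).
  { apply (is_RInt_derive (V := R_CompleteNormedModule) Hh h).
    - intros t _. unfold Hh, h. auto_derive; auto. unfold Rdiv, Rminus. field. lra.
    - intros t _. apply (ex_derive_continuous h). unfold h. auto_derive; auto. }
  assert (S1 : forall t, (a <= t <= a + PI)%R -> Rabs (sin t) = sin (t - a)).
  { intros t Ht. replace t with (a + (t - a))%R at 1 by ring. rewrite sin_plus.
    assert (Hsa : sin a = 0%R) by (destruct (Req_dec (sin a) 0); auto; exfalso; apply (Rabs_no_R0 (sin a)); auto).
    rewrite Hsa, Rmult_0_l, Rplus_0_l, Rabs_mult.
    pose proof (sin2_cos2 a) as Q. rewrite Hsa in Q. unfold Rsqr in Q.
    assert (Hca : Rabs (cos a) = 1%R).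
    { assert (Q2 : ((cos a - 1) * (cos a + 1) = 0)%R) by lra.
      apply Rmult_integral in Q2. destruct Q2 as [Q2|Q2].
      replace (cos a) with 1%R by lra. apply Rabs_R1.
      replace (cos a) with (- (1))%R by lra. rewrite Rabs_Ropp. apply Rabs_R1. }
    rewrite Hca, Rmult_1_l. apply Rabs_pos_eq. apply sin_ge_0; lra. }
  eapply Rle_trans. apply (CInt_Cmod_le g h a (a + PI)%R (Hh (a + PI)%R - Hh a)%R ltac:(lra)); [auto| |exact I].
  - intros t Ht. eapply Rle_trans. apply Hb; auto. unfold h. apply Rmult_le_compat_l; auto.
    rewrite S1 by auto.
    pose proof (exp_pos (- (r * (t - a) / 4))). pose proof (exp_pos (- (r * (a + PI - t) / 4))).
    destruct (Rle_lt_dec (t - a) (PI / 2)).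
    + assert (K := sin_lower (t - a) ltac:(lra)).
      assert (exp (- (r * sin (t - a))) <= exp (- (r * (t - a) / 4)))%R by (apply exp_neg_le; nra). lra.
    + assert (K := sin_lower (PI - (t - a)) ltac:(lra)).
      replace (sin (PI - (t - a))) with (sin (t - a)) in K by (symmetry; apply sin_PI_x).
      assert (exp (- (r * sin (t - a))) <= exp (- (r * (a + PI - t) / 4)))%R by (apply exp_neg_le; nra). lra.
  - unfold Hh.
    replace (r * (a + PI - (a + PI)) / 4)%R with 0%R by field.
    replace (r * (a - a) / 4)%R with 0%R by field.
    rewrite Ropp_0, exp_0. 
    pose proof (exp_pos (- (r * (a + PI - a) / 4))). 
    assert (E : (a + PI - a = PI)%R) by ring. rewrite E in *.
    assert (0 <= m * (4 / r))%R by (apply Rmult_le_pos; [auto | apply Rdiv_le_0_compat; lra]).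
    replace (16 * m / r)%R with (4 * (m * (4 / r)))%R by (field; lra). nra.
Qed.

Lemma oint_exp_sin_bound (g : R -> C) (r m : R) : (0 < r)%R -> (0 <= m)%R ->
  (forall t, tc g t) -> (forall t, (Cmod (g t) <= m * exp (- (r * Rabs (sin t))))%R) ->
  (Cmod (oint g) <= 32 * m / r)%R.
Proof.
  intros Hr Hm Hg Hb. pose proof PI_RGT_0 as Hpi.
  assert (E : oint g = CInt g 0 (0 + PI) + CInt g PI (PI + PI)).
  { destruct (tc_ex_RInt g 0 PI ltac:(lra) (fun t _ => Hg t)) as [A1 A2].
    destruct (tc_ex_RInt g PI (PI + PI) ltac:(lra) (fun t _ => Hg t)) as [B1 B2].
    unfold oint, CInt, Cplus. simpl fst. simpl snd. rewrite Rplus_0_l.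
    replace (2 * PI)%R with (PI + PI)%R by ring.
    f_equal; symmetry; apply (RInt_Chasles (V := R_CompleteNormedModule)); auto. }
  rewrite E. eapply Rle_trans. apply Cmod_triangle.
  pose proof (CInt_exp_sin_bound g 0 r m Hr Hm ltac:(rewrite sin_0; apply Rabs_R0) Hg (fun t _ => Hb t)).
  pose proof (CInt_exp_sin_bound g PI r m Hr Hm ltac:(rewrite sin_PI; apply Rabs_R0) Hg (fun t _ => Hb t)).
  unfold Rdiv in *. lra.
Qed.

(** * Zeros and poles *)

(** Partial fractions in w turn the integrand into a difference of two kernels w/(w - a) with poles
    inside the circle; both integrate to 2 pi by [oint_circ_quot]. *)
Lemma oint_pole (r : R) (p z : C) : (0 < r)%R -> (Cmod p < r)%R -> (Cmod z < r)%R -> z <> p ->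
  oint (fun t => / (circ r t - p) * (circ r t / (circ r t - z))) = 0.
Proof.
  intros Hr Hp Hz N. apply not_eq_sym in N. apply Cminus_neq_0 in N.
  transitivity (oint (fun t => / (p - z) * (circ r t / (circ r t - p) - circ r t / (circ r t - z)))).
  { apply oint_ext. intros t. pose proof (circ_sub_neq_0 r t p Hp). pose proof (circ_sub_neq_0 r t z Hz).
    field. auto. }
  rewrite oint_lin; [|intros; apply tc_circ_quot; auto..].
  rewrite !oint_circ_quot by auto. ring.
Qed.

Lemma oint_inv_pow_quot (r : R) (z : C) (j : nat) : (0 < r)%R -> (Cmod z < r)%R -> z <> 0 ->
  oint (fun t => / circ r t ^ S j * (circ r t / (circ r t - z))) = 0.
Proof.
  intros Hr Hz N. induction j.
  - transitivity (oint (fun t => / z * (circ r t / (circ r t - z) - 1))).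
    { apply oint_ext. intros t. pose proof (circ_neq_0 r t Hr). pose proof (circ_sub_neq_0 r t z Hz).
      simpl. field. auto. }
    rewrite oint_lin; [|intros; apply tc_circ_quot; auto|intros; apply tc_const].
    rewrite !oint_circ_quot, oint_const by auto. ring.
  - transitivity (oint (fun t => / z * (/ circ r t ^ S j * (circ r t / (circ r t - z)) - / circ r t ^ S j))).
    { apply oint_ext. intros t. pose proof (circ_neq_0 r t Hr). pose proof (circ_sub_neq_0 r t z Hz).
      pose proof (Cpow_nz _ j H). simpl. field. auto. }
    rewrite oint_lin.
    + rewrite IHj, oint_circ_inv_pow by auto. ring.
    + intros t. apply (tc_mult _ (fun t => / circ r t ^ S j)). apply tc_circ_inv_pow; auto. apply tc_circ_quot; auto.
    + intros t. apply tc_circ_inv_pow; auto.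
Qed.

Lemma oint_csum_0 (f : nat -> R -> C) (n : nat) :
  (forall i, (i < n)%nat -> forall t, tc (f i) t) -> (forall i, (i < n)%nat -> oint (f i) = 0) ->
  (forall t, tc (fun t => csum (fun i => f i t) n) t) /\ oint (fun t => csum (fun i => f i t) n) = 0.
Proof.
  induction n; intros H1 H2; simpl.
  - split. intros; apply tc_const. rewrite oint_const. ring.
  - destruct IHn as [T I]; auto. split.
    + intros t. apply (tc_plus _ (fun t => csum (fun i => f i t) n)); auto.
    + unfold oint in *. pose proof two_PI_pos. rewrite (CInt_plus (fun t => csum (fun i => f i t) n)); auto; [|lra].
      rewrite I, H2 by lia. ring.
Qed.

Lemma sum_n_m_csum (f : nat -> C) (n : nat) :
  sum_n_m (G := C_AbelianMonoid) f 1 n = csum (fun j => f (S j)) n.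
Proof.
  induction n.
  - apply (sum_n_m_zero (G := C_AbelianMonoid)). lia.
  - rewrite sum_n_Sm by lia. rewrite IHn. reflexivity.
Qed.

Lemma continuous_neq_0 (f : R -> R) (x : R) : continuous f x -> f x <> 0%R ->
  exists d, (0 < d)%R /\ forall y, (Rabs (y - x) < d)%R -> f y <> 0%R.
Proof.
  intros H N. assert (P : (0 < Rabs (f x))%R) by (apply Rabs_pos_lt; auto).
  destruct (proj1 (filterlim_locally _ _) H (mkposreal _ P)) as [d Hd].
  exists d. split. apply cond_pos. intros y Hy E. specialize (Hd y Hy).
  unfold ball in Hd; simpl in Hd. unfold AbsRing_ball, abs, minus, plus, opp in Hd; simpl in Hd.
  rewrite E, Rplus_0_l, Rabs_Ropp in Hd. lra.
Qed.

Section Zeros.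

Variables (q : nat) (zk : Z -> R).
Hypothesis Hz : bessel_zeros q zk.

Lemma zk_pos (k : Z) : (1 <= k)%Z -> (0 < zk k)%R.
Proof. intros Hk. apply (proj1 Hz k Hk). Qed.

Lemma zk_zero (k : Z) : (1 <= k)%Z -> rJ q (zk k) = 0%R.
Proof.
  intros Hk. destruct (proj1 Hz k Hk) as [_ [_ [H _]]].
  rewrite besselJ_of_nat, bJ_real in H. exact (f_equal Re H).
Qed.

Lemma zk_opp (k : Z) : (1 <= k)%Z -> zk (- k)%Z = (- zk k)%R.
Proof. intros Hk. apply (proj1 Hz k Hk). Qed.

Lemma zk_lt (j k : Z) : (1 <= j < k)%Z -> (zk j < zk k)%R.
Proof.
  intros H. replace k with (j + 1 + Z.of_nat (Z.to_nat (k - j - 1)))%Z by lia.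
  generalize (Z.to_nat (k - j - 1)). intros n. induction n.
  - rewrite Z.add_0_r. apply (proj1 Hz). lia.
  - eapply Rlt_trans; [apply IHn|].
    replace (j + 1 + Z.of_nat (S n))%Z with (j + 1 + Z.of_nat n + 1)%Z by lia.
    apply (proj1 Hz). lia.
Qed.

Lemma zk_le (j k : Z) : (1 <= j <= k)%Z -> (zk j <= zk k)%R.
Proof.
  intros H. destruct (Z.eq_dec j k) as [->|]. lra. left. apply zk_lt. lia.
Qed.

Lemma zk_inj (j k : Z) : j <> 0%Z -> k <> 0%Z -> j <> k -> zk j <> zk k.
Proof.
  assert (P : forall i, (i < 0)%Z -> zk i = (- zk (- i))%R /\ (0 < zk (- i))%R).
  { intros i Hi. split. rewrite <- (zk_opp (- i)) by lia. f_equal. lia. apply zk_pos. lia. }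
  assert (L : forall a b, (1 <= a)%Z -> (1 <= b)%Z -> a <> b -> zk a <> zk b).
  { intros a b Ha Hb Hab. destruct (Z_lt_le_dec a b).
    pose proof (zk_lt a b ltac:(lia)); lra. pose proof (zk_lt b a ltac:(lia)); lra. }
  intros Hj Hk Hjk. destruct (Z_lt_le_dec j 0) as [H1|H1], (Z_lt_le_dec k 0) as [H2|H2].
  - destruct (P j H1) as [-> _], (P k H2) as [-> _].
    pose proof (L (- j) (- k) ltac:(lia) ltac:(lia) ltac:(lia))%Z. lra.
  - destruct (P j H1) as [-> K]. pose proof (zk_pos k ltac:(lia)). lra.
  - destruct (P k H2) as [-> K]. pose proof (zk_pos j ltac:(lia)). lra.
  - apply L; lia.
Qed.

Lemma zk_bJ (k : Z) : k <> 0%Z -> bJ q (RtoC (zk k)) = 0 /\ bJ' q (RtoC (zk k)) <> 0 /\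
  zk k <> 0%R /\ Cmod (RtoC (zk k)) = zk (Z.abs k).
Proof.
  intros Hk. assert (Ha : (1 <= Z.abs k)%Z) by lia.
  pose proof (zk_pos _ Ha) as P. pose proof (zk_zero _ Ha) as E0.
  assert (C : zk k = zk (Z.abs k) \/ zk k = (- zk (Z.abs k))%R).
  { destruct (Z_lt_le_dec k 0).
    - right. rewrite <- zk_opp by auto. f_equal. lia.
    - left. f_equal. lia. }
  set (x := zk (Z.abs k)) in *.
  assert (Hm : forall n, Cmod (bJ n (RtoC (zk k))) = Cmod (bJ n (RtoC x))).
  { intros n. destruct C as [-> | ->]; auto. rewrite RtoC_opp. apply bJ_opp. }
  assert (H0 : bJ q (RtoC (zk k)) = 0).
  { apply Cmod_eq_0. rewrite Hm, bJ_real, E0. apply Cmod_0. }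
  assert (Hzk : zk k <> 0%R) by (destruct C; lra).
  repeat split; auto.
  - rewrite bJ'_rec by (apply RtoC_neq; auto). rewrite H0. intros E.
    assert (E1 : bJ (S q) (RtoC (zk k)) = 0).
    { replace (bJ (S q) (RtoC (zk k))) with (RtoC (INR q) / RtoC (zk k) * 0 - (RtoC (INR q) / RtoC (zk k) * 0 - bJ (S q) (RtoC (zk k)))) by ring.
      rewrite E. ring. }
    apply (f_equal Cmod) in E1. rewrite Hm, bJ_real, Cmod_R, Cmod_0 in E1.
    apply (bJ_simple_zero q x P E0). apply NNPP. intros N. apply Rabs_pos_lt in N. lra.
  - rewrite Cmod_R. destruct C as [-> | ->]; rewrite ?Rabs_Ropp; apply Rabs_pos_eq; lra.
Qed.

Lemma bJ_zero_is_zk (w : C) : w <> 0 -> bJ q w = 0 -> exists k, k <> 0%Z /\ w = RtoC (zk k).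
Proof.
  intros Hw H. pose proof (bJ_zeros_real q w Hw H) as Hi.
  assert (E : w = RtoC (Re w)) by (apply injective_projections; auto).
  rewrite E in *. set (x := Re w) in *. clearbody x. clear E Hi.
  assert (Hx : x <> 0%R) by (intros ->; auto).
  destruct (Rlt_le_dec 0 x) as [Hp|Hn].
  - destruct (proj2 Hz x Hp) as [k [Hk1 Hk2]]. rewrite besselJ_of_nat; auto.
    exists k. split. lia. congruence.
  - destruct (proj2 Hz (- x)%R) as [k [Hk1 Hk2]]. lra.
    { rewrite besselJ_of_nat. apply Cmod_eq_0. rewrite RtoC_opp, bJ_opp, H. apply Cmod_0. }
    exists (- k)%Z. split. lia. f_equal. rewrite zk_opp by auto. lra.
Qed.

(* A finite limit of the zeros would also be a limit of zeros of the derivative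
   of [sqrt x * J_q(x)], which contradicts [energy_pos]. *)
Lemma zk_unbounded (B : R) : exists N, (1 <= N)%Z /\ forall k, (N <= k)%Z -> (B < zk k)%R.
Proof.
  apply NNPP. intros HN.
  assert (Hb : forall k, (1 <= k)%Z -> (zk k <= B)%R).
  { intros k Hk. apply Rnot_lt_le. intros Hlt. apply HN. exists k. split; auto.
    intros k' Hk'. eapply Rlt_le_trans; [apply Hlt|]. apply zk_le. lia. }
  destruct (completeness (fun x => exists k, (1 <= k)%Z /\ x = zk k)) as [L [HL1 HL2]].
  { exists B. intros x [k [Hk ->]]. auto. }
  { exists (zk 1). exists 1%Z. split; [lia|auto]. }
  assert (HLu : forall k, (1 <= k)%Z -> (zk k <= L)%R) by (intros k Hk; apply HL1; eauto).
  assert (HLp : (0 < L)%R) by (eapply Rlt_le_trans; [apply (zk_pos 1); lia | apply HLu; lia]).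
  assert (App : forall d, (0 < d)%R -> exists k, (1 <= k)%Z /\ (L - d < zk k)%R).
  { intros d Hd. apply NNPP. intros H. assert (K : (L <= L - d)%R); [|lra].
    apply HL2. intros x [k [Hk ->]]. apply Rnot_lt_le. intros Hlt. apply H. eauto. }
  assert (J0 : rJ q L = 0%R).
  { apply NNPP. intros N. destruct (continuous_neq_0 (rJ q) L) as [d [Hd H]]; auto.
    { apply (ex_derive_continuous (rJ q)). eexists. apply rJ_derive. lra. }
    destruct (App d Hd) as [k [Hk1 Hk2]]. apply (H (zk k)). 
    apply Rabs_def1; pose proof (HLu k Hk1); lra. apply zk_zero; auto. }
  assert (H0 : rH q L = 0%R).
  { apply NNPP. intros N. destruct (continuous_neq_0 (rH q) L) as [d [Hd H]]; auto.
    { apply (ex_derive_continuous (rH q)). eexists. apply rH_derive. lra. }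
    destruct (App d Hd) as [k [Hk1 Hk2]].
    destruct (critical_point_between q (zk k) (zk (k + 1))) as [r [Hr Hr0]].
    - split. apply zk_pos; auto. apply zk_lt. lia.
    - apply zk_zero; auto.
    - apply zk_zero; lia.
    - pose proof (HLu (k + 1)%Z ltac:(lia)). apply (H r); auto. apply Rabs_def1; lra. }
  pose proof (energy_pos q L HLp) as P. unfold energy in P. rewrite J0, H0 in P. lra.
Qed.

(** The order 1, -1, 2, -2, and so on: the first 2N indices are exactly those with 1 <= |k| <= N, so
    sums over poles inside a circle are the symmetric partial sums. *)
Definition pole_index (i : nat) : Z :=
  if Nat.even i then Z.of_nat (S (Nat.div2 i)) else (- Z.of_nat (S (Nat.div2 i)))%Z.

Lemma pole_index_even (i : nat) : pole_index (2 * i) = Z.of_nat (S i).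
Proof. unfold pole_index. rewrite Nat.even_mul, Nat.div2_double. reflexivity. Qed.

Lemma pole_index_odd (i : nat) : pole_index (S (2 * i)) = (- Z.of_nat (S i))%Z.
Proof.
  unfold pole_index. rewrite Nat.even_succ, Nat.odd_mul, Nat.div2_succ_double. reflexivity.
Qed.

Lemma pole_index_spec (N i : nat) : (i < 2 * N)%nat ->
  pole_index i <> 0%Z /\ (1 <= Z.abs (pole_index i) <= Z.of_nat N)%Z.
Proof.
  intros H. destruct (Nat.Even_or_Odd i) as [[m ->]|[m ->]].
  - rewrite pole_index_even. lia.
  - rewrite Nat.add_1_r, pole_index_odd. lia.
Qed.

Lemma pole_index_inj (i j : nat) : pole_index i = pole_index j -> i = j.
Proof.
  destruct (Nat.Even_or_Odd i) as [[m ->]|[m ->]], (Nat.Even_or_Odd j) as [[n ->]|[n ->]];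
  rewrite ?Nat.add_1_r, ?pole_index_even, ?pole_index_odd; lia.
Qed.

Lemma pole_index_surj (N : nat) (k : Z) : k <> 0%Z -> (Z.abs k <= Z.of_nat N)%Z ->
  exists i, (i < 2 * N)%nat /\ pole_index i = k.
Proof.
  intros H1 H2. destruct (Z_lt_le_dec k 0).
  - exists (S (2 * (Z.to_nat (- k) - 1)))%nat. rewrite pole_index_odd. lia.
  - exists (2 * (Z.to_nat k - 1))%nat. rewrite pole_index_even. lia.
Qed.

Lemma csum_pole_index (f : Z -> C) (N : nat) :
  csum (fun i => f (pole_index i)) (2 * N) =
  sum_n_m (G := C_AbelianMonoid) (fun k => f (Z.of_nat k) + f (- Z.of_nat k)%Z) 1 N.
Proof.
  rewrite sum_n_m_csum. induction N; auto.
  replace (2 * S N)%nat with (S (S (2 * N))) by lia.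
  change (csum (fun i => f (pole_index i)) (2 * N) + f (pole_index (2 * N)) + f (pole_index (S (2 * N)))
    = csum (fun j => f (Z.of_nat (S j)) + f (- Z.of_nat (S j))%Z) N
      + (f (Z.of_nat (S N)) + f (- Z.of_nat (S N))%Z)).
  rewrite IHN, pole_index_odd, pole_index_even. ring.
Qed.

Let p (i : nat) : C := RtoC (zk (pole_index i)).

(** The even entire factor E_q((z/2)^2) of J_q is a product of linear factors times a zero-free U on
    the disc of radius z_(N+1); applying partial fractions to 1/U then exposes all poles. [be] and
    [K] come from a construction depending on N, but uniqueness of Laurent expansions identifies
    [be] with the coefficients at 0, the same for all N. *)
Lemma bJ_decomposition (N : nat) (r : R) : (1 <= N)%nat ->
  (zk (Z.of_nat N) < r < zk (Z.of_nat (S N)))%R ->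
  exists be K R0, (r < R0)%R /\ holo K R0 /\
  (forall j, (j < q)%nat -> laurent_coeff (inv_besselJ q) 0 (- Z.of_nat (S j))%Z = be j) /\
  (exists a, is_laurent (inv_besselJ q) 0 a) /\
  forall z, (Cmod z < R0)%R -> bJ q z <> 0 ->
    / bJ q z = csum (fun i => / bJ' q (p i) / (z - p i)) (2 * N)
       + csum (fun j => be j / z ^ S j) q + K z.
Proof.
  intros HN Hr.
  set (n := (2 * N)%nat). set (R1 := zk (Z.of_nat (S N))) in *.
  (* Inverting U costs part of the disc of radius [R1]; the midpoint still leaves room around the
     circle of radius r for Cauchy's formula. *)
  set (R0 := ((r + R1) / 2)%R). assert (HR0 : (r < R0 < R1)%R) by (unfold R0; lra).
  assert (Hr0 : (0 < r)%R) by (eapply Rlt_trans; [apply (zk_pos (Z.of_nat N)); lia | lra]).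
  assert (Hpm : forall i, (i < n)%nat -> (zk 1 <= Cmod (p i) < r)%R).
  { intros i Hi. destruct (pole_index_spec N i Hi) as [H1 H2].
    destruct (zk_bJ _ H1) as [_ [_ [_ H3]]]. unfold p. rewrite H3. split.
    - apply zk_le. lia.
    - eapply Rle_lt_trans; [apply (zk_le _ (Z.of_nat N)); lia | lra]. }
  assert (Hz1 : (0 < zk 1)%R) by (apply zk_pos; lia).
  assert (Hp0 : forall i, (i < n)%nat -> p i <> 0).
  { intros i Hi. apply Cmod_pos_neq. specialize (Hpm i Hi). lra. }
  assert (HpJ : forall i, (i < n)%nat -> bJ q (p i) = 0 /\ bJ' q (p i) <> 0).
  { intros i Hi. destruct (pole_index_spec N i Hi) as [H1 H2].
    destruct (zk_bJ _ H1) as [H3 [H4 _]]. auto. }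
  assert (Hpd : forall i j, (i < j < n)%nat -> p i <> p j).
  { intros i j Hij. apply RtoC_neq. apply zk_inj.
    - apply (pole_index_spec N); unfold n in *; lia.
    - apply (pole_index_spec N); unfold n in *; lia.
    - intros E. apply pole_index_inj in E. lia. }
  assert (Hpall : forall w : C, w <> 0 -> (Cmod w < R1)%R -> bJ q w = 0 -> exists i, (i < n)%nat /\ w = p i).
  { intros w Hw0 Hw H. destruct (bJ_zero_is_zk w Hw0 H) as [k [Hk ->]].
    destruct (zk_bJ k Hk) as [_ [_ [_ Hm]]]. rewrite Hm in Hw.
    destruct (pole_index_surj N k Hk) as [i [Hi1 Hi2]].
    - destruct (Z_lt_le_dec (Z.of_nat N) (Z.abs k)); [|lia].
      pose proof (zk_le (Z.of_nat (S N)) (Z.abs k) ltac:(lia)). unfold R1 in Hw. lra.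
    - exists i. split; auto. unfold p. rewrite Hi2. reflexivity. }
  set (F := fun z => bE q (z / 2 * (z / 2))).
  assert (HF : holo F R1) by (exact (bE_half_holo q R1 ltac:(lra))).
  assert (JF : forall z, bJ q z = (z / 2) ^ q * F z) by (intros; apply bJ_bE).
  assert (N2 : forall z : C, z <> 0 -> (z / 2) ^ q <> 0).
  { intros z H. apply Cpow_nz. apply Cmult_neq_0; auto. apply Cmod_pos_neq.
    rewrite Cmod_inv, Cmod_R, Rabs_pos_eq by (try apply C2_neq_0; lra). lra. }
  assert (Fp : forall i, (i < n)%nat -> F (p i) = 0).
  { intros i Hi. destruct (HpJ i Hi) as [E _]. rewrite JF in E.
    replace (F (p i)) with ((p i / 2) ^ q * F (p i) / (p i / 2) ^ q) by (field; auto).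
    rewrite E. field. auto. }
  destruct (holo_factor F R1 p n HF) as [U [HU HFU]]; auto.
  { intros i Hi. specialize (Hpm i Hi). lra. }
  (* A zero of U is a nonzero zero of J_q inside the disc, hence some p_i. There the linear factor
     vanishes as well, so the product rule would make the derivative of J_q vanish, against
     simplicity. *)
  assert (HU0 : forall z, (Cmod z < R1)%R -> U z <> 0).
  { intros z Hzr E. 
    assert (EF : F z = 0) by (rewrite HFU, E by auto; ring).
    assert (Hz0 : z <> 0).
    { intros ->. unfold F in EF. replace (0 / 2 * (0 / 2)) with (RtoC 0) in EF by field.
      apply (bE_0_neq q EF). }
    destruct (Hpall z Hz0 Hzr) as [i [Hi ->]]. rewrite JF, EF. ring.
    destruct (HpJ i Hi) as [_ ND]. apply ND.
    apply cdv_unique with (1 := bJ_cdv q (p i)).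
    destruct (holo_cdv U R1 HU) as [U' [_ DU]].
    destruct (cprod_cdv (fun l w => w - p l) n (p i)) as [D HD].
    { intros l _. eexists. apply cdv_minus. apply cdv_id. apply cdv_const. }
    destruct (cdv_half_pow q (p i)) as [D2 HD2].
    apply cdv_ext_loc with (fun w => (w / 2) ^ q * (cprod (fun l => w - p l) n * U w)) (R1 - Cmod (p i))%R; [lra| |].
    - intros w Hw. rewrite JF, HFU; auto. replace w with (w - p i + p i) by ring.
      eapply Rle_lt_trans. apply Cmod_triangle. lra.
    - eapply cdv_val; [|apply (cdv_mult (fun w => (w / 2) ^ q) _ _ _ _ HD2 (cdv_mult _ _ _ _ _ HD (DU _ Hzr)))].
      cbv beta. rewrite E, (cprod_eq_0 (fun l => p i - p l) n i Hi) by ring. ring. }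
  (* The factor 2^q comes from the reciprocal of (z/2)^q, whose z^q goes into the pole at 0. *)
  assert (HW : holo (fun z => RtoC 2 ^ q * / U z) R0).
  { apply holo_scal. apply holo_inv with R1; auto. lra. }
  destruct (partial_fractions_at_0 _ R0 p n q ltac:(lra) HW) as [al [be [K [HK HPF]]]]; auto.
  { intros i Hi. specialize (Hpm i Hi). lra. }
  assert (Hdec : forall z, (Cmod z < R0)%R -> bJ q z <> 0 ->
    / bJ q z = csum (fun i => al i / (z - p i)) n + csum (fun j => be j / z ^ S j) q + K z).
  { intros z Hzr HJ.
    assert (Hzp : forall i, (i < n)%nat -> z <> p i).
    { intros i Hi ->. apply HJ. apply HpJ; auto. }
    assert (Hq : q = O \/ z <> 0).
    { destruct (Nat.eq_dec q 0) as [|Hq]; auto. right. intros ->. apply HJ. rewrite JF.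
      destruct (Nat.neq_0_r q) as [[k ->] _]; auto. rewrite Cpow_S. unfold Cdiv. ring. }
    rewrite <- HPF by auto. rewrite JF, HFU by lra.
    assert (NP : cprod (fun i => z - p i) n <> 0).
    { apply cprod_neq_0. intros i Hi. apply Cminus_neq_0; auto. }
    assert (NU : U z <> 0) by (apply HU0; lra).
    assert (N3 : RtoC 2 ^ q <> 0) by (apply Cpow_nz, C2_neq_0).
    replace ((z / 2) ^ q) with (z ^ q * / RtoC 2 ^ q)
      by (unfold Cdiv; rewrite Cpow_mult_l, Cpow_inv by apply C2_neq_0; reflexivity).
    destruct Hq as [Hq|Hq].
    - rewrite Hq. simpl. field. auto.
    - pose proof (Cpow_nz z q Hq). field. auto. }
  (* The residue: multiplying the decomposition by J_q(z) (z - p_i) gives z - p_i = J_q(z) (al_i +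
     (z - p_i) rest(z)) near p_i, and differentiating at p_i gives 1 = J_q'(p_i) al_i. *)
  assert (Hal : forall i, (i < n)%nat -> al i = / bJ' q (p i)).
  { intros i Hi. destruct (HpJ i Hi) as [J0 J1]. specialize (Hpm i Hi).
    set (rest := fun z => csum (fun l => if Nat.eq_dec l i then RtoC 0 else al l / (z - p l)) n
         + csum (fun j => be j / z ^ S j) q + K z).
    assert (Drest : exists l, cdv rest (p i) l).
    { destruct (csum_cdv (fun l z => if Nat.eq_dec l i then RtoC 0 else al l / (z - p l)) n (p i)) as [l1 H1].
      { intros l Hl. destruct (Nat.eq_dec l i). eexists; apply cdv_const.
        eexists. apply cdv_scal. apply cdv_shift_pole.
        destruct (Nat.lt_ge_cases l i). apply not_eq_sym, Hpd; lia. apply Hpd; lia. }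
      destruct (csum_cdv (fun j z => be j / z ^ S j) q (p i)) as [l2 H2].
      { intros j Hj. eexists. apply cdv_scal. apply (cdv_inv (fun z => z ^ S j)).
        apply Cpow_nz; auto. apply cdv_pow. }
      destruct (holo_cdv K R0 HK) as [K' [_ H3]].
      eexists. apply cdv_plus. apply cdv_plus; [apply H1 | apply H2]. apply H3. lra. }
    destruct Drest as [l Dl].
    assert (Hm1 : (0 < Cmod (bJ' q (p i)))%R) by (apply Cmod_gt_0; auto).
    (* Within d of p_i the linear approximation is off by at most half of its size, so p_i is the
       only zero of J_q there and the decomposition applies at the other points. *)
    destruct (proj1 (cdv_iff _ _ _) (bJ_cdv q (p i)) (Cmod (bJ' q (p i)) / 2)%R ltac:(lra)) as [d [Hd Hiso]].
    assert (D1 : cdv (fun z => z - p i) (p i) (bJ' q (p i) * al i)).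
    { apply cdv_ext_loc with (fun z => bJ q z * (al i + (z - p i) * rest z)) (Rmin d (R0 - Cmod (p i))).
      - apply Rmin_pos; lra.
      - intros w Hw.
        destruct (Rmin_Rgt_l _ _ _ Hw) as [Hw1 Hw2].
        destruct (classic (w = p i)) as [->|Nw]. rewrite J0. ring.
        assert (Nw' : w - p i <> 0) by (apply Cminus_neq_0; auto).
        assert (NJ : bJ q w <> 0).
        { intros E. specialize (Hiso w Hw1). rewrite E, J0 in Hiso.
          replace (0 - 0 - (w - p i) * bJ' q (p i)) with (- ((w - p i) * bJ' q (p i))) in Hiso by ring.
          rewrite Cmod_opp, Cmod_mult in Hiso. apply Cmod_gt_0 in Nw'. nra. }
        assert (Hwr : (Cmod w < R0)%R).
        { replace w with (w - p i + p i) by ring. eapply Rle_lt_trans. apply Cmod_triangle. lra. }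
        assert (E : csum (fun l => al l / (w - p l)) n = al i / (w - p i) +
           csum (fun l => if Nat.eq_dec l i then RtoC 0 else al l / (w - p l)) n).
        { exact (csum_remove (fun l => al l / (w - p l)) n i Hi). }
        pose proof (Hdec w Hwr NJ) as E2. rewrite E in E2.
        transitivity (bJ q w * (w - p i) * / bJ q w); [|field; auto].
        rewrite E2. unfold rest. field. auto.
      - eapply cdv_val; [|apply (cdv_mult _ _ _ _ _ (bJ_cdv q (p i)) (cdv_plus _ _ _ _ _ (cdv_const (al i) _)
          (cdv_mult (fun z => z - p i) _ _ _ _ (cdv_minus _ _ _ _ _ (cdv_id _) (cdv_const (p i) _)) Dl)))].
        cbv beta. rewrite J0. ring. }
    assert (E1 : bJ' q (p i) * al i = 1 - 0).
    { apply (cdv_unique _ _ _ _ D1). apply cdv_minus. apply cdv_id. apply cdv_const. }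
    replace (al i) with (/ bJ' q (p i) * (bJ' q (p i) * al i)) by (field; auto). rewrite E1. ring. }
  (* On the disc reaching to the first zero, the terms with poles p_i are analytic and join the
     regular part, so only the powers of 1/z form the principal part. *)
  destruct (is_laurent_of_parts (inv_besselJ q) (fun z => csum (fun i => al i / (z - p i)) n + K z) be q (zk 1) Hz1) as [a [Ha1 Ha2]].
  { apply holo_plus.
    - apply holo_csum. intros i Hi. apply (holo_scal (al i) (fun z => / (z - p i))). apply holo_pole; auto.
      specialize (Hpm i Hi). lra.
    - apply holo_weaken with R0; auto. pose proof (zk_le 1 (Z.of_nat N) ltac:(lia)). lra. }
  { intros z Hzr. assert (Hz0 : z <> 0) by (apply Cmod_pos_neq; lra).
    assert (NJ : bJ q z <> 0).
    { intros E. destruct (bJ_zero_is_zk z Hz0 E) as [k [Hk ->]].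
      destruct (zk_bJ k Hk) as [_ [_ [_ Hm]]]. rewrite Hm in Hzr.
      pose proof (zk_le 1 (Z.abs k) ltac:(lia)). lra. }
    unfold inv_besselJ. rewrite besselJ_of_nat. 
    transitivity (/ bJ q z). field; auto. rewrite Hdec. ring.
    pose proof (zk_le 1 (Z.of_nat N) ltac:(lia)). lra. auto. }
  exists be, K, R0. split; [lra|]. split; auto. split; [|split].
  - intros j Hj. rewrite (laurent_coeff_eq _ _ a); auto.
  - exists a; auto.
  - intros z Hzr HJ. rewrite Hdec by auto. do 2 f_equal. apply csum_ext.
    intros i Hi. rewrite Hal by auto. reflexivity.
Qed.

End Zeros.

(* Cauchy's formula for the regular part [K]: the polar terms integrate to zero
   against w / (w - z), and what is left is the integral of w / (J_q(w) (w - z)). *)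
Lemma regular_part_bound (q n m : nat) (c r R0 : R) (p al be : nat -> C) (K : C -> C) (z : C) :
  (0 < c)%R -> (0 < r < R0)%R -> holo K R0 ->
  (forall w, Cmod w = r -> (c / sqrt r * exp (Rabs (Im w)) <= Cmod (bJ q w))%R) ->
  (forall i, (i < n)%nat -> (Cmod (p i) < r)%R) ->
  (forall w, (Cmod w < R0)%R -> bJ q w <> 0 ->
    / bJ q w = csum (fun i => al i / (w - p i)) n + csum (fun j => be j / w ^ S j) m + K w) ->
  (2 * Cmod z <= r)%R -> (forall i, (i < n)%nat -> z <> p i) -> (m = O \/ z <> 0) ->
  (Cmod (K z) <= 64 / (c * sqrt r))%R.
Proof.
  intros Hc Hr HK Hlow Hp Hdec Hz Hzp Hm.
  pose proof (Cmod_ge_0 z) as Hz0. assert (Hzr : (Cmod z < r)%R) by lra.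
  assert (Hsr : (0 < sqrt r)%R) by (apply sqrt_lt_R0; lra).
  assert (Hss : (sqrt r * sqrt r = r)%R) by (apply sqrt_sqrt; lra).
  assert (Hcs : (0 < c / sqrt r)%R) by (apply Rdiv_lt_0_compat; auto).
  pose proof two_PI_pos as Hpi.
  assert (Mw : forall t, Cmod (circ r t) = r) by (intros; apply Cmod_circ; lra).
  set (Q := fun t => circ r t / (circ r t - z)).
  assert (TQ : forall t, tc Q t) by (intros; apply tc_circ_quot; auto).
  assert (HJ : forall t, bJ q (circ r t) <> 0).
  { intros t. apply Cmod_pos_neq. eapply Rlt_le_trans; [|apply Hlow; auto].
    apply Rmult_lt_0_compat; auto. apply exp_pos. }
  set (g := fun t => / bJ q (circ r t) * Q t).
  assert (Tg : forall t, tc g t).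
  { intros t. apply tc_mult; auto. apply (tc_inv _ (fun t => bJ q (circ r t))); auto.
    eapply cder_tc. apply bJ_cder. apply cder_circ. }
  destruct (oint_csum_0 (fun i t => al i * (/ (circ r t - p i) * Q t)) n) as [TA IA].
  { intros i Hi t. apply (tc_mult _ (fun _ => al i) (fun t => / (circ r t - p i) * Q t)). apply tc_const.
    apply (tc_mult _ (fun t => / (circ r t - p i))); auto. apply tc_pole; auto. }
  { intros i Hi. unfold oint. rewrite CInt_scal; [|lra|].
    - fold (oint (fun t => / (circ r t - p i) * Q t)). unfold Q. rewrite oint_pole by (auto; lra). ring.
    - intros t _. apply (tc_mult _ (fun t => / (circ r t - p i))); auto. apply tc_pole; auto. }
  destruct (oint_csum_0 (fun j t => be j * (/ circ r t ^ S j * Q t)) m) as [TB IB].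
  { intros j Hj t. apply (tc_mult _ (fun _ => be j) (fun t => / circ r t ^ S j * Q t)). apply tc_const.
    apply (tc_mult _ (fun t => / circ r t ^ S j)); auto. apply tc_circ_inv_pow; lra. }
  { intros j Hj. destruct Hm as [->|Hm]; [lia|]. unfold oint. rewrite CInt_scal; [|lra|].
    - fold (oint (fun t => / circ r t ^ S j * Q t)). unfold Q. rewrite oint_inv_pow_quot by (auto; lra). ring.
    - intros t _. apply (tc_mult _ (fun t => / circ r t ^ S j)); auto. apply tc_circ_inv_pow; lra. }
  assert (E : K z * RtoC (2 * PI) = oint g).
  { rewrite <- (holo_cauchy K r R0 z) by auto.
    transitivity (oint (fun t => 1 * (g t - (csum (fun i => al i * (/ (circ r t - p i) * Q t)) n
       + csum (fun j => be j * (/ circ r t ^ S j * Q t)) m)))).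
    - apply oint_ext. intros t. unfold g. rewrite Hdec; [|rewrite Mw; lra|auto].
      rewrite (csum_ext (fun i => al i * (/ (circ r t - p i) * Q t)) (fun i => Q t * (al i / (circ r t - p i))))
        by (intros; unfold Cdiv; ring).
      rewrite (csum_ext (fun j => be j * (/ circ r t ^ S j * Q t)) (fun j => Q t * (be j / circ r t ^ S j)))
        by (intros; unfold Cdiv; ring).
      rewrite !csum_scal. fold (Q t). ring.
    - rewrite oint_lin; auto.
      + unfold oint at 2. rewrite CInt_plus; auto; [|lra].
        unfold oint in IA, IB. rewrite IA, IB. ring.
      + intros t. apply (tc_plus _ (fun t => csum (fun i => al i * (/ (circ r t - p i) * Q t)) n)); auto. }
  (* The integrand is at most (sqrt(r)/c) e^(-r |sin t|) from the lower bound on J_q, times 2 from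
     the kernel, where |w - z| >= r/2 because 2 |z| <= r. Jordan's lemma then turns sqrt(r) into
     sqrt(r)/r. *)
  assert (B : (Cmod (oint g) <= 32 * (2 * sqrt r / c) / r)%R).
  { apply oint_exp_sin_bound; auto; [lra | left; apply Rdiv_lt_0_compat; lra |].
    intros t. unfold g. rewrite Cmod_mult, Cmod_inv by auto.
    specialize (Hlow (circ r t) (Mw t)).
    replace (Rabs (Im (circ r t))) with (r * Rabs (sin t))%R in Hlow.
    2:{ unfold circ, cis. simpl. rewrite <- (Rabs_pos_eq r) at 1 by lra. rewrite <- Rabs_mult. f_equal. ring. }
    rewrite exp_Ropp. set (y := exp (r * Rabs (sin t))) in *. assert (Hy : (0 < y)%R) by apply exp_pos.
    assert (HQ : (Cmod (Q t) <= 2)%R).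
    { pose proof (Cmod_sub_ge (circ r t) z) as S. rewrite Mw in S.
      unfold Q. rewrite Cmod_div, Mw by (apply circ_sub_neq_0; auto).
      apply (Rle_div_l r 2); lra. }
    replace (2 * sqrt r / c * / y)%R with (/ (c / sqrt r * y) * 2)%R by (field; lra).
    apply Rmult_le_compat; try apply Cmod_ge_0; auto.
    - left. apply Rinv_0_lt_compat. apply Cmod_gt_0; auto.
    - apply Rinv_le_contravar; auto. apply Rmult_lt_0_compat; auto. }
  rewrite <- E, Cmod_mult, Cmod_R, Rabs_pos_eq in B by lra.
  replace (32 * (2 * sqrt r / c) / r)%R with (64 / (c * sqrt r))%R in B.
  2:{ rewrite <- Hss at 3. field. lra. }
  (* The factor 2 pi on the left is at least 1 and is dropped. *)
  pose proof (Cmod_ge_0 (K z)). pose proof PI2_3_2. nra.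
Qed.

Lemma pole_coeff_eq (q : nat) (zk : Z -> R) (k : Z) : pole_coeff q zk k = 1 / bJ' q (RtoC (zk k)).
Proof.
  unfold pole_coeff. f_equal. apply is_C_derive_unique.
  apply cdv_ext with (bJ q); [|apply bJ_cdv]. intros w. symmetry. apply besselJ_of_nat.
Qed.

Lemma A0den_csum (q : nat) (z : C) (be : nat -> C) :
  (forall j, (j < q)%nat -> laurent_coeff (inv_besselJ q) 0 (- Z.of_nat (S j))%Z = be j) ->
  A0den q z = csum (fun j => be j / z ^ S j) q.
Proof.
  intros H. unfold A0den. destruct q as [|q]; [reflexivity|].
  rewrite sum_n_m_csum. apply csum_ext. intros j Hj. rewrite H by auto. reflexivity.
Qed.

Theorem mainTheorem8 :
  forall (q : nat) (zk : Z -> R),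
  bessel_zeros q zk ->
  (forall k : Z, k <> 0%Z ->
     ex_derive (K := C_AbsRing) (V := C_NormedModule)
       (besselJ (Z.of_nat q)) (RtoC (zk k)) /\
     C_derive (besselJ (Z.of_nat q)) (RtoC (zk k)) <> 0 /\
     pole_coeff q zk k =
       2 / (besselJ (Z.of_nat q - 1) (RtoC (zk k)) -
            besselJ (Z.of_nat q + 1) (RtoC (zk k)))) /\
  (exists a : Z -> C, is_laurent (inv_besselJ q) 0 a) /\
  forall z : C, besselJ (Z.of_nat q) z <> 0 ->
  exists S : C,
    is_sym_sum (fun k => pole_coeff q zk k / (z - RtoC (zk k))) S /\
    A0den q z + S <> 0 /\
    besselJ (Z.of_nat q) z = 1 / (A0den q z + S).
Proof.
  intros q zk Hz.
  assert (HD : forall k, cdv (besselJ (Z.of_nat q)) (RtoC (zk k)) (bJ' q (RtoC (zk k)))).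
  { intros k. apply cdv_ext with (bJ q); [|apply bJ_cdv]. intros w. symmetry. apply besselJ_of_nat. }
  assert (Hcrit : forall N, (1 <= N)%nat -> exists r, (zk (Z.of_nat N) < r < zk (Z.of_nat (S N)))%R /\ rH q r = 0%R).
  { intros N HN. apply critical_point_between.
    - split. apply (zk_pos q zk Hz). lia. apply (zk_lt q zk Hz). lia.
    - apply (zk_zero q zk Hz). lia.
    - apply (zk_zero q zk Hz). lia. }
  split; [|split].
  - intros k Hk. destruct (zk_bJ q zk Hz k Hk) as [_ [H1 _]]. split; [|split].
    + eexists. apply HD.
    + rewrite (is_C_derive_unique _ _ _ (HD k)). exact H1.
    + rewrite pole_coeff_eq, besselJ_diff. pose proof C2_neq_0. field. auto.
  - destruct (Hcrit 1%nat) as [r [Hr _]]; auto.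
    destruct (bJ_decomposition q zk Hz 1 r) as [be [K [R0 [_ [_ [_ [Ha _]]]]]]]; auto.
  - intros z HJ. rewrite besselJ_of_nat in HJ.
    (* With this candidate for the sum the closing identity is immediate; what remains is that the
       symmetric partial sums converge to it. *)
    exists (/ bJ q z - A0den q z).
    assert (HS : A0den q z + (/ bJ q z - A0den q z) = / bJ q z) by ring.
    rewrite HS, besselJ_of_nat. split; [|split].
    2:{ intros E. apply HJ. replace (bJ q z) with (bJ q z * (bJ q z * / bJ q z)) by (field; auto).
        rewrite E. ring. }
    2:{ field. auto. }
    destruct (circle_lower_bound q) as [c [r0 [Hc [Hr0 Hlow]]]].
    assert (Hq : q = O \/ z <> 0).
    { destruct (Nat.eq_dec q 0) as [|Hq]; auto. right. intros ->. apply HJ. rewrite bJ_bE.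
      destruct q; [lia|]. rewrite Cpow_S. unfold Cdiv. ring. }
    apply filterlim_locally. intros eps.
    (* The bound 64/(c sqrt(r)) falls below eps as soon as sqrt(r) > y. Hence N is taken so large
       that z_N, and with it r, exceeds y^2, the threshold r0 and 2 |z|. *)
    set (y := (64 / (c * eps))%R).
    assert (Hy : (0 < y)%R).
    { apply Rdiv_lt_0_compat; [lra|]. apply Rmult_lt_0_compat; auto. apply cond_pos. }
    destruct (zk_unbounded q zk Hz (Rmax r0 (Rmax (2 * Cmod z) (y * y)))) as [N0 [HN01 HN0]].
    exists (Z.to_nat N0). intros N HN.
    destruct (Hcrit N) as [r [Hr Hcr]]; [lia|].
    specialize (HN0 (Z.of_nat N) ltac:(lia)).
    pose proof (Rmax_l r0 (Rmax (2 * Cmod z) (y * y))).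
    pose proof (Rmax_r r0 (Rmax (2 * Cmod z) (y * y))).
    pose proof (Rmax_l (2 * Cmod z) (y * y)). pose proof (Rmax_r (2 * Cmod z) (y * y)).
    destruct (bJ_decomposition q zk Hz N r) as [be [K [R0 [HR0 [HK [Hbe [_ Hdec]]]]]]]; auto; [lia|].
    pose proof (Cmod_ge_0 z).
    assert (HzR : (Cmod z < R0)%R) by lra.
    assert (Hpz : forall k, k <> 0%Z -> z <> RtoC (zk k)).
    { intros k Hk ->. apply HJ. apply (zk_bJ q zk Hz k Hk). }
    (* The defect of the N-th symmetric partial sum is exactly the regular part at z, since the
       polar part at 0 is [A0den] for every N. *)
    assert (EK : / bJ q z - A0den q z - sum_n_m (G := C_AbelianMonoid)
       (fun k => pole_coeff q zk (Z.of_nat k) / (z - RtoC (zk (Z.of_nat k)))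
         + pole_coeff q zk (- Z.of_nat k)%Z / (z - RtoC (zk (- Z.of_nat k)%Z))) 1 N = K z).
    { rewrite <- (csum_pole_index (fun k => pole_coeff q zk k / (z - RtoC (zk k)))).
      rewrite (A0den_csum q z be Hbe), (Hdec z HzR HJ).
      rewrite (csum_ext (fun i => pole_coeff q zk (pole_index i) / (z - RtoC (zk (pole_index i))))
        (fun i => / bJ' q (RtoC (zk (pole_index i))) / (z - RtoC (zk (pole_index i))))).
      - ring.
      - intros i Hi. rewrite pole_coeff_eq. unfold Cdiv. ring. }
    apply ball_of_Cmod. rewrite Cmod_sub_comm.
    match goal with |- (Cmod ?x < _)%R => replace x with (K z) by (symmetry; exact EK) end.
    eapply Rle_lt_trans.
    + apply (regular_part_bound q (2 * N) q c r R0 (fun i => RtoC (zk (pole_index i)))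
        (fun i => / bJ' q (RtoC (zk (pole_index i)))) be K z); auto; try lra.
      * intros w Hw. apply Hlow; auto. lra.
      * intros i Hi. destruct (pole_index_spec N i Hi) as [H4 H5].
        destruct (zk_bJ q zk Hz _ H4) as [_ [_ [_ ->]]].
        eapply Rle_lt_trans; [apply (zk_le q zk Hz _ (Z.of_nat N)); lia | lra].
      * intros i Hi. apply Hpz. apply (pole_index_spec N i Hi).
    + assert (Hs : (y < sqrt r)%R).
      { rewrite <- (sqrt_square y) by lra. apply sqrt_lt_1_alt. split; nra. }
      pose proof (cond_pos eps) as He.
      apply (Rlt_div_l _ _ (c * sqrt r)). apply Rmult_lt_0_compat; lra.
      assert (E : (c * eps * y = 64)%R) by (unfold y; field; split; lra).
      rewrite <- E. assert (0 < c * eps)%R by (apply Rmult_lt_0_compat; auto). nra.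
Qed.
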